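(* Assume that Conditions 1, 2, 3, 4 and 5 listed in the context hold. Then, for predetermined working correlation matrices $\mathbf{W}$ and a nonrandom penalty vector $\boldsymbol{\lambda}$, as $n\to\infty$, $$\operatorname{LsoCV}(\mathbf{W},\boldsymbol{\lambda})-U(\mathbf{W},\boldsymbol{\lambda})=o_p\bigl(L(\mathbf{W},\boldsymbol{\lambda})\bigr)$$ and, therefore, $$\operatorname{LsoCV}(\mathbf{W},\boldsymbol{\lambda})-L(\mathbf{W},\boldsymbol{\lambda})-\frac1n\boldsymbol{\varepsilon}^T\boldsymbol{\varepsilon}=o_p\bigl(L(\mathbf{W},\boldsymbol{\lambda})\bigr).$$
   Context: **Model.** There are $n$ independent subjects; subject $i$ has $n_i$ observations, $N=\sum_{i=1}^n n_i$ (the $n_i$ need not be bounded). $\mathbf{y}_i\in\mathbb{R}^{n_i}$ is the response vector of subject $i$. Given the covariates (all expectations, variances and probabilities are conditional on the covariates, which are treated as fixed), $E(\mathbf{y}_i)=\boldsymbol{\mu}_i$ and $\operatorname{Cov}(\mathbf{y}_i)=\boldsymbol{\Sigma}_i$ (an $n_i\times n_i$ positive definite matrix). The mean has components $\mu_{ij}=\mathbf{x}_{ij0}\boldsymbol{\beta}_0+\sum_{k=1}^m f_k(\mathbf{x}_{ijk})$ with unknown vector $\boldsymbol\beta_0$ and unknown smooth functions $f_k$. Put $\mathbf{Y}=(\mathbf{y}_1^T,\dots,\mathbf{y}_n^T)^T$, $\boldsymbol{\mu}=(\boldsymbol{\mu}_1^T,\dots,\boldsymbol{\mu}_n^T)^T$,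 $\boldsymbol{\varepsilon}=\mathbf{Y}-\boldsymbol{\mu}$ with subvectors $\boldsymbol{\varepsilon}_i=\mathbf{y}_i-\boldsymbol{\mu}_i$, $\boldsymbol{\Sigma}=\operatorname{diag}\{\boldsymbol{\Sigma}_1,\dots,\boldsymbol{\Sigma}_n\}$. **Estimator.** $\mathbf{X}_i$ is an $n_i\times p$ design matrix (obtained by basis expansion of the $f_k$; $\boldsymbol{\mu}_i$ is approximated by $\mathbf{X}_i\boldsymbol{\beta}$ but need not lie in its range), $\mathbf{X}=(\mathbf{X}_1^T,\dots,\mathbf{X}_n^T)^T$; $\mathbf{W}_i$ is a symmetric positive definite $n_i\times n_i$ working correlation matrix, possibly misspecified (not related to $\boldsymbol\Sigma_i$), $\mathbf{W}=\operatorname{diag}\{\mathbf{W}_1,\dots,\mathbf{W}_n\}$; ''predetermined'' means that $\mathbf{W}$ is determined by observation times and/or covariates (so it is nonrandom given the covariates). $\mathbf{S}_1,\dots,\mathbf{S}_m$ are symmetric positive semi-definite $p\times p$ penalty matrices and $\boldsymbol{\lambda}=(\lambda_1,\dots,\lambda_m)$, $\lambda_k\ge0$. The estimate of $\boldsymbol\mu$ is $\mathbf{X}\hat{\boldsymbol\beta}=\mathbf{A}\mathbf{Y}$, where $\hat{\boldsymbol\beta}$ minimizes $\sum_{i}(\mathbf{y}_i-\mathbf{X}_i\boldsymbol\beta)^T\mathbf{W}_i^{-1}(\mathbf{y}_i-\mathbf{X}_i\boldsymbol\beta)+\sum_k\lambda_k\boldsymbol\beta^T\mathbf{S}_k\boldsymbol\beta$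 and $$\mathbf{A}=\mathbf{A}(\mathbf{W},\boldsymbol\lambda)=\mathbf{X}\Bigl(\mathbf{X}^T\mathbf{W}^{-1}\mathbf{X}+\sum_{k=1}^m\lambda_k\mathbf{S}_k\Bigr)^{-1}\mathbf{X}^T\mathbf{W}^{-1},$$ the inverted matrix being assumed invertible. All quantities ($n_i$, $p$, $\mathbf X$, $\mathbf W$, $\boldsymbol\lambda$, ...) may depend on $n$. **Leave-subject-out cross-validation.** Let $\hat{\boldsymbol\beta}^{[-i]}$ be the minimizer over $\boldsymbol\beta$ of $\sum_{j\ne i}(\mathbf{y}_j-\mathbf{X}_j\boldsymbol\beta)^T\mathbf{W}_j^{-1}(\mathbf{y}_j-\mathbf{X}_j\boldsymbol\beta)+\sum_k\lambda_k\boldsymbol\beta^T\mathbf{S}_k\boldsymbol\beta$ (same method, leaving out all data of subject $i$), and $\hat\mu^{[-i]}(\mathbf{X}_i)=\mathbf{X}_i\hat{\boldsymbol\beta}^{[-i]}$. Then $$\operatorname{LsoCV}(\mathbf{W},\boldsymbol\lambda)=\frac1n\sum_{i=1}^n\{\mathbf{y}_i-\hat\mu^{[-i]}(\mathbf{X}_i)\}^T\{\mathbf{y}_i-\hat\mu^{[-i]}(\mathbf{X}_i)\}.$$ **Loss, risk, $U$.** $$L(\mathbf{W},\boldsymbol\lambda)=\frac1n(\mathbf{A}\mathbf{Y}-\boldsymbol\mu)^T(\mathbf{A}\mathbf{Y}-\boldsymbol\mu),\qquad R(\mathbf{W},\boldsymbol\lambda)=E\{L(\mathbf{W},\boldsymbol\lambda)\}=\frac1n\boldsymbol\mu^T(\mathbf{I}-\mathbf{A})^T(\mathbf{I}-\mathbf{A})\boldsymbol\mu+\frac1n\operatorname{tr}(\mathbf{A}^T\mathbf{A}\boldsymbol\Sigma),$$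 $$U(\mathbf{W},\boldsymbol\lambda)=\frac1n\mathbf{Y}^T(\mathbf{I}-\mathbf{A})^T(\mathbf{I}-\mathbf{A})\mathbf{Y}+\frac2n\operatorname{tr}(\mathbf{A}\boldsymbol\Sigma).$$ **Notation.** $\tilde{\mathbf{A}}=\mathbf{W}^{-1/2}\mathbf{A}\mathbf{W}^{1/2}$ (symmetric); $\mathbf{A}_{ii}$ and $\mathbf{C}_{ii}$ are the $i$th $n_i\times n_i$ diagonal blocks (subject $i$) of $\mathbf{A}$ and $\tilde{\mathbf{A}}^2$; $\lambda_{\max}(\cdot)$ is the largest eigenvalue; $\xi(\boldsymbol\Sigma,\mathbf{W})=\lambda_{\max}(\boldsymbol\Sigma\mathbf{W}^{-1})\lambda_{\max}(\mathbf{W})$; $\mathbf{e}_i=\boldsymbol\Sigma_i^{-1/2}\boldsymbol\varepsilon_i$. **Conditions** (asymptotics as $n\to\infty$). - Condition 1: for some constant $K>0$, $E\{(\mathbf{u}_i^T\mathbf{e}_i)^4\}\le K$ for all $i=1,\dots,n$ and all $\mathbf{u}_i\in\mathbb{R}^{n_i}$ with $\mathbf{u}_i^T\mathbf{u}_i=1$. - Condition 2: (i) $\max_{1\le i\le n}\operatorname{tr}(\mathbf{A}_{ii})=O(\operatorname{tr}(\mathbf{A})/n)=o(1)$ (in particular $\operatorname{tr}(\mathbf A)/n\to0$); (ii) $\max_{1\le i\le n}\operatorname{tr}(\mathbf{C}_{ii})=o(1)$. - Condition 3: $\xi(\boldsymbol\Sigma,\mathbf{W})/n=o(R(\mathbf{W},\boldsymbol\lambda))$.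 - Condition 4: $\xi(\boldsymbol\Sigma,\mathbf{W})\{n^{-1}\operatorname{tr}(\mathbf{A})\}^2/\{n^{-1}\operatorname{tr}(\mathbf{A}^T\mathbf{A}\boldsymbol\Sigma)\}=o(1)$. - Condition 5: $\lambda_{\max}(\mathbf{W})\lambda_{\max}(\mathbf{W}^{-1})\,n^{-2}\operatorname{tr}(\mathbf{A})^2=o(1)$. *)

(* Defs.v *)
From HB Require Import structures.
From mathcomp Require Import all_boot all_order all_algebra.
From mathcomp Require Import all_classical all_reals all_analysis.

Set Implicit Arguments.
Unset Strict Implicit.
Unset Printing Implicit Defensive.

Import Order.TTheory GRing.Theory Num.Theory.
Import numFieldNormedType.Exports.

Local Open Scope classical_set_scope.
Local Open Scope ring_scope.

Definition sqnorm (R : realType) (k : nat) (u : 'cV[R]_k) : R := (u^T *m u) 0 0.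

Definition qform (R : realType) (k : nat) (M : 'M[R]_k) (u : 'cV[R]_k) : R :=
  (u^T *m M *m u) 0 0.

Definition posdefmx (R : realType) (k : nat) (M : 'M[R]_k) : Prop :=
  M^T = M /\ forall u : 'cV[R]_k, u != 0 -> 0 < qform M u.

Definition possemidefmx (R : realType) (k : nat) (M : 'M[R]_k) : Prop :=
  M^T = M /\ forall u : 'cV[R]_k, 0 <= qform M u.

(* The symmetric positive semi-definite square root, which exists and is unique
   when M is symmetric positive semi-definite; 0 is only a junk default. *)
Definition sqrtmx (R : realType) (k : nat) (M : 'M[R]_k) : 'M[R]_k :=
  xget 0 [set B : 'M[R]_k | possemidefmx B /\ B *m B = M].

(* Largest real eigenvalue. It is applied to W, W^-1 and Sigma W^-1 only, all of
   whose complex eigenvalues are real; the set is finite. *)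
Definition lambda_max (R : realType) (k : nat) (M : 'M[R]_k) : R :=
  sup [set a : R | eigenvalue M a].

(* The nonrandom data of the problem with n subjects: dimensions, covariates, mean
   components, response covariances, and the ingredients of the estimators. The
   design need not be related to the mean, nor the working correlation to the
   covariance; no regularity is required of the mean components. *)
Record model (R : realType) (n : nat) := Model {
  nobs : 'I_n -> nat;
  ncomp : nat;
  dim0 : nat;
  dimc : 'I_ncomp -> nat;
  covar0 : forall i : 'I_n, 'I_(nobs i) -> 'rV[R]_dim0;
  covar : forall (i : 'I_n) (j : 'I_(nobs i)) (k : 'I_ncomp), 'rV[R]_(dimc k);
  beta0 : 'cV[R]_dim0;
  fcomp : forall k : 'I_ncomp, 'rV[R]_(dimc k) -> R;
  ycov : forall i : 'I_n, 'M[R]_(nobs i);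
  pdim : nat;
  design : forall i : 'I_n, 'M[R]_(nobs i, pdim);
  wcorr : forall i : 'I_n, 'M[R]_(nobs i);
  penalty : 'I_ncomp -> 'M[R]_pdim;
  lam : 'I_ncomp -> R
}.

Arguments nobs {R n} _ _.
Arguments dimc {R n} _ _.
Arguments covar0 {R n} _ _ _.
Arguments covar {R n} _ _ _ _.
Arguments fcomp {R n} _ _ _.
Arguments ycov {R n} _ _.
Arguments design {R n} _ _.
Arguments wcorr {R n} _ _.
Arguments penalty {R n} _ _.
Arguments lam {R n} _ _.

Definition mean (R : realType) (n : nat) (M : model R n) (i : 'I_n) :
    'cV[R]_(nobs M i) :=
  \col_j ((covar0 M i j *m beta0 M) 0 0
          + \sum_(k < ncomp M) fcomp M k (covar M i j k)).

Definition ntot (R : realType) (n : nat) (M : model R n) : nat :=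
  (\sum_(i < n) nobs M i)%N.

Definition muv (R : realType) (n : nat) (M : model R n) : 'cV[R]_(ntot M) :=
  \mxcol_(i < n) mean M i.

Definition Xmx (R : realType) (n : nat) (M : model R n) :
    'M[R]_(ntot M, pdim M) :=
  \mxcol_(i < n) design M i.

Definition Wmx (R : realType) (n : nat) (M : model R n) : 'M[R]_(ntot M) :=
  \mxdiag_(i < n) wcorr M i.

Definition Sigmamx (R : realType) (n : nat) (M : model R n) : 'M[R]_(ntot M) :=
  \mxdiag_(i < n) ycov M i.

Definition penalized_gram (R : realType) (n : nat) (M : model R n) :
    'M[R]_(pdim M) :=
  (Xmx M)^T *m invmx (Wmx M) *m Xmx M + \sum_(k < ncomp M) lam M k *: penalty M k.

Definition Amx (R : realType) (n : nat) (M : model R n) : 'M[R]_(ntot M) :=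
  Xmx M *m invmx (penalized_gram M) *m (Xmx M)^T *m invmx (Wmx M).

Definition Atilde (R : realType) (n : nat) (M : model R n) : 'M[R]_(ntot M) :=
  invmx (sqrtmx (Wmx M)) *m Amx M *m sqrtmx (Wmx M).

Definition Ablock (R : realType) (n : nat) (M : model R n) (i : 'I_n) :
    'M[R]_(nobs M i) :=
  submxblock (Amx M) i i.

Definition Cblock (R : realType) (n : nat) (M : model R n) (i : 'I_n) :
    'M[R]_(nobs M i) :=
  submxblock (Atilde M *m Atilde M) i i.

(* The default 0 of the maxima is harmless: the traces are nonnegative. *)
Definition max_trA (R : realType) (n : nat) (M : model R n) : R :=
  \big[Num.max/0]_(i < n) \tr (Ablock M i).

Definition max_trC (R : realType) (n : nat) (M : model R n) : R :=
  \big[Num.max/0]_(i < n) \tr (Cblock M i).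

Definition xi (R : realType) (n : nat) (M : model R n) : R :=
  lambda_max (Sigmamx M *m invmx (Wmx M)) * lambda_max (Wmx M).

(* A value of the responses, one vector per subject. *)
Definition responses (R : realType) (n : nat) (M : model R n) : Type :=
  forall i : 'I_n, 'cV[R]_(nobs M i).

Definition residual (R : realType) (n : nat) (M : model R n)
    (y : responses M) (i : 'I_n) : 'cV[R]_(nobs M i) :=
  y i - mean M i.

Definition standardized (R : realType) (n : nat) (M : model R n)
    (y : responses M) (i : 'I_n) : 'cV[R]_(nobs M i) :=
  invmx (sqrtmx (ycov M i)) *m residual y i.

Definition loss (R : realType) (n : nat) (M : model R n) (y : responses M) : R :=
  n%:R^-1 * sqnorm (Amx M *m \mxcol_(i < n) y i - muv M).

Definition Ucrit (R : realType) (n : nat) (M : model R n) (y : responses M) : R :=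
  let Y := \mxcol_(i < n) y i in
  n%:R^-1 * (Y^T *m (1%:M - Amx M)^T *m (1%:M - Amx M) *m Y) 0 0
  + 2 / n%:R * \tr (Amx M *m Sigmamx M).

Definition noise (R : realType) (n : nat) (M : model R n) (y : responses M) : R :=
  n%:R^-1 * sqnorm (\mxcol_(i < n) y i - muv M).

Definition lso_objective (R : realType) (n : nat) (M : model R n)
    (y : responses M) (i : 'I_n) (b : 'cV[R]_(pdim M)) : R :=
  \sum_(j < n | j != i) qform (invmx (wcorr M j)) (y j - design M j *m b)
  + \sum_(k < ncomp M) lam M k * qform (penalty M k) b.

Definition lso_minimizer (R : realType) (n : nat) (M : model R n)
    (y : responses M) (i : 'I_n) (b : 'cV[R]_(pdim M)) : Prop :=
  forall b' : 'cV[R]_(pdim M), lso_objective y i b <= lso_objective y i b'.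

(* [b i] is the estimate computed without subject i. *)
Definition lsocv (R : realType) (n : nat) (M : model R n)
    (y : responses M) (b : 'I_n -> 'cV[R]_(pdim M)) : R :=
  n%:R^-1 * \sum_(i < n) sqnorm (y i - design M i *m b i).

Definition observed (d : measure_display) (T : measurableType d) (R : realType)
    (P : probability T R) (n : nat) (M : model R n)
    (y : forall i : 'I_n, 'I_(nobs M i) -> {RV P >-> R}) (w : T) : responses M :=
  fun i => \col_j y i j w.

Definition risk (d : measure_display) (T : measurableType d) (R : realType)
    (P : probability T R) (n : nat) (M : model R n)
    (y : forall i : 'I_n, 'I_(nobs M i) -> {RV P >-> R}) : R :=
  fine 'E_P[fun w => loss (observed y w)].

(* Mutual independence of the n random vectors (y i j)_j: the product rule for
   the sigma-algebras they generate. *)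
Definition independent_vectors (d : measure_display) (T : measurableType d)
    (R : realType) (P : probability T R) (n : nat) (k : 'I_n -> nat)
    (y : forall i : 'I_n, 'I_(k i) -> {RV P >-> R}) : Prop :=
  forall (J : {set 'I_n}) (E : 'I_n -> set T),
    (forall i, i \in J -> g_sigma_preimage (fun j : 'I_(k i) => y i j : T -> R) (E i)) ->
    P (\bigcap_(i in [set` J]) E i) = (\prod_(i in J) P (E i))%E.

(* Z_n = o_p(V_n), in the form that also makes sense where V_n vanishes. *)
Definition little_op (R : realType) (d : nat -> measure_display)
    (T : forall n, measurableType (d n)) (P : forall n, probability (T n) R)
    (Z V : forall n, T n -> R) : Prop :=
  forall e : R, 0 < e ->
    P n [set w | e * `|V n w| < `|Z n w|] @[n --> \oo] --> 0%E.

(* Main.v *)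
(* Let Ad be the block diagonal part of A and eps = Y - mu. By the normal equations,
   the vector r of all leave-subject-out residuals satisfies (1 - Ad) r = Y - A Y. With
   l = A Y - mu, expanding (1 - Ad)^-1 to first order gives
     |r|^2 = |Y - A Y|^2 + 2 eps^T Ad eps - 2 eps^T Ad l + remainder.
   Ad is small for the W^-1-norm, since an operator norm is at most the trace, but it
   is not symmetric: the products with Ad are bounded by the quadratic form of the
   envelope (S/w + w W^-1 S W^-1)/2, taken blockwise, whose expectation at eps is at
   most s w tr A. Linear forms in eps, and quadratic forms with zero diagonal blocks,
   have variances computed from second moments alone; block diagonal quadratic forms
   are sums of independent terms, controlled by fourth moments through the envelope.
   All variances are at most a small multiple of the squared risk, so Chebyshev's
   inequality makes every error term small with respect to the risk; the loss itself
   differs from the risk by such errors, hence the risk can be replaced by the loss. *)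
Require Import Defs.
From HB Require Import structures.
From mathcomp Require Import all_boot all_order all_algebra.
From mathcomp Require Import all_classical all_reals all_analysis.
From mathcomp Require Import measurable_realfun ring lra.

Set Implicit Arguments.
Unset Strict Implicit.
Unset Printing Implicit Defensive.

Import Order.TTheory GRing.Theory Num.Theory.
Import numFieldNormedType.Exports.

Local Open Scope classical_set_scope.
Local Open Scope ring_scope.

(** * Linear algebra *)

(** The obstacle is that Condition 3 only makes s w / n small against the risk, so a variance may
    cost one factor s w but no condition number of W. Comparisons are therefore made between the
    forms of Sigma, S, W and W^-1, where A^T is a contraction, and a Euclidean bound on Ad is used
    only through a factor that Condition 5 makes small. The remainder is not centred, so no variance
    bound can control it. Its first moment is of order s w max tr(A_ii) tr(A) / n, which Conditions
    2 and 4 make small against the variance part tr(A^T A Sigma) / n of the risk. The centred block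
    diagonal form of A uses both rates, since its variance is at most a constant times the product
    of s w / n and that first moment; the one of A^T A uses the traces of the blocks C_ii.
    Everything is proved for a fixed n, with explicit constants and one smallness parameter; limits
    are taken at the very end. The risk is allowed to vanish, which is why all error events are
    strict inequalities. *)

Section linear_algebra.
Context {R : realType}.

Definition dot (k : nat) (x y : 'cV[R]_k) : R := (x^T *m y) 0 0.

Section dot_lemmas.
Variables (k : nat).
Implicit Types (x y z : 'cV[R]_k) (M N : 'M[R]_k) (a : R).

Lemma dotE x y : dot x y = \sum_s x s 0 * y s 0.
Proof. by rewrite /dot mxE; apply: eq_bigr => s _; rewrite mxE. Qed.

Lemma dotC x y : dot x y = dot y x.
Proof. by rewrite !dotE; apply: eq_bigr => s _; rewrite mulrC. Qed.

Lemma dotDr x y z : dot x (y + z) = dot x y + dot x z.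
Proof. by rewrite /dot mulmxDr mxE. Qed.

Lemma dotDl x y z : dot (y + z) x = dot y x + dot z x.
Proof. by rewrite dotC dotDr !(dotC x). Qed.

Lemma dotZr a x y : dot x (a *: y) = a * dot x y.
Proof. by rewrite /dot -scalemxAr mxE. Qed.

Lemma dotZl a x y : dot (a *: x) y = a * dot x y.
Proof. by rewrite dotC dotZr dotC. Qed.

Lemma dotNr x y : dot x (- y) = - dot x y.
Proof. by rewrite -scaleN1r dotZr mulN1r. Qed.

Lemma dotNl x y : dot (- x) y = - dot x y.
Proof. by rewrite dotC dotNr dotC. Qed.

Lemma dotBr x y z : dot x (y - z) = dot x y - dot x z.
Proof. by rewrite dotDr dotNr. Qed.

Lemma dotBl x y z : dot (y - z) x = dot y x - dot z x.
Proof. by rewrite dotDl dotNl. Qed.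

Lemma dot0r x : dot x 0 = 0.
Proof. by rewrite -(scale0r 0) dotZr mul0r. Qed.

Lemma dot0l x : dot 0 x = 0.
Proof. by rewrite dotC dot0r. Qed.

Lemma dot_sumr (I : finType) (F : I -> 'cV[R]_k) x :
  dot x (\sum_i F i) = \sum_i dot x (F i).
Proof. by rewrite /dot mulmx_sumr summxE. Qed.

Lemma dot_ge0 x : 0 <= dot x x.
Proof. by rewrite dotE sumr_ge0 // => s _; rewrite -expr2 sqr_ge0. Qed.

Lemma dot_eq0 x : (dot x x == 0) = (x == 0).
Proof.
apply/eqP/eqP => [|->]; last by rewrite dot0r.
rewrite dotE => /eqP; rewrite psumr_eq0; last first.
  by move=> s _; rewrite -expr2 sqr_ge0.
move=> /allP x0; apply/colP => s; rewrite mxE.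
by have := x0 s (mem_index_enum _); rewrite /= -expr2 sqrf_eq0 => /eqP.
Qed.

Lemma qformE M x : qform M x = dot x (M *m x).
Proof. by rewrite /qform /dot mulmxA. Qed.

Lemma sqnormE x : sqnorm x = dot x x. Proof. by []. Qed.

Lemma qformD M N x : qform (M + N) x = qform M x + qform N x.
Proof. by rewrite !qformE mulmxDl dotDr. Qed.

Lemma qformN M x : qform (- M) x = - qform M x.
Proof. by rewrite !qformE mulNmx dotNr. Qed.

Lemma qformZ a M x : qform (a *: M) x = a * qform M x.
Proof. by rewrite !qformE -scalemxAl dotZr. Qed.

Lemma qform1 x : qform 1%:M x = dot x x.
Proof. by rewrite qformE mul1mx. Qed.

Lemma qform_sum (I : finType) (F : I -> 'M[R]_k) x :
  qform (\sum_i F i) x = \sum_i qform (F i) x.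
Proof. by rewrite !qformE mulmx_suml dot_sumr; apply: eq_bigr => i _; rewrite qformE. Qed.

Lemma qformZv a M x : qform M (a *: x) = a ^+ 2 * qform M x.
Proof. by rewrite !qformE -scalemxAr dotZr dotZl mulrA expr2. Qed.

(** Only the existence of a positive constant matters: it keeps the Rayleigh ratios bounded. The
    summand 1 makes it positive even when M is 0. *)
Lemma qform_bound M : exists2 C, 0 < C & forall x, `|qform M x| <= C * dot x x.
Proof.
exists (1 + \sum_s \sum_t `|M s t|).
  by rewrite ltr_pwDl // sumr_ge0 // => s _; rewrite sumr_ge0.
move=> x; rewrite mulrDl mul1r ler_wpDl ?dot_ge0 // qformE dotE.
apply: le_trans (ler_norm_sum _ _ _) _; rewrite mulr_suml; apply: ler_sum => s _.
rewrite normrM mxE; apply: le_trans (ler_wpM2l (normr_ge0 _) (ler_norm_sum _ _ _)) _.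
rewrite mulr_sumr mulr_suml; apply: ler_sum => t _.
rewrite normrM mulrCA ler_wpM2l //.
have le1 u : `|x u 0| ^+ 2 <= dot x x.
  rewrite dotE (bigD1 u) //= real_normK ?num_real // expr2 lerDl sumr_ge0 // => v _.
  by rewrite -expr2 sqr_ge0.
by move: (le1 s) (le1 t) (sqr_ge0 (`|x s 0| - `|x t 0|)); lra.
Qed.

End dot_lemmas.

Lemma dot_mulmxl (k p : nat) (A : 'M[R]_(k, p)) x y :
  dot (A *m x) y = dot x (A^T *m y).
Proof. by rewrite /dot trmx_mul mulmxA. Qed.

Section possemidef.
Variables (k : nat).
Implicit Types (x y z : 'cV[R]_k) (M N S W : 'M[R]_k) (a : R).

Lemma psd_sym M : possemidefmx M -> M^T = M. Proof. by case. Qed.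

Lemma psd_ge0 M x : possemidefmx M -> 0 <= qform M x. Proof. by case. Qed.

Lemma sym_dotC M x y : M^T = M -> dot x (M *m y) = dot y (M *m x).
Proof. by move=> MT; rewrite dotC dot_mulmxl MT. Qed.

Lemma qform_add_sym M x y : M^T = M ->
  qform M (x + y) = qform M x + 2 * dot x (M *m y) + qform M y.
Proof.
by move=> MT; rewrite !qformE mulmxDr !(dotDl, dotDr) (sym_dotC y x MT); ring.
Qed.

(* Expand [0 <= qform M (c *: x +/- y)]. *)
Lemma psd_young M c x y : possemidefmx M -> 0 < c ->
  2 * `|dot x (M *m y)| <= c * qform M x + c^-1 * qform M y.
Proof.
move=> [MT M0] c0.
have h (s : R) : s ^+ 2 = 1 ->
    0 <= c * qform M x + c^-1 * qform M y + 2 * (s * dot x (M *m y)).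
  move=> s2; have := M0 ((s * c) *: x + y).
  rewrite qform_add_sym // qformZv dotZl exprMn s2 mul1r => h.
  rewrite -(pmulr_rge0 _ c0); apply: le_trans h _; rewrite le_eqVlt.
  by apply/orP; left; apply/eqP; field; rewrite gt_eqF.
have := h 1 (expr1n _ _); have := h (-1) (etrans (sqrrN 1) (expr1n _ 2)).
rewrite mul1r mulN1r; set d := dot _ _; set p := c * _ + _.
by move=> h1 h2; have [] := ger0P d; lra.
Qed.

Lemma psd_cauchy M x y : possemidefmx M ->
  dot x (M *m y) ^+ 2 <= qform M x * qform M y.
Proof.
move=> [MT M0]; have q0 := M0 y.
have [qx0|qx_neq0] := eqVneq (qform M x) 0.
  rewrite qx0 mul0r; have [->|d0] := eqVneq (dot x (M *m y)) 0; first by rewrite expr0n.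
  (* The multiplier is chosen so that the form would take the value -1 at this vector. *)
  have := M0 ((- (1 + qform M y) / (2 * dot x (M *m y))) *: x + y).
  rewrite qform_add_sym // qformZv qx0 mulr0 add0r dotZl.
  have -> : 2 * (- (1 + qform M y) / (2 * dot x (M *m y)) * dot x (M *m y))
      = - (1 + qform M y) by field.
  by move=> h; exfalso; move: h; rewrite opprD subrK ler0N1.
have qx : 0 < qform M x by rewrite lt_def qx_neq0 M0.
(* At this vector the form is [qform M x] times the wanted difference. *)
have := M0 (qform M x *: y + (- dot x (M *m y)) *: x).
rewrite qform_add_sym // !qformZv dotZl -scalemxAr dotZr (sym_dotC y x MT).
move=> h; rewrite -subr_ge0 -(pmulr_rge0 _ qx); apply: le_trans h _.
by rewrite le_eqVlt; apply/orP; left; apply/eqP; ring.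
Qed.

Lemma psd0 : possemidefmx (0 : 'M[R]_k).
Proof. by split=> [|u]; rewrite ?trmx0 // qformE mul0mx dot0r. Qed.

Lemma psd1 : possemidefmx (1%:M : 'M[R]_k).
Proof. by split=> [|u]; rewrite ?trmx1 // qform1 dot_ge0. Qed.

Lemma psdD M N : possemidefmx M -> possemidefmx N -> possemidefmx (M + N).
Proof.
move=> [MT M0] [NT N0]; split=> [|u]; first by rewrite linearD /= MT NT.
by rewrite qformD addr_ge0.
Qed.

Lemma psdZ a M : 0 <= a -> possemidefmx M -> possemidefmx (a *: M).
Proof.
move=> a0 [MT M0]; split=> [|u]; first by rewrite linearZ /= MT.
by rewrite qformZ mulr_ge0.
Qed.

Lemma psd_sum (I : finType) (F : I -> 'M[R]_k) :
  (forall i, possemidefmx (F i)) -> possemidefmx (\sum_i F i).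
Proof.
by move=> F0; elim/big_ind : _ => //; [exact: psd0 | exact: psdD].
Qed.

Lemma pd_psd W : posdefmx W -> possemidefmx W.
Proof.
move=> [WT W0]; split=> // u; have [->|u0] := eqVneq u 0.
  by rewrite qformE mulmx0 dot0r.
exact/ltW/W0.
Qed.

Lemma pd_unit W : posdefmx W -> W \in unitmx.
Proof.
move=> [WT W0]; rewrite unitmxE unitfE; apply/negP => /det0P[v v0 vW].
have := W0 v^T; rewrite trmx_eq0 => /(_ v0).
by rewrite qformE -WT -trmx_mul vW trmx0 dot0r ltxx.
Qed.

Lemma psd_unit_pd W : possemidefmx W -> W \in unitmx -> posdefmx W.
Proof.
move=> Wpsd uW; have [WT W0] := Wpsd; split=> // u u0; rewrite lt_def W0 andbT.
(* Paired with W^-1 u, an isotropic u would satisfy (u.u)^2 <= 0. *)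
apply/negP => /eqP qu0; have := psd_cauchy u (invmx W *m u) Wpsd.
rewrite qu0 mul0r mulKVmx // => h.
have /eqP : dot u u ^+ 2 = 0 by apply/eqP; rewrite eq_le h sqr_ge0.
by rewrite sqrf_eq0 dot_eq0 (negPf u0).
Qed.

Lemma sym_inv W : W^T = W -> (invmx W)^T = invmx W.
Proof. by move=> WT; rewrite trmx_inv WT. Qed.

Lemma qform_inv W x : posdefmx W -> qform (invmx W) (W *m x) = qform W x.
Proof.
move=> Wpd; rewrite !qformE mulmxA mulVmx ?pd_unit // mul1mx dotC.
by [].
Qed.

Lemma pd_inv W : posdefmx W -> posdefmx (invmx W).
Proof.
move=> Wpd; have [WT W0] := Wpd; split=> [|u u0]; first exact: sym_inv.
rewrite -(mulKVmx (pd_unit Wpd) u) qform_inv // W0 //; apply: contraNneq u0 => h.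
by rewrite -(mulKVmx (pd_unit Wpd) u) h mulmx0.
Qed.

Lemma psd_congr (p : nat) (B : 'M[R]_(p, k)) (M : 'M[R]_p) :
  possemidefmx M -> possemidefmx (B^T *m M *m B).
Proof.
move=> [MT M0]; split=> [|u]; first by rewrite !trmx_mul trmxK MT mulmxA.
by have := M0 (B *m u); rewrite !qformE dot_mulmxl !mulmxA.
Qed.

Lemma psd_congrT (p : nat) (B : 'M[R]_(k, p)) (M : 'M[R]_p) :
  possemidefmx M -> possemidefmx (B *m M *m B^T).
Proof.
by move=> [MT M0]; split=> [|u]; [rewrite !trmx_mul trmxK MT mulmxA |
  have := M0 (B^T *m u); rewrite !qformE dot_mulmxl trmxK !mulmxA].
Qed.

(** Coercivity without compactness of the sphere: Cauchy-Schwarz for W between x and W^-1 x bounds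
    (x.x)^2 by the product of the forms of W and W^-1 at x, and the latter is at most C (x.x). *)
Lemma pd_lower W : posdefmx W ->
  exists2 C, 0 < C & forall x, dot x x <= C * qform W x.
Proof.
move=> Wpd; have [C C0 CW] := qform_bound (invmx W); exists C => // x.
have [->|x0] := eqVneq x 0; first by rewrite qformE mulmx0 dot0r mulr0.
have d0 : 0 < dot x x by rewrite lt_def dot_eq0 x0 dot_ge0.
have := psd_cauchy x (invmx W *m x) (pd_psd Wpd).
rewrite -(qform_inv (invmx W *m x)) // !mulKVmx ?pd_unit // => h.
have h2 : qform (invmx W) x <= C * dot x x by apply: le_trans (ler_norm _) (CW x).
rewrite -(ler_pM2r d0) -expr2; apply: le_trans h _.
by rewrite (mulrC C) -mulrA ler_wpM2l // (psd_ge0 _ (pd_psd Wpd)).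
Qed.

(* The largest ratio [qform S x / qform W x] is an eigenvalue of [S W^-1]:
   otherwise [lambda W - S] would be invertible, hence bounded below by a multiple
   of the identity, and the ratios would stay away from their supremum. *)
Lemma rayleigh_eigen S W x : x != 0 -> S^T = S -> posdefmx W ->
  exists2 l, eigenvalue (S *m invmx W) l & forall z, qform S z <= l * qform W z.
Proof.
move=> x0 ST Wpd; have [WT W0] := Wpd.
have [C C0 CS] := qform_bound S; have [D D0 DW] := qform_bound W.
have [I I0 lowerW] := pd_lower Wpd.
pose E := [set a : R | exists2 z, z != 0 & a = qform S z / qform W z].
have Eub : has_ubound E.
  exists (C * I) => a [z z0 ->]; rewrite ler_pdivrMr ?W0 //.
  apply: le_trans (ler_norm _) _; apply: le_trans (CS z) _.
  by rewrite -mulrA ler_wpM2l ?(ltW C0) ?lowerW.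
pose l := sup E.
have supE : has_sup E by split=> //; exists (qform S x / qform W x); exists x.
have El z : qform S z <= l * qform W z.
  have [->|z0] := eqVneq z 0; first by rewrite !qformE !mulmx0 !dot0r mulr0.
  by rewrite -ler_pdivrMr ?W0 //; apply: ub_le_sup => //; exists z.
have Npsd : possemidefmx (l *: W - S).
  split=> [|z]; first by rewrite linearB linearZ /= WT ST.
  by rewrite qformD qformN qformZ subr_ge0.
have /det0P[v v0 vN] : \det (l *: W - S) == 0.
  apply/negPn/negP => dN.
  have Npd : posdefmx (l *: W - S).
    by apply: psd_unit_pd => //; rewrite unitmxE unitfE.
  have [J J0 lowerN] := pd_lower Npd.
  have : l <= l - (D * J)^-1.
    apply: ge_sup; first by case: supE.
    move=> a [z z0 ->]; rewrite ler_pdivrMr ?W0 // mulrBl lerBrDr -lerBrDl.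
    have := lowerN z; rewrite qformD qformN qformZ => h.
    rewrite ler_pdivrMl ?mulr_gt0 // -mulrA (le_trans _ (ler_wpM2l (ltW D0) h)) //.
    by apply: le_trans (DW z); exact: ler_norm.
  by rewrite lerBrDl gerDr invr_le0 leNgt mulr_gt0.
exists l => //; apply/eigenvalueP; exists v => //.
have vS : v *m S = l *: (v *m W).
  by apply/eqP; rewrite eq_sym -subr_eq0 scalemxAr -mulmxBr vN.
by rewrite mulmxA vS -scalemxAl mulmxK ?pd_unit.
Qed.

(** A [sup] dominates its elements only when the set is bounded. Here every eigenvalue is the ratio
    of the two forms at its left eigenvector, hence at most the eigenvalue given by
    [rayleigh_eigen]. *)
Lemma lambda_max_rayleigh S W x : S^T = S -> posdefmx W ->
  qform S x <= lambda_max (S *m invmx W) * qform W x.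
Proof.
move=> ST Wpd; have [WT W0] := Wpd.
have [->|x0] := eqVneq x 0; first by rewrite !qformE !mulmx0 !dot0r mulr0.
have [l eig El] := rayleigh_eigen x0 ST Wpd.
apply: le_trans (El x) _; rewrite ler_wpM2r ?(psd_ge0 _ (pd_psd Wpd)) //.
apply: ub_le_sup => //; exists l => a /eigenvalueP[u uS u0].
have h : u *m S = a *: (u *m W) by rewrite scalemxAl -uS !mulmxA mulmxKV ?pd_unit.
have u0' : u^T != 0 by rewrite trmx_eq0.
have := El u^T; rewrite -ler_pdivrMr ?W0 //; congr (_ <= _).
apply/(canLR (mulfK _)); first by rewrite gt_eqF ?W0.
by rewrite /qform trmxK h -!scalemxAl mxE.
Qed.

Lemma pd1 : posdefmx (1%:M : 'M[R]_k).
Proof. by split=> [|u u0]; rewrite ?trmx1 // qform1 lt_def dot_eq0 u0 dot_ge0. Qed.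

Lemma lambda_maxP W x : W^T = W -> qform W x <= lambda_max W * dot x x.
Proof.
by move=> WT; have := lambda_max_rayleigh x WT pd1; rewrite invmx1 mulmx1 qform1.
Qed.

Lemma trM_sum_qform (B P : 'M[R]_k) : \tr (B^T *m P *m B) = \sum_s qform P (col s B).
Proof.
apply: eq_bigr => s _; rewrite -mulmxA !mxE qformE dotE.
apply: eq_bigr => t _; rewrite !mxE; congr (_ * _).
by apply: eq_bigr => u _; rewrite !mxE.
Qed.

Lemma psd_cauchy0 M x : possemidefmx M -> qform M x = 0 -> M *m x = 0.
Proof.
move=> Mpsd q0; have := psd_cauchy (M *m x) x Mpsd; rewrite q0 mulr0 => h.
by apply/eqP; rewrite -dot_eq0 -sqrf_eq0 eq_le h sqr_ge0.
Qed.

Lemma mulmx_cV_eq0 (p : nat) (M : 'M[R]_(p, k)) :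
  (forall x : 'cV[R]_k, M *m x = 0) -> M = 0.
Proof.
move=> M0; apply/matrixP => s t; have := M0 (delta_mx t 0).
by rewrite -colE => /matrixP/(_ s 0); rewrite !mxE.
Qed.

Lemma qform_rank1 (v x : 'cV[R]_k) : qform (v *m v^T) x = dot v x ^+ 2.
Proof.
rewrite qformE -mulmxA dotC dot_mulmxl dotE big_ord_recl big_ord0 addr0 !mxE.
by rewrite expr2 !dotE; congr (_ * _); apply: eq_bigr => s _; rewrite !mxE.
Qed.

Lemma psd_top_eigen M : possemidefmx M -> M != 0 ->
  exists2 l, 0 < l & exists2 v : 'cV[R]_k, dot v v = 1 & M *m v = l *: v.
Proof.
move=> Mpsd Mneq0; have [MT M0] := Mpsd.
have [x Mx0] : exists x : 'cV[R]_k, M *m x != 0.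
  apply/not_existsP => h; move: Mneq0; rewrite -(mulmx1 M) => /eqP; apply.
  by rewrite mulmx1; apply: mulmx_cV_eq0 => x; have /negP/negPn/eqP := h x.
have x0 : x != 0 by apply: contraNneq Mx0 => ->; rewrite mulmx0.
have [l /eigenvalueP[u uM u0] Ml] := rayleigh_eigen x0 MT pd1.
have qx0 : 0 < qform M x.
  by rewrite lt_def M0 andbT; apply: contra_neq Mx0 => h; exact: psd_cauchy0.
have l0 : 0 < l.
  have := lt_le_trans qx0 (Ml x); rewrite qform1 pmulr_lgt0 //.
  by rewrite lt_def dot_eq0 x0 dot_ge0.
have d0 : 0 < dot u^T u^T by rewrite lt_def dot_eq0 trmx_eq0 u0 dot_ge0.
exists l => //; exists ((Num.sqrt (dot u^T u^T))^-1 *: u^T).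
  by rewrite dotZl dotZr mulrA -expr2 exprVn sqr_sqrtr ?ltW // mulVf ?gt_eqF.
rewrite -scalemxAr -[in M *m _]MT -trmx_mul; move: uM.
by rewrite invmx1 mulmx1 => ->; rewrite linearZ /= !scalerA mulrC.
Qed.

(* Induction on the rank: splitting off an eigenvector v of M lowers the rank, and
   any square root of the remainder annihilates v. *)
Lemma psd_sqrt M : possemidefmx M -> exists2 B, possemidefmx B & B *m B = M.
Proof.
have [r] := ubnP (\rank M); elim: r M => // r IH M rM Mpsd; have [MT M0] := Mpsd.
have [M_eq0|Mneq0] := eqVneq M 0.
  by exists 0; [exact: psd0 | rewrite mulmx0 M_eq0].
have [l l0 [v v1 Mv]] := psd_top_eigen Mpsd Mneq0.
have vTv : v^T *m v = 1%:M.
  by apply/matrixP => s t; rewrite !ord1 -[LHS]/(dot v v) v1 mxE.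
have vvpsd : possemidefmx (v *m v^T).
  by split=> [|x]; [rewrite trmx_mul trmxK | rewrite qform_rank1 sqr_ge0].
pose M' := M - l *: (v *m v^T).
have M'psd : possemidefmx M'.
  split=> [|x]; first by rewrite linearB linearZ /= MT trmx_mul trmxK.
  rewrite qformD qformN qformZ qform_rank1 subr_ge0.
  (* As M v = l v and v has norm 1, this reads l^2 (v.x)^2 <= l q(x), with q the form of M. *)
  have := psd_cauchy x v Mpsd; rewrite (qformE M v) Mv !dotZr v1 mulr1 dotC.
  by rewrite exprMn (expr2 l) -mulrA [_ * l]mulrC ler_pM2l.
have M'v : M' *m v = 0.
  by rewrite mulmxBl Mv -scalemxAl -mulmxA vTv mulmx1 subrr.
have vTM : v^T *m M = l *: v^T by rewrite -[in LHS]MT -trmx_mul Mv linearZ.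
have rM' : (\rank M' < \rank M)%N.
  apply: rank_ltmx; rewrite ltmxE; apply/andP; split.
    have -> : M' = (1%:M - v *m v^T) *m M.
      by rewrite mulmxBl mul1mx -mulmxA vTM -scalemxAr.
    exact: submxMl.
  apply/negP => MM'; have : (v^T <= M')%MS.
    apply: submx_trans MM'; rewrite -(eqmx_scale (v^T) (lt0r_neq0 l0)) -vTM.
    exact: submxMl.
  move=> /submxP[w vw]; have : v^T *m v = 0 by rewrite vw -mulmxA M'v mulmx0.
  by rewrite vTv => /matrixP/(_ 0 0)/eqP; rewrite !mxE oner_eq0.
have [B Bpsd BB] := IH _ (leq_trans rM' rM) M'psd; have [BT _] := Bpsd.
have Bv : B *m v = 0.
  by apply/eqP; rewrite -dot_eq0 dot_mulmxl BT mulmxA BB M'v dot0r.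
have vTB : v^T *m B = 0 by rewrite -BT -trmx_mul Bv trmx0.
exists (B + Num.sqrt l *: (v *m v^T)).
  by apply: psdD => //; apply: psdZ => //; exact: sqrtr_ge0.
rewrite mulmxDl !mulmxDr BB -!scalemxAr -!scalemxAl mulmxA Bv mul0mx.
rewrite -mulmxA vTB mulmx0 -mulmxA (mulmxA v^T) vTv mul1mx scalerA -expr2.
by rewrite sqr_sqrtr ?ltW // !scaler0 addr0 add0r subrK.
Qed.

(** With a symmetric square root B of M, the trace of M Z is the sum of the values of the form Z at
    the columns of B. *)
Lemma tr_mono M P Q : possemidefmx M ->
  (forall x, qform P x <= qform Q x) -> \tr (M *m P) <= \tr (M *m Q).
Proof.
move=> /psd_sqrt[B [BT _] <-] PQ.
have e Z : \tr (B *m B *m Z) = \sum_s qform Z (col s B).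
  by rewrite -mulmxA mxtrace_mulC -trM_sum_qform BT.
by rewrite !e; apply: ler_sum.
Qed.

Lemma tr_psdM_ge0 M P : possemidefmx M -> possemidefmx P -> 0 <= \tr (M *m P).
Proof.
move=> Mpsd [_ P0]; have := @tr_mono M 0 P Mpsd; rewrite mulmx0 mxtrace0; apply.
by move=> x; rewrite qformE mul0mx dot0r.
Qed.

Lemma tr_psd_ge0 M : possemidefmx M -> 0 <= \tr M.
Proof. by move=> Mpsd; rewrite -(mulmx1 M) tr_psdM_ge0 //; exact: psd1. Qed.

Lemma tr_mono_scal M P a : possemidefmx M ->
  (forall x, qform P x <= a * dot x x) -> \tr (M *m P) <= a * \tr M.
Proof.
move=> Mpsd Pa; rewrite -mxtraceZ -[in leRHS](mulmx1 M) scalemxAr.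
by apply: tr_mono => // x; rewrite qformZ qform1.
Qed.

(** For S = B B, the form of S at x is the sum of the (b.x)^2 over the columns b of B.
    Cauchy-Schwarz between W^-1 b and x bounds each by the forms of W^-1 at b and of W at x, and the
    former add up to the trace. *)
Lemma psd_le_tr S W x : possemidefmx S -> posdefmx W ->
  qform S x <= \tr (S *m invmx W) * qform W x.
Proof.
move=> Spsd Wpd; have [WT W0] := Wpd; have [B [BT _] BB] := psd_sqrt Spsd.
rewrite -{1 2}BB qformE -mulmxA dotC dot_mulmxl BT -mulmxA mxtrace_mulC.
have -> : dot (B *m x) (B *m x) = \sum_s dot (col s B) x ^+ 2.
  rewrite dotE; apply: eq_bigr => s _; rewrite -expr2; congr (_ ^+ 2).
  rewrite -[in LHS]BT mxE dotE.
  by apply: eq_bigr => t _; rewrite !mxE.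
rewrite -[X in X *m _ *m _]BT trM_sum_qform mulr_suml; apply: ler_sum => s _.
have := psd_cauchy (invmx W *m col s B) x (pd_psd Wpd).
rewrite -qform_inv // mulKVmx ?pd_unit //.
by rewrite dot_mulmxl sym_inv // mulKmx ?pd_unit.
Qed.

(** For z = W^-1 S x, both x.(S z) and the form of W at z equal the left side. Cauchy-Schwarz for S
    followed by S <= a W bounds its square by a times itself times the form of S at x. *)
Lemma psd_le_mulinv S W a x : possemidefmx S -> posdefmx W ->
  (forall z, qform S z <= a * qform W z) ->
  qform (S *m invmx W *m S) x <= a * qform S x.
Proof.
move=> Spsd Wpd Sa; have [WT W0] := Wpd; have [ST S0] := Spsd.
pose z := invmx W *m (S *m x).
have e : qform (S *m invmx W *m S) x = qform W z.
  rewrite -(qform_inv z) // mulKVmx ?pd_unit // !qformE -!mulmxA.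
  by rewrite dot_mulmxl ST.
(* The sign of a is not given: when the left side is 0, it is read off the hypothesis at x. *)
rewrite e; have [->|z0] := eqVneq (qform W z) 0.
  case: (eqVneq (qform S x) 0) => [->|sx]; first by rewrite mulr0.
  rewrite mulr_ge0 //.
  have sx0 : 0 < qform S x by rewrite lt_def sx S0.
  have x0 : x != 0 by apply: contraNneq sx => ->; rewrite qformE mulmx0 dot0r.
  by have := lt_le_trans sx0 (Sa x); rewrite pmulr_lgt0 ?W0 // => /ltW.
have Wz0 : 0 < qform W z by rewrite lt_def z0 (psd_ge0 _ (pd_psd Wpd)).
have := psd_cauchy x z Spsd.
have -> : dot x (S *m z) = qform W z by rewrite -e qformE -!mulmxA.
rewrite expr2 => h; rewrite -(ler_pM2r Wz0); apply: le_trans h _.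
by rewrite mulrAC mulrC ler_wpM2r.
Qed.

(** This is [psd_le_mulinv] with W compared to the identity, evaluated at W^-1 x. *)
Lemma dot_le_inv W a x : posdefmx W -> (forall z, qform W z <= a * dot z z) ->
  dot x x <= a * qform (invmx W) x.
Proof.
move=> Wpd Wa; have [WT _] := Wpd.
have := @psd_le_mulinv W 1%:M a (invmx W *m x) (pd_psd Wpd) pd1.
rewrite invmx1 mulmx1 -[qform W _]qform_inv // mulKVmx ?pd_unit //.
rewrite qformE -mulmxA mulKVmx ?pd_unit // dot_mulmxl sym_inv // mulKmx ?pd_unit //.
by apply=> z; rewrite qform1.
Qed.

End possemidef.
End linear_algebra.

(** * Block structure of the smoother *)

Section grouped.
Context {R : realType} (n N : nat) (g : 'I_N -> 'I_n).
Implicit Types (M C W : 'M[R]_N) (x y : 'cV[R]_N) (i : 'I_n).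

(** Blocks are kept as N x N matrices cut out by coordinate projectors, so block computations take
    place in one matrix ring, without dependent dimensions. *)
Definition gproj i : 'M[R]_N := \matrix_(s, t) ((s == t) && (g s == i))%:R.

Definition gdiag M := forall s t, g s != g t -> M s t = 0.

Definition gpart M : 'M[R]_N := \matrix_(s, t) if g s == g t then M s t else 0.

Definition gblock i M : 'M[R]_N := gproj i *m M *m gproj i.

Lemma mul_gprojE i (p : nat) (M : 'M[R]_(N, p)) s t :
  (gproj i *m M) s t = if g s == i then M s t else 0.
Proof.
rewrite mxE (bigD1 s) //= mxE eqxx /= big1 => [|u us].
  by rewrite addr0; case: eqP => _; rewrite ?mul1r ?mul0r.
by rewrite mxE eq_sym (negPf us) mul0r.
Qed.

Lemma tr_gproj i : (gproj i)^T = gproj i.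
Proof. by apply/matrixP => s t; rewrite !mxE eq_sym; case: eqVneq => [->|]. Qed.

Lemma mulmx_gprojE i (p : nat) (M : 'M[R]_(p, N)) s t :
  (M *m gproj i) s t = if g t == i then M s t else 0.
Proof.
rewrite -[M *m _]trmxK trmx_mul tr_gproj mxE mul_gprojE.
by case: ifP => //; rewrite mxE.
Qed.

Lemma gprojK i : gproj i *m gproj i = gproj i.
Proof.
apply/matrixP => s t; rewrite mul_gprojE !mxE.
by case: (g s == i); rewrite ?andbF.
Qed.

Lemma gblockE i M s t :
  gblock i M s t = if (g s == i) && (g t == i) then M s t else 0.
Proof. by rewrite mulmx_gprojE mul_gprojE; do 2 case: (_ == i). Qed.

Lemma sum_gblock M : \sum_i gblock i M = gpart M.
Proof.
apply/matrixP => s t; rewrite summxE mxE (bigD1 (g s)) //= gblockE eqxx /=.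
rewrite eq_sym big1 ?addr0 // => i si.
by rewrite gblockE (eq_sym (g s)) (negPf si).
Qed.

Lemma sum_gproj : \sum_i gproj i = 1%:M.
Proof.
apply/matrixP => s t; rewrite summxE (bigD1 (g s)) //= !mxE eqxx andbT.
by rewrite big1 ?addr0 // => i si; rewrite !mxE (eq_sym (g s)) (negPf si) andbF.
Qed.

(** Commutation is the working form of block diagonality: it passes to products and inverses by pure
    algebra. *)
Lemma gdiagP M : gdiag M <-> forall i, gproj i *m M = M *m gproj i.
Proof.
split=> [Md i|MC s t st].
  apply/matrixP => s t; rewrite mul_gprojE mulmx_gprojE.
  have [->//|/Md ->] := eqVneq (g s) (g t).
  by case: ifP; case: ifP.
have /matrixP/(_ s t) := MC (g s); rewrite mul_gprojE mulmx_gprojE eqxx.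
by rewrite eq_sym (negPf st).
Qed.

Lemma gdiag_inv M : M \in unitmx -> gdiag M -> gdiag (invmx M).
Proof.
move=> uM /gdiagP Md; apply/gdiagP => i.
by rewrite -[LHS](mulKmx uM) (mulmxA M) -Md mulmxK.
Qed.

Lemma gdiagM M C : gdiag M -> gdiag C -> gdiag (M *m C).
Proof.
move=> /gdiagP Md /gdiagP Cd; apply/gdiagP => i.
by rewrite mulmxA Md -!mulmxA Cd.
Qed.

Lemma gdiag1 : gdiag 1%:M.
Proof. by apply/gdiagP => i; rewrite mulmx1 mul1mx. Qed.

Lemma gdiag_gpart M : gdiag (gpart M).
Proof. by move=> s t st; rewrite mxE (negPf st). Qed.

Lemma gpart_id M : gdiag M -> gpart M = M.
Proof. by move=> Md; apply/matrixP => s t; rewrite mxE; case: eqVneq => // /Md. Qed.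

Lemma gpartMl M C : gdiag C -> gpart (C *m M) = C *m gpart M.
Proof.
move=> /gdiagP Cd; rewrite -!sum_gblock mulmx_sumr; apply: eq_bigr => i _.
by rewrite /gblock mulmxA Cd -!mulmxA.
Qed.

Lemma gpartMr M C : gdiag C -> gpart (M *m C) = gpart M *m C.
Proof.
move=> /gdiagP Cd; rewrite -!sum_gblock mulmx_suml; apply: eq_bigr => i _.
by rewrite /gblock -!mulmxA Cd.
Qed.

Lemma gpartT M : (gpart M)^T = gpart M^T.
Proof. by apply/matrixP => s t; rewrite !mxE eq_sym. Qed.

Lemma mxtrace_gpart M : \tr (gpart M) = \tr M.
Proof. by apply: eq_bigr => s _; rewrite mxE eqxx. Qed.

Lemma mxtrace_gblock i M : \tr (gblock i M) = \tr (gproj i *m M).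
Proof. by rewrite /gblock mxtrace_mulC mulmxA gprojK. Qed.

Lemma psd_gblock i M : possemidefmx M -> possemidefmx (gblock i M).
Proof. by move=> /(psd_congr (gproj i)); rewrite tr_gproj. Qed.

Lemma psd_gpart M : possemidefmx M -> possemidefmx (gpart M).
Proof. by move=> Mpsd; rewrite -sum_gblock; apply: psd_sum => i; apply: psd_gblock. Qed.

Lemma qform_gblock i M x : qform (gblock i M) x = qform M (gproj i *m x).
Proof. by rewrite !qformE dot_mulmxl tr_gproj !mulmxA. Qed.

Lemma gpart_tr_mul M C : gdiag C -> \tr (M *m C) = \tr (gpart M *m C).
Proof. by move=> Cd; rewrite -mxtrace_gpart gpartMr. Qed.

(* Dropping the diagonal blocks of M is an orthogonal projection for the
   semi-inner product tr (M Sg M'^T C). *)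
Lemma tr_offpart_le M Sg C : possemidefmx Sg -> possemidefmx C ->
  gdiag Sg -> gdiag C ->
  \tr ((M - gpart M) *m Sg *m (M - gpart M)^T *m C) <= \tr (M *m Sg *m M^T *m C).
Proof.
move=> Sgpsd Cpsd Sgd Cd; set D := gpart M; set F := M - D.
have Fp : gpart F = 0.
  by apply/matrixP => s t; rewrite !mxE; case: (g s == g t); rewrite ?subrr.
(* The factors to the right of F are block diagonal, so the product has no diagonal block, as F has
   none. *)
have FD : \tr (F *m Sg *m D^T *m C) = 0.
  have Dd : gdiag D^T by rewrite gpartT; exact: gdiag_gpart.
  rewrite -!mulmxA -mxtrace_gpart gpartMr ?Fp ?mul0mx ?mxtrace0 //.
  by do 2 apply: gdiagM => //.
have DF : \tr (D *m Sg *m F^T *m C) = 0.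
  rewrite -FD -[RHS]mxtrace_tr !trmx_mul trmxK (psd_sym Sgpsd) (psd_sym Cpsd).
  by rewrite mxtrace_mulC !mulmxA.
have eM : F + D = M by rewrite subrK.
rewrite -[in leRHS]eM; clear eM Fp; clearbody F D.
rewrite [(F + D)^T]raddfD /= !(mulmxDl, mulmxDr) !mxtraceD FD DF addr0 add0r lerDl.
by apply: tr_psdM_ge0 => //; exact: psd_congrT.
Qed.

End grouped.

(* s, w and v stand for the largest eigenvalues of Sg W^-1, W and W^-1; sm_SJS says
   that the eigenvalues of A, which is similar to a psd matrix, are at most 1. *)
Record smoother (R : realType) (n N : nat) (g : 'I_N -> 'I_n)
    (S W A Sg : 'M[R]_N) (s w v a c : R) : Prop := Smoother {
  sm_AE : A = S *m invmx W;
  sm_Wpd : posdefmx W;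
  sm_Sgpd : posdefmx Sg;
  sm_Wd : gdiag g W;
  sm_Sgd : gdiag g Sg;
  sm_Spsd : possemidefmx S;
  sm_SJS : forall x, qform (S *m invmx W *m S) x <= qform S x;
  sm_s_ge0 : 0 <= s;
  sm_w_gt0 : 0 < w;
  sm_v_ge0 : 0 <= v;
  sm_Sg_le : forall x, qform Sg x <= s * qform W x;
  sm_W_le : forall x, qform W x <= w * dot x x;
  sm_J_le : forall x, qform (invmx W) x <= v * dot x x;
  sm_a_ge0 : 0 <= a;
  sm_a_max : forall i, \tr (gproj g i *m A) <= a;
  sm_c_max : forall i, \tr (gproj g i *m (A *m A)) <= c
}.

(** What Young's inequality gives for x.(S W^-1 x) with weight 1/w. This weight balances the halves:
    since Sg <= s W and W <= w^2 W^-1, each half has trace against Sg at most s w tr(S W^-1) / 2. *)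
Definition envelope (R : realType) (N : nat) (W : 'M[R]_N) (w : R) (S : 'M[R]_N) :=
  2^-1 *: (w^-1 *: S + w *: (invmx W *m S *m invmx W)).

(** * Trace and norm bounds for the smoother *)

Section bounds.
Context {R : realType} (n N : nat) (g : 'I_N -> 'I_n).
Variables (S W A Sg : 'M[R]_N) (s w v a c : R).
Local Notation J := (invmx W).
Local Notation gproj := (@gproj R n N g).
Local Notation gpart := (@gpart R n N g).
Local Notation gblock := (@gblock R n N g).
Local Notation gdiag := (@gdiag R n N g).

Hypothesis HS : smoother g S W A Sg s w v a c.

Let AE : A = S *m J. Proof. by case: HS. Qed.
Let Wpd : posdefmx W. Proof. by case: HS. Qed.
Let Sgpd : posdefmx Sg. Proof. by case: HS. Qed.
Let Wd : gdiag W. Proof. by case: HS. Qed.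
Let Sgd : gdiag Sg. Proof. by case: HS. Qed.
Let Spsd : possemidefmx S. Proof. by case: HS. Qed.
Let SJS : forall x, qform (S *m J *m S) x <= qform S x. Proof. by case: HS. Qed.
Let s_ge0 : 0 <= s. Proof. by case: HS. Qed.
Let w_gt0 : 0 < w. Proof. by case: HS. Qed.
Let v_ge0 : 0 <= v. Proof. by case: HS. Qed.
Let Sg_le : forall x, qform Sg x <= s * qform W x. Proof. by case: HS. Qed.
Let W_le : forall x, qform W x <= w * dot x x. Proof. by case: HS. Qed.
Let J_le : forall x, qform J x <= v * dot x x. Proof. by case: HS. Qed.
Let a_ge0 : 0 <= a. Proof. by case: HS. Qed.
Let a_max : forall i, \tr (gproj i *m A) <= a. Proof. by case: HS. Qed.
Let c_max : forall i, \tr (gproj i *m (A *m A)) <= c. Proof. by case: HS. Qed.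
Local Notation xi0 := (s * w).
Local Notation D := (A *m Sg *m A^T).
Local Notation Sd := (gpart S).
Local Notation Ad := (gpart A).
Local Notation tau := (\tr (A^T *m A *m Sg)).
(** The part w v a^2 bounds the squared Euclidean norm of Ad; the extra a^2 absorbs the half S / w
    of the envelope. *)
Local Notation theta := ((1 + w * v) * a ^+ 2).

Let WT : W^T = W. Proof. by case: Wpd. Qed.
Let JT : J^T = J. Proof. exact: sym_inv. Qed.
Let ST : S^T = S. Proof. by case: Spsd. Qed.
Let SgT : Sg^T = Sg. Proof. by case: Sgpd. Qed.
Let Jpd : posdefmx J. Proof. exact: pd_inv. Qed.
Let Wu : W \in unitmx. Proof. exact: pd_unit. Qed.
Let Jd : gdiag J. Proof. exact: gdiag_inv. Qed.
Let Sgpsd : possemidefmx Sg. Proof. exact: pd_psd. Qed.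
Let Jpsd : possemidefmx J. Proof. exact: pd_psd. Qed.
Let Dpsd : possemidefmx D. Proof. exact: psd_congrT. Qed.
Let xi_ge0 : 0 <= xi0. Proof. by rewrite mulr_ge0 // ltW. Qed.

Let AT : A^T = J *m S. Proof. by rewrite AE trmx_mul JT ST. Qed.

Let AdE : Ad = Sd *m J. Proof. by rewrite AE gpartMr. Qed.

Let tauE : tau = \tr D.
Proof. by rewrite -mulmxA mxtrace_mulC. Qed.

(** Cauchy-Schwarz for W between x and W^-1 S x bounds the square of the form of S at x by the forms
    of W and of S W^-1 S at x; the second is at most the form of S, which cancels. *)
Let S_le x : qform S x <= qform W x.
Proof.
have [_ S0] := Spsd; have [->|sx] := eqVneq (qform S x) 0.
  exact: psd_ge0 (pd_psd Wpd).
have sx0 : 0 < qform S x by rewrite lt_def sx S0.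
have := psd_cauchy x (J *m (S *m x)) (pd_psd Wpd).
rewrite mulKVmx // -qformE => h.
have e : qform W (J *m (S *m x)) = qform (S *m J *m S) x.
  by rewrite -qform_inv // mulKVmx // !qformE dot_mulmxl ST !mulmxA.
rewrite -(ler_pM2r sx0) -expr2; apply: le_trans h _.
by rewrite e ler_wpM2l // (psd_ge0 _ (pd_psd Wpd)).
Qed.

Lemma Sg_le_xi x : qform Sg x <= xi0 * dot x x.
Proof. by apply: le_trans (Sg_le x) _; rewrite -mulrA ler_wpM2l. Qed.

(** A^T = W^-1 S is a contraction for the form of W, so only the passages from Sg to W and from W to
    the identity are paid for. *)
Lemma D_le_xi x : qform D x <= xi0 * dot x x.
Proof.
have -> : qform D x = qform Sg (J *m (S *m x)).
  by rewrite !qformE dot_mulmxl JT dot_mulmxl ST AT AE !mulmxA.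
apply: le_trans (Sg_le _) _; rewrite -mulrA ler_wpM2l //.
apply: le_trans (W_le x); apply: le_trans (S_le x); apply: le_trans (SJS x).
by rewrite -qform_inv // mulKVmx // !qformE dot_mulmxl ST !mulmxA.
Qed.

(** This trace governs the variance of the noise form of A^T A; by cyclicity it is the trace of D
    D. *)
Lemma tr_AtA_le : \tr ((A^T *m A) *m Sg *m (A^T *m A)^T *m Sg) <= xi0 * tau.
Proof.
rewrite trmx_mul trmxK.
have -> : \tr (A^T *m A *m Sg *m (A^T *m A) *m Sg) = \tr (D *m D).
  by rewrite -!mulmxA mxtrace_mulC -!mulmxA.
by rewrite tauE; apply: tr_mono_scal => // x; exact: D_le_xi.
Qed.

Lemma tr_A_le : \tr (A *m Sg *m A^T *m Sg) <= xi0 * tau.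
Proof. by rewrite tauE; apply: tr_mono_scal => // x; exact: Sg_le_xi. Qed.

Lemma tau_ge0 : 0 <= tau. Proof. by rewrite tauE tr_psd_ge0. Qed.

Let Jle x : dot x x <= w * qform J x.
Proof. exact: dot_le_inv. Qed.

Let Wle x : qform W x <= w ^+ 2 * qform J x.
Proof.
by apply: le_trans (W_le x) _; rewrite expr2 -mulrA ler_wpM2l ?Jle // ltW.
Qed.

Lemma gblock_AtA_psd i : possemidefmx (gblock i (A^T *m A)).
Proof.
by apply: psd_gblock; have := psd_congr A (psd1 N); rewrite mulmx1.
Qed.

Lemma sum_tr_gblock_AtA : \sum_i \tr (gblock i (A^T *m A) *m Sg) = tau.
Proof. by rewrite -linear_sum /= -mulmx_suml sum_gblock -gpart_tr_mul. Qed.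

(** Replacing Sg by s W, then the identity between the two factors S by w W^-1, leads to the trace
    over subject i of A A, that is, of the block C_ii. *)
Lemma tr_gblock_AtA_le i : \tr (gblock i (A^T *m A) *m Sg) <= xi0 * c.
Proof.
have /gdiagP Jc := Jd; have /gdiagP Wc := Wd.
have psdA : possemidefmx (A^T *m A) by have := psd_congr A (psd1 N); rewrite mulmx1.
have -> : \tr (gblock i (A^T *m A) *m Sg) = \tr (A^T *m A *m gblock i Sg).
  by rewrite /gblock -!mulmxA mxtrace_mulC -!mulmxA.
have h1 : \tr (A^T *m A *m gblock i Sg) <= s * \tr (A^T *m A *m gblock i W).
  rewrite -mxtraceZ scalemxAr; apply: tr_mono => // x.
  by rewrite qformZ !qform_gblock.
apply: le_trans h1 _; rewrite -mulrA ler_wpM2l //.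
have -> : \tr (A^T *m A *m gblock i W) = \tr (gblock i J *m (S *m S)).
  rewrite AT AE /gblock mxtrace_mulC -mulmxA -Wc !mulmxA gprojK.
  rewrite -!mulmxA mulKVmx // (mulmxA S) mxtrace_mulC [in RHS]mulmxA Jc.
  rewrite -(mulmxA J) (mulmxA (gproj i) (gproj i)) gprojK.
  by rewrite -(mulmxA (S *m S)) [LHS]mxtrace_mulC -mulmxA.
have h2 : \tr (gblock i J *m (S *m S)) <= w * \tr (gblock i J *m (S *m J *m S)).
  rewrite -mxtraceZ scalemxAr; apply: tr_mono => [|x]; first exact: psd_gblock.
  rewrite qformZ; have := Jle (S *m x).
  by rewrite !qformE !dot_mulmxl ST !mulmxA.
apply: le_trans h2 _; rewrite ler_wpM2l ?(ltW w_gt0) //.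
have -> : \tr (gblock i J *m (S *m J *m S)) = \tr (gproj i *m (A *m A)).
  rewrite mxtrace_mulC [RHS]mxtrace_mulC /gblock Jc.
  by rewrite -(mulmxA J) gprojK AE !mulmxA.
exact: c_max.
Qed.

Let theta_ge0 : 0 <= theta.
Proof. by rewrite mulr_ge0 ?sqr_ge0 // addr_ge0 // mulr_ge0 // ltW. Qed.

(** Makes the variance formula for forms without diagonal blocks applicable to Ad (A - Ad). *)
Lemma offpart_gpart_mul : gpart (Ad *m (A - Ad)) = 0.
Proof.
rewrite gpartMl; last exact: gdiag_gpart.
suff -> : gpart (A - Ad) = 0 by rewrite mulmx0.
by apply/matrixP => i j; rewrite !mxE; case: (_ == _); rewrite ?subrr.
Qed.

Let Sdpsd : possemidefmx Sd. Proof. exact: psd_gpart. Qed.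
Let SdT : Sd^T = Sd. Proof. by case: Sdpsd. Qed.

Let tr_gprojA i : \tr (gproj i *m A) = \tr (gblock i S *m J).
Proof. by have /gdiagP Jc := Jd; rewrite -mxtrace_gblock /gblock AE -!mulmxA Jc. Qed.

Let Sd_ge0 x : 0 <= qform Sd x. Proof. by case: Sdpsd => _; apply. Qed.
Let w_ge0 : 0 <= w. Proof. exact: ltW. Qed.
Let wi_ge0 : 0 <= w^-1. Proof. by rewrite invr_ge0. Qed.
Hint Resolve Sd_ge0 w_ge0 wi_ge0 : core.

(** Each block of S is at most W times its trace against W^-1, which is the trace of A over the
    subject. The blocks add up because W is block diagonal. *)
Let Sd_le x : qform Sd x <= a * qform W x.
Proof.
rewrite -sum_gblock -[in leRHS](gpart_id Wd) -sum_gblock !qform_sum mulr_sumr.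
apply: ler_sum => i _; apply: le_trans (_ : qform (gblock i S) (gproj i *m x) <= _).
  by rewrite !qform_gblock mulmxA gprojK.
apply: le_trans (psd_le_tr _ (psd_gblock g i Spsd) Wpd) _.
rewrite [in leRHS]qform_gblock ler_wpM2r ?(psd_ge0 _ (pd_psd Wpd)) //.
by rewrite -tr_gprojA.
Qed.

(** Ad = Sd W^-1 sees x only through W^-1 x, and F is the form of Sd there; it is the half of the
    envelope that controls Ad x. *)
Let F x := qform (J *m Sd *m J) x.
Let H x := 2^-1 * (w^-1 * qform Sd x + w * F x).

Lemma qform_envelope M x :
  qform (envelope W w M) x = 2^-1 * (w^-1 * qform M x + w * qform (J *m M *m J) x).
Proof. by rewrite qformZ qformD !qformZ. Qed.

Let HE x : qform (envelope W w Sd) x = H x. Proof. exact: qform_envelope. Qed.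

Let FE x : F x = qform Sd (J *m x).
Proof. by rewrite /F !qformE dot_mulmxl JT !mulmxA. Qed.

Let F_ge0 x : 0 <= F x. Proof. by rewrite FE (psd_ge0 _ Sdpsd). Qed.

Let SdJSd_le x : qform (Sd *m J *m Sd) x <= a * qform Sd x.
Proof. exact: psd_le_mulinv Sdpsd Wpd Sd_le. Qed.

Let SdJSdpsd : possemidefmx (Sd *m J *m Sd).
Proof. by have := psd_congr Sd Jpsd; rewrite SdT. Qed.

Let J_Ad x : qform J (Ad *m x) = qform (Sd *m J *m Sd) (J *m x).
Proof. by rewrite AdE -mulmxA !qformE dot_mulmxl SdT !mulmxA. Qed.

Let Ad_sq x : dot (Ad *m x) (Ad *m x) <= w * a * F x.
Proof.
apply: le_trans (Jle _) _; rewrite -mulrA ler_wpM2l // FE.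
by rewrite J_Ad.
Qed.

Let F_le x : F x <= a * v * dot x x.
Proof.
rewrite FE; apply: le_trans (Sd_le _) _; rewrite -mulrA ler_wpM2l //.
rewrite -qform_inv // mulKVmx //; exact: J_le.
Qed.

Lemma gpart_A_le x : dot (Ad *m x) (Ad *m x) <= theta * dot x x.
Proof.
apply: le_trans (Ad_sq x) _.
have := ler_wpM2l (mulr_ge0 (ltW w_gt0) a_ge0) (F_le x).
move: (dot_ge0 x) => d0 /le_trans; apply; rewrite -subr_ge0.
have -> : theta * dot x x - w * a * (a * v * dot x x) = a ^+ 2 * dot x x by ring.
by rewrite mulr_ge0 ?sqr_ge0.
Qed.

Let aH_le x : a * H x <= theta * dot x x.
Proof.
have h1 : w^-1 * qform Sd x <= a * dot x x.
  rewrite ler_pdivrMl // mulrCA; apply: le_trans (Sd_le x) _.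
  by rewrite ler_wpM2l.
have h2 : w * F x <= w * (a * v * dot x x) by rewrite ler_wpM2l ?F_le.
have h3 : 0 <= a * dot x x by rewrite mulr_ge0 ?dot_ge0.
have h4 : 0 <= w * (a * v * dot x x) by rewrite !mulr_ge0 ?dot_ge0.
have -> : theta * dot x x = a * (a * dot x x + w * (a * v * dot x x)) by ring.
by rewrite ler_wpM2l // /H; lra.
Qed.

Let Ad_sqH x : dot (Ad *m x) (Ad *m x) <= 2 * (a * H x).
Proof.
apply: le_trans (Ad_sq x) _.
have -> : 2 * (a * H x) = a * (w^-1 * qform Sd x) + w * a * F x by rewrite /H; field; rewrite gt_eqF.
by rewrite lerDr mulr_ge0 // mulr_ge0.
Qed.

(** Ad Ad y is Sd W^-1 Sd applied to W^-1 y. Young's inequality for this semi-definite matrix, with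
    the weight 1/w of the envelope, then uses Sd W^-1 Sd <= a Sd on both sides. *)
Let AdAd x y : 2 * `|dot x (Ad *m (Ad *m y))| <= a * (w^-1 * qform Sd x + w * F y).
Proof.
have -> : dot x (Ad *m (Ad *m y)) = dot x ((Sd *m J *m Sd) *m (J *m y)).
  by rewrite AdE !mulmxA.
apply: le_trans (psd_young _ _ SdJSdpsd (_ : 0 < w^-1)) _; first by rewrite invr_gt0.
by rewrite invrK mulrDr FE lerD // mulrCA ler_wpM2l.
Qed.

Let qformSdD x y : qform Sd (x - y) <= 2 * qform Sd x + 2 * qform Sd y.
Proof.
have [_ S0] := Sdpsd; have := S0 (x + y).
have qN : qform Sd (- y) = qform Sd y by rewrite -scaleN1r qformZv sqrrN expr1n mul1r.
by rewrite -[x - y]/(x + - y) !qform_add_sym // mulmxN dotNr qN; lra.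
Qed.

Let F_D x y : F (x - y) <= 2 * F x + 2 * F y.
Proof. by rewrite !FE mulmxBr qformSdD. Qed.

Let H_D x y : H (x - y) <= 2 * H x + 2 * H y.
Proof.
have h1 := ler_wpM2l (ltW w_gt0) (F_D x y).
have h2 := ler_wpM2l wi_ge0 (qformSdD x y).
by rewrite /H; lra.
Qed.

(** For this seminorm Ad shrinks by the factor a alone, free of w and v; this is what compares r
    with e as soon as a <= 1/2. *)
Let F_Ad x : F (Ad *m x) <= a ^+ 2 * F x.
Proof.
rewrite FE; apply: le_trans (Sd_le _) _; rewrite expr2 -mulrA ler_wpM2l // FE.
apply: le_trans (SdJSd_le _).
by rewrite -J_Ad -[leLHS](@qform_inv _ _ W) // mulKVmx.
Qed.

(** The inverse of 1 - Ad is not formed: r = e + Ad r is substituted into itself. What is left is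
    quadratic in Ad and bounded by the envelope. The parameter eta splits the terms in which Ad
    meets l, so that they cost a small multiple of |l|^2. *)
Lemma lso_residual_expansion (eta : R) (eps l r : 'cV[R]_N) :
  a <= 2^-1 -> 0 < eta -> (1%:M - Ad) *m r = eps - l ->
  `|dot r r - dot (eps - l) (eps - l) - 2 * dot eps (Ad *m eps)
    + 2 * dot eps (Ad *m l)|
  <= (32 + 2 / eta) * (a * qform (envelope W w Sd) eps) + (2 * eta + theta / eta + 32 * theta) * dot l l.
Proof.
move=> a2 eta0; rewrite HE; set e := eps - l => re.
have rE : r = e + Ad *m r by rewrite -re mulmxBl mul1mx subrK.
have eE : e = r - Ad *m r by rewrite [X in X - _]rE addrK.
(* F r <= 2 F e + 2 a^2 F r, and 2 a^2 <= 1/2. *)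
have Fr : F r <= 4 * F e.
  have := F_D e (- (Ad *m r)); rewrite opprK -rE => h.
  have FN z : F (- z) = F z by rewrite /F -scaleN1r qformZv sqrrN expr1n mul1r.
  rewrite FN in h; have := F_Ad r => h2.
  have a4 : a ^+ 2 <= 4^-1.
    have -> : 4^-1 = 2^-1 ^+ 2 :> R by field.
    by rewrite ler_pXn2r ?nnegrE ?invr_ge0.
  have := ler_wpM2r (F_ge0 r) a4; lra.
have rest : dot r r = dot e e + 2 * dot e (Ad *m e) + 2 * dot e (Ad *m (Ad *m r))
    + dot (Ad *m r) (Ad *m r).
  have -> : dot r r = dot e e + 2 * dot e (Ad *m r) + dot (Ad *m r) (Ad *m r).
    have sq (z q : 'cV[R]_N) : dot (z + q) (z + q) = dot z z + 2 * dot z q + dot q q.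
      by rewrite !(dotDl, dotDr) (dotC q z); ring.
    by rewrite -sq -rE.
  have -> : dot e (Ad *m r) = dot e (Ad *m e) + dot e (Ad *m (Ad *m r)).
    by rewrite -dotDr -mulmxDr -rE.
  by ring.
(* Each of the two terms contributes 4 w a F e. Raising the coefficient of the other half of H to 8
   as well gives 16 a H e. *)
have Herr : `|2 * dot e (Ad *m (Ad *m r)) + dot (Ad *m r) (Ad *m r)| <= 16 * (a * H e).
  apply: le_trans (ler_normD _ _) _; rewrite normrM (ger0_norm (dot_ge0 _)) ger0_norm //.
  have h1 := AdAd e r; have h2 := Ad_sq r.
  have h3 := ler_wpM2l (mulr_ge0 (ltW w_gt0) a_ge0) Fr.
  have h4 : 0 <= a * (w^-1 * qform Sd e).
    by rewrite !mulr_ge0.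
  have -> : 16 * (a * H e) = 8 * (a * (w^-1 * qform Sd e)) + 8 * (w * a * F e).
    by rewrite /H; field; rewrite gt_eqF.
  have h5 : 0 <= w * a * F e by rewrite !mulr_ge0.
  by rewrite mulrDr mulrCA mulrA in h1; lra.
have He : a * H e <= 2 * (a * H eps) + 2 * (theta * dot l l).
  have := ler_wpM2l a_ge0 (H_D eps l); have := aH_le l; rewrite -/e; lra.
have lAe : 2 * `|dot l (Ad *m eps)| <= eta * dot l l + eta^-1 * (2 * (a * H eps)).
  have := psd_young l (Ad *m eps) (psd1 N) eta0; rewrite mul1mx !qform1 => /le_trans; apply.
  by rewrite lerD2l ler_wpM2l ?Ad_sqH ?invr_ge0 ?ltW.
have lAl : 2 * `|dot l (Ad *m l)| <= eta * dot l l + eta^-1 * (theta * dot l l).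
  have := psd_young l (Ad *m l) (psd1 N) eta0; rewrite mul1mx !qform1 => /le_trans; apply.
  by rewrite lerD2l ler_wpM2l ?gpart_A_le ?invr_ge0 ?ltW.
have eAe : dot e (Ad *m e) = dot eps (Ad *m eps) - dot eps (Ad *m l)
    - dot l (Ad *m eps) + dot l (Ad *m l).
  by rewrite /e mulmxBr !(dotBl, dotBr); ring.
rewrite rest eAe.
move: Herr He lAe lAl; set X := 2 * dot e _ + _ => Herr He lAe lAl.
have -> : dot e e + 2 * (dot eps (Ad *m eps) - dot eps (Ad *m l)
    - dot l (Ad *m eps) + dot l (Ad *m l)) + 2 * dot e (Ad *m (Ad *m r))
    + dot (Ad *m r) (Ad *m r) - dot e e - 2 * dot eps (Ad *m eps)
    + 2 * dot eps (Ad *m l) = X - 2 * dot l (Ad *m eps) + 2 * dot l (Ad *m l).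
  by rewrite /X; ring.
apply: le_trans (ler_normD _ _) _; apply: le_trans (lerD (ler_normB _ _) (lexx _)) _.
rewrite !normrM (ger0_norm (_ : 0 <= 2 :> R)) //.
(* The constant 32 is 16 from [Herr] times 2 from [He]; the terms in 1/eta come from [lAe] and
   [lAl]. *)
have -> : (32 + 2 / eta) * (a * H eps) + (2 * eta + theta / eta + 32 * theta) * dot l l =
  16 * (2 * (a * H eps) + 2 * (theta * dot l l)) + (eta * dot l l + eta^-1 * (2 * (a * H eps)))
  + (eta * dot l l + eta^-1 * (theta * dot l l)).
  by field; rewrite gt_eqF.
by lra.
Qed.

(** The outer Sg costs xi0, Ad^T Ad costs theta, and dropping the diagonal blocks of A does not
    increase the remaining trace. *)
Lemma gpart_A_off_le : \tr ((Ad *m (A - Ad)) *m Sg *m (Ad *m (A - Ad))^T *m Sg)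
  <= xi0 * (theta * tau).
Proof.
set B := A - Ad.
have psdB : possemidefmx (B *m Sg *m B^T) by exact: psd_congrT.
have -> : Ad *m B *m Sg *m (Ad *m B)^T = Ad *m (B *m Sg *m B^T) *m Ad^T.
  by rewrite trmx_mul !mulmxA.
apply: le_trans (tr_mono_scal (psd_congrT Ad psdB) Sg_le_xi) _.
rewrite ler_wpM2l // mxtrace_mulC (mulmxA Ad^T) mxtrace_mulC.
apply: le_trans (@tr_mono_scal _ _ _ (Ad^T *m Ad) theta psdB _) _.
  by move=> x; rewrite qformE -mulmxA dotC dot_mulmxl trmxK gpart_A_le.
rewrite ler_wpM2l ?theta_ge0 // tauE.
have := tr_offpart_le A Sgpsd (psd1 N) Sgd (@gdiag1 _ _ _ g).
by rewrite !mulmx1.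
Qed.

(** Serves the block diagonal part of the noise form of Ad A. It is not centred, so it joins the
    envelope and is treated by its first moment. *)
Lemma gpart_A_sq_le x : `|dot x (Ad *m (Ad *m x))| <= a * qform (envelope W w Sd) x.
Proof.
have := AdAd x x; rewrite HE /H.
have -> : a * (2^-1 * (w^-1 * qform Sd x + w * F x)) =
  2^-1 * (a * (w^-1 * qform Sd x + w * F x)) by ring.
by lra.
Qed.

Lemma envelope_psd M : possemidefmx M -> possemidefmx (envelope W w M).
Proof.
move=> Mpsd; apply: psdZ; first by rewrite invr_ge0.
apply: psdD; apply: psdZ; rewrite ?invr_ge0 ?ltW //.
by have := psd_congr J Mpsd; rewrite JT.
Qed.

Lemma sum_envelope : \sum_i envelope W w (gblock i S) = envelope W w Sd.
Proof.
rewrite /envelope -scaler_sumr big_split /= -!scaler_sumr sum_gblock.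
by rewrite -mulmx_suml -mulmx_sumr sum_gblock.
Qed.

Lemma gblock_envelope i : gblock i (envelope W w (gblock i S)) = envelope W w (gblock i S).
Proof.
have /gdiagP Jc := Jd.
have PX : gproj i *m gblock i S = gblock i S by rewrite /gblock !mulmxA gprojK.
have XP : gblock i S *m gproj i = gblock i S by rewrite /gblock -!mulmxA gprojK.
rewrite /envelope {1}/gblock; move: (gblock i S) PX XP => X PX XP.
rewrite -scalemxAr -scalemxAl mulmxDr mulmxDl -!scalemxAr -!scalemxAl PX XP.
rewrite !mulmxA Jc -(mulmxA J _ X) PX.
by rewrite -(mulmxA _ J (gproj i)) -Jc mulmxA -(mulmxA J _ (gproj i)) XP.
Qed.

Lemma gblock_A_le i x : `|dot x (gblock i A *m x)| <= qform (envelope W w (gblock i S)) x.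
Proof.
have -> : gblock i A = gblock i S *m J.
  by have /gdiagP Jc := Jd; rewrite /gblock AE -!mulmxA Jc.
have Sipsd := psd_gblock g i Spsd.
have := psd_young x (J *m x) Sipsd (_ : 0 < w^-1); rewrite invr_gt0 invrK => /(_ w_gt0).
rewrite qform_envelope -mulmxA.
have -> : qform (J *m gblock i S *m J) x = qform (gblock i S) (J *m x).
  by rewrite !qformE dot_mulmxl JT !mulmxA.
by lra.
Qed.

Lemma tr_envelope_le i : \tr (envelope W w (gblock i S) *m Sg) <= xi0 * \tr (gproj i *m A).
Proof.
have Sipsd := psd_gblock g i Spsd.
rewrite tr_gprojA /envelope -scalemxAl mulmxDl -!scalemxAl mxtraceZ mxtraceD !mxtraceZ.
have h1 : \tr (gblock i S *m Sg) <= s * (w ^+ 2 * \tr (gblock i S *m J)).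
  rewrite -!mxtraceZ !scalemxAr; apply: tr_mono => // x; rewrite !qformZ.
  by apply: le_trans (Sg_le x) _; rewrite ler_wpM2l.
have h2 : \tr (J *m gblock i S *m J *m Sg) <= s * \tr (gblock i S *m J).
  have -> : \tr (gblock i S *m J) = \tr (J *m gblock i S *m J *m W).
    by rewrite mulmxKV // mxtrace_mulC.
  rewrite -mxtraceZ scalemxAr; apply: tr_mono => [|x]; last by rewrite qformZ.
  by have := psd_congr J Sipsd; rewrite JT.
have := ler_wpM2l wi_ge0 h1; have := ler_wpM2l w_ge0 h2.
have -> : w^-1 * (s * (w ^+ 2 * \tr (gblock i S *m J))) = w * (s * \tr (gblock i S *m J)).
  by field; rewrite gt_eqF.
by lra.
Qed.

Lemma sum_tr_gproj_A : \sum_i \tr (gproj i *m A) = \tr A.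
Proof. by rewrite -linear_sum /= -mulmx_suml sum_gproj mul1mx. Qed.

End bounds.

(** * Expectation and independence *)

Section expectation.
Context {d : measure_display} {T : measurableType d} {R : realType}.
Variable P : probability T R.
Implicit Types (f g X Y : T -> R).

Definition intble f := P.-integrable setT (EFin \o f).

(** A real number, with infinite integrals sent to 0: it is meaningful only together with [intble],
    so many statements below prove both. *)
Definition Ex f : R := \int[P]_w f w.

Lemma intble_measurable f : intble f -> measurable_fun setT f.
Proof. by move=> /measurable_int /measurable_EFinP. Qed.

Lemma intbleE f : intble f -> (\int[P]_w (f w)%:E)%E = (Ex f)%:E.
Proof. by move=> If; rewrite /Ex /Rintegral fineK // integrable_fin_num. Qed.

Lemma intbleD f g : intble f -> intble g -> intble (fun w => f w + g w).
Proof. by move=> If Ig; apply: eq_integrable (integrableD _ If Ig). Qed.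

Lemma intbleZ a f : intble f -> intble (fun w => a * f w).
Proof. by move=> If; apply: eq_integrable (integrableZl _ a If). Qed.

Lemma intble_cst a : intble (fun=> a).
Proof. exact: finite_measure_integrable_cst. Qed.

Lemma intble_le f g : measurable_fun setT f -> intble g ->
  (forall w, `|f w| <= `|g w|) -> intble f.
Proof.
move=> mf Ig fg; apply: le_integrable Ig => //; first exact/measurable_EFinP.
by move=> w _ /=; rewrite lee_fin.
Qed.

Lemma intble_sum (I : Type) (r : seq I) (F : I -> T -> R) :
  (forall i, intble (F i)) -> intble (fun w => \sum_(i <- r) F i w).
Proof.
move=> IF; elim: r => [|i r IH].
  by under eq_fun do rewrite big_nil; exact: intble_cst.
by under eq_fun do rewrite big_cons; exact: intbleD.
Qed.

Lemma intble_ge0 f c : measurable_fun setT f -> (forall w, 0 <= f w) ->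
  (\int[P]_w (f w)%:E <= c%:E)%E -> intble f /\ Ex f <= c.
Proof.
move=> mf f0 fc.
have If : intble f.
  apply/integrableP; split; first exact/measurable_EFinP.
  under eq_integral => w _ do rewrite /= ger0_norm //.
  exact: le_lt_trans fc (ltry _).
by split=> //; rewrite -lee_fin -intbleE.
Qed.

Lemma ExD f g : intble f -> intble g -> Ex (fun w => f w + g w) = Ex f + Ex g.
Proof. exact: RintegralD. Qed.

Lemma ExZ a f : intble f -> Ex (fun w => a * f w) = a * Ex f.
Proof. exact: RintegralZl. Qed.

Lemma Ex_cst a : Ex (fun=> a) = a.
Proof. by rewrite /Ex Rintegral_cst //= [P _]probability_setT mulr1. Qed.

Lemma Ex_ge0 f : (forall w, 0 <= f w) -> 0 <= Ex f.
Proof. by move=> f0; apply: Rintegral_ge0. Qed.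

Lemma Ex_le f g : intble f -> intble g -> (forall w, f w <= g w) -> Ex f <= Ex g.
Proof. by move=> If Ig fg; apply: le_Rintegral. Qed.

Lemma Ex_sum (I : Type) (r : seq I) (F : I -> T -> R) :
  (forall i, intble (F i)) ->
  Ex (fun w => \sum_(i <- r) F i w) = \sum_(i <- r) Ex (F i).
Proof.
move=> IF; elim: r => [|i r IH].
  by rewrite big_nil; under eq_fun do rewrite big_nil; exact: Ex_cst.
rewrite big_cons; under eq_fun do rewrite big_cons.
by rewrite ExD // ?IH //; exact: intble_sum.
Qed.

Lemma Ex_indic (E : set T) : measurable E -> Ex \1_E = fine (P E).
Proof. by move=> mE; rewrite /Ex /Rintegral integral_indic // setIT. Qed.

Lemma intble_indic (E : set T) : measurable E -> intble \1_E.
Proof. by move=> mE; exact: integrable_indic. Qed.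

Lemma Ex_monotone_cvg (h : nat -> T -> R) f :
  (forall m, measurable_fun setT (h m)) -> (forall m w, 0 <= h m w) ->
  (forall w, nondecreasing_seq (h ^~ w)) -> (forall w, h ^~ w @ \oo --> f w) ->
  (\int[P]_w (h m w)%:E @[m --> \oo] --> \int[P]_w (f w)%:E)%E.
Proof.
move=> mh h0 nd cv.
have -> : (\int[P]_w (f w)%:E = \int[P]_w limn (fun m => (h m w)%:E))%E.
  apply: eq_integral => w _; apply/esym/cvg_lim => //.
  by apply: cvg_EFin (cv w); exact: nearW.
apply: cvg_monotone_convergence => //.
- by move=> m; exact/measurable_EFinP.
- by move=> m w _; rewrite lee_fin.
- by move=> w _ m1 m2 m12; rewrite lee_fin nd.
Qed.

Section independence.
Import HBNNSimple.
Variables (n : nat) (F : 'I_n -> set (set T)).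
Hypothesis Fm : forall i, F i `<=` measurable.
Hypothesis Findep : forall (J : {set 'I_n}) (E : 'I_n -> set T),
  (forall i, i \in J -> <<s F i >> (E i)) ->
  P (\bigcap_(i in [set` J]) E i) = (\prod_(i in J) P (E i))%E.

Definition Fmeas i X := @measurable_fun _ _ (g_sigma_algebraType (F i)) R setT X.

Lemma sigma_sub_measurable i : <<s F i >> `<=` measurable.
Proof. by apply: smallest_sub => //; exact: sigma_algebra_measurable. Qed.

Lemma Fmeas_measurable i X : Fmeas i X -> measurable_fun setT X.
Proof.
move=> mX _ B mB; apply: (@sigma_sub_measurable i).
exact: (mX _ B mB).
Qed.

(** Independence is given for events. The indicators are replaced by arbitrary nonnegative factors
    one index at a time: at stage k only the factors of index at least k need be indicators. *)
Lemma prod_indep_ge0 (X : 'I_n -> T -> R) (c : 'I_n -> R) :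
  (forall i w, 0 <= X i w) -> (forall i, Fmeas i (X i)) ->
  (forall i, (\int[P]_w (X i w)%:E = (c i)%:E)%E) ->
  (\int[P]_w (\prod_i X i w)%:E = (\prod_i c i)%:E)%E.
Proof.
suff H k : forall (X : 'I_n -> T -> R) (c : 'I_n -> R),
  (forall i w, 0 <= X i w) -> (forall i, Fmeas i (X i)) ->
  (forall i, (\int[P]_w (X i w)%:E = (c i)%:E)%E) ->
  (forall i : 'I_n, (k <= i)%N -> exists2 E, <<s F i >> E & X i = \1_E) ->
  (\int[P]_w (\prod_i X i w)%:E = (\prod_i c i)%:E)%E.
  move=> X0 mX cX; apply: (H n) => // i; rewrite leqNgt ltn_ord //.
elim: k => [|k IH] {}X {}c X0 mX cX indX.
  have [E FE XE] : exists2 E : 'I_n -> set T, forall i, <<s F i >> (E i) &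
      forall i, X i = \1_(E i).
    have h i : exists E, <<s F i >> E /\ X i = \1_E.
      by have [E] := indX i (leq0n i); exists E.
    by exists (fun i => projT1 (cid (h i))) => i; case: (cid (h i)) => ? [].
  have mE i : measurable (E i) by apply: (@sigma_sub_measurable i).
  have cE i : P (E i) = (c i)%:E.
    by rewrite -cX XE integral_indic // setIT.
  pose J : {set 'I_n} := finset.setTfor 'I_n.
  have -> : (fun w => (\prod_i X i w)%:E) =
      (fun w => (\1_(\bigcap_(i in [set` J]) E i) w)%:E).
    apply/funext => w; congr EFin; under eq_bigr => i _ do rewrite XE indicE.
    rewrite indicE; case: (pselect (forall i, E i w)) => [h|/existsNP[i h]].
      by rewrite big1 => [|i _]; rewrite mem_set // => i _; exact: h.
    rewrite (bigD1 i) //= memNset // mul0r memNset // => h2; apply: h.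
    by apply: h2; rewrite /= inE.
  rewrite integral_indic //; last by apply: fin_bigcap_measurable.
  rewrite setIT; apply: (eq_trans (@Findep J E (fun i _ => FE i))).
  by rewrite -prodEFin; apply: eq_big => [i|i _]; rewrite ?inE.
have [nk|kn] := leqP n k.
  by apply: IH => // i /(leq_trans nk); rewrite leqNgt ltn_ord.
pose i0 := Ordinal kn.
pose G w := \prod_(i | i != i0) X i w.
pose C := \prod_(i | i != i0) c i.
have G0 w : 0 <= G w by apply: prodr_ge0.
have mXT i : measurable_fun setT (X i) by exact: Fmeas_measurable (mX i).
have mG : measurable_fun setT G.
  rewrite /G; under eq_fun do rewrite -big_filter.
  by apply: measurable_prod => i _.
(* The product rule with an indicator at index k, from the induction hypothesis; simple functions
   follow by linearity and [X i0] by monotone convergence. *)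
have step E : <<s F i0 >> E ->
    intble (fun w => \1_E w * G w) /\ Ex (fun w => \1_E w * G w) = Ex \1_E * C.
  move=> FE; have mE : measurable E by exact: (@sigma_sub_measurable i0).
  have := IH (fun i => if i == i0 then \1_E else X i)
             (fun i => if i == i0 then Ex \1_E else c i).
  have -> : \prod_i (if i == i0 then Ex \1_E else c i) = Ex \1_E * C.
    rewrite (bigD1 i0) //= eqxx; congr (_ * _).
    by apply: eq_bigr => i /negPf ->.
  have -> : (fun w => (\prod_i (if i == i0 then \1_E else X i) w)%:E) =
      (fun w => (\1_E w * G w)%:E).
    apply/funext => w; rewrite (bigD1 i0) //= eqxx; congr (_ * _)%:E.
    by apply: eq_bigr => i /negPf ->.
  move=> H; have {}H : (\int[P]_w (\1_E w * G w)%:E = (Ex \1_E * C)%:E)%E.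
    apply: H.
    - by move=> i w; case: ifP.
    - move=> i; case: eqVneq => [->|_ //].
      exact: (@measurable_indic _ (g_sigma_algebraType (F i0)) R setT E FE).
    - move=> i; case: eqVneq => // _; rewrite intbleE //; exact: intble_indic.
    - move=> i ki; case: eqVneq => [->|ii0]; first by exists E.
      apply: indX; rewrite ltn_neqAle ki andbT; apply: contra ii0 => /eqP ki'.
      by apply/eqP/val_inj.
  have [|||I1 _] := @intble_ge0 (fun w => \1_E w * G w) (Ex \1_E * C).
  - by apply: measurable_funM => //; exact: measurable_indic.
  - by move=> w; rewrite mulr_ge0.
  - by rewrite H.
  by split=> //; apply: EFin_inj; rewrite -intbleE.
have mX0 : @measurable_fun _ _ (g_sigma_algebraType (F i0)) _ setT (EFin \o X i0).
  by apply/measurable_EFinP; exact: mX.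
(* The approximation is taken inside the sigma-algebra of subject k, so that its level sets are
   admissible for [step]. *)
pose phi := @nnsfun_approx _ (g_sigma_algebraType (F i0)) R setT measurableT _ mX0.
have phiG m : (\int[P]_w (phi m w * G w)%:E = (\int[P]_w (phi m w)%:E) * C%:E)%E.
  pose s : seq R := finmap.enum_fset (fset_set (range (phi m))).
  pose E (r : R) : set T := phi m @^-1` [set r].
  have FE j : <<s F i0 >> (E j).
    exact: (@measurable_funPTI _ _ (g_sigma_algebraType (F i0)) R (phi m) _
      (measurable_set1 j)).
  have mE j : measurable (E j) by exact: (@sigma_sub_measurable i0).
  have phiE w : phi m w = \sum_(j <- s) (j * \1_(E j) w).
    by rewrite fimfunE fsbig_finite.
  have -> : (fun w => (phi m w * G w)%:E) =
     (fun w => (\sum_(j <- s) (j * (\1_(E j) w * G w)))%:E).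
    apply/funext => w; rewrite phiE mulr_suml; congr EFin.
    by apply: eq_bigr => j _; rewrite mulrA.
  have -> : (fun w => (phi m w)%:E) =
     (fun w => (\sum_(j <- s) (j * \1_(E j) w))%:E).
    by apply/funext => w; rewrite phiE.
  rewrite !intbleE; first last.
  - by apply: intble_sum => j; apply: intbleZ; case: (step _ (FE j)).
  - by apply: intble_sum => j; apply: intbleZ; exact: intble_indic.
  rewrite -EFinM !Ex_sum; first last.
  - by move=> j; apply: intbleZ; case: (step _ (FE j)).
  - by move=> j; apply: intbleZ; exact: intble_indic.
  rewrite mulr_suml; congr EFin; apply: eq_bigr => j _.
  have [I1 E1] := step _ (FE j).
  by rewrite !ExZ ?E1 ?mulrA //; exact: intble_indic.
have phi_cvg (w : T) : phi ^~ w @ \oo --> X i0 w.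
  have : EFin \o phi ^~ w @ \oo --> (X i0 w)%:E.
    by apply: (@cvg_nnsfun_approx _ (g_sigma_algebraType (F i0))) => // ? _; rewrite lee_fin.
  by move/fine_cvgP => [_]; apply: cvg_trans; apply: near_eq_cvg; exact: nearW.
have phi_nd (w : T) : nondecreasing_seq (phi ^~ w).
  move=> m1 m2 m12.
  by have /lefP := @nd_nnsfun_approx _ (g_sigma_algebraType (F i0)) R setT measurableT _ mX0 _ _ m12; apply.
have phi0 m (w : T) : 0 <= phi m w by [].
have mphi m : @measurable_fun _ _ T R setT (phi m).
  apply: (@Fmeas_measurable i0).
  exact: (@measurable_funPT _ _ (g_sigma_algebraType (F i0)) R (phi m)).
have h1 := Ex_monotone_cvg mphi phi0 phi_nd phi_cvg.
have h2 : (\int[P]_w (phi m w * G w)%:E @[m --> \oo] --> \int[P]_w (X i0 w * G w)%:E)%E.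
  apply: Ex_monotone_cvg.
  - by move=> m; exact: measurable_funM.
  - by move=> m w; exact: mulr_ge0.
  - by move=> w m1 m2 m12; rewrite ler_wpM2r // phi_nd.
  - by move=> w; apply: cvgM => //; exact: cvg_cst.
have h3 : (\int[P]_w (phi m w * G w)%:E @[m --> \oo] --> (\int[P]_w (X i0 w)%:E) * C%:E)%E.
  under eq_fun do rewrite phiG.
  exact: cvgeMr.
rewrite cX in h3.
have := cvg_unique _ h2 h3; rewrite -EFinM => e.
have -> : (fun w => (\prod_i X i w)%:E) = (fun w => (X i0 w * G w)%:E).
  by apply/funext => w; rewrite (bigD1 i0).
by rewrite e // (bigD1 i0).
Qed.
Lemma Fmeas_cst i a : Fmeas i (fun=> a).
Proof. exact: (@measurable_cst _ _ (g_sigma_algebraType (F i))). Qed.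

Lemma FmeasD i X Y : Fmeas i X -> Fmeas i Y -> Fmeas i (fun w => X w + Y w).
Proof. exact: (@measurable_funD _ (g_sigma_algebraType (F i))). Qed.

Lemma FmeasM i X Y : Fmeas i X -> Fmeas i Y -> Fmeas i (fun w => X w * Y w).
Proof. exact: (@measurable_funM _ (g_sigma_algebraType (F i))). Qed.

Lemma Fmeas_max i X Y : Fmeas i X -> Fmeas i Y -> Fmeas i (fun w => Num.max (X w) (Y w)).
Proof. exact: (@measurable_maxr _ (g_sigma_algebraType (F i))). Qed.

Lemma Fmeas_sum i (I : Type) (r : seq I) (X : I -> T -> R) :
  (forall k, Fmeas i (X k)) -> Fmeas i (fun w => \sum_(k <- r) X k w).
Proof. exact: (@measurable_sum _ (g_sigma_algebraType (F i))). Qed.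

(** Each factor is split into positive and negative parts, and the product is expanded over all
    choices of parts. *)
Lemma prod_indep (X : 'I_n -> T -> R) :
  (forall i, intble (X i)) -> (forall i, Fmeas i (X i)) ->
  intble (fun w => \prod_i X i w) /\
  Ex (fun w => \prod_i X i w) = \prod_i Ex (X i).
Proof.
move=> IX mX.
pose Y (i : 'I_n) (b : bool) (w : T) := if b then Num.max (X i w) 0 else Num.max (- X i w) 0.
have mY i b : Fmeas i (Y i b).
  rewrite /Y; case: b; apply: Fmeas_max => //; try exact: Fmeas_cst.
  under eq_fun do rewrite -mulN1r; apply: FmeasM => //; exact: Fmeas_cst.
have Y0 i b w : 0 <= Y i b w by rewrite /Y; case: b; rewrite le_max lexx orbT.
have IY i b : intble (Y i b).
  apply: intble_le (IX i) _; first exact: Fmeas_measurable (mY i b).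
  move=> w; rewrite ger0_norm // /Y; case: b; rewrite ge_max normr_ge0 andbT.
    exact: ler_norm.
  by rewrite -normrN ler_norm.
have XY i w : X i w = \sum_(b : bool) (-1) ^+ (~~ b) * Y i b w.
  rewrite big_bool /= expr0 expr1 /Y mul1r mulN1r.
  have [h|h] := boolP (X i w <= 0).
    by rewrite (max_idPr h) (max_idPl _) ?oppr_ge0 // sub0r opprK.
  rewrite -ltNge in h.
  by rewrite (max_idPl (ltW h)) (max_idPr _) ?oppr_le0 ?(ltW h) // subr0.
have key (f : {ffun 'I_n -> bool}) :
    intble (fun w => \prod_i Y i (f i) w) /\
    Ex (fun w => \prod_i Y i (f i) w) = \prod_i Ex (Y i (f i)).
  have h := @prod_indep_ge0 (fun i => Y i (f i)) (fun i => Ex (Y i (f i)))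
    (fun i => Y0 i (f i)) (fun i => mY i (f i)) (fun i => intbleE (IY i (f i))).
  have [|||I1 _] := @intble_ge0 (fun w => \prod_i Y i (f i) w) (\prod_i Ex (Y i (f i))).
  - by apply: measurable_prod => i _; exact: Fmeas_measurable (mY i (f i)).
  - by move=> w; apply: prodr_ge0.
  - by rewrite h.
  by split=> //; apply: EFin_inj; rewrite -intbleE.
have -> : (fun w => \prod_i X i w) = (fun w => \sum_(f : {ffun 'I_n -> bool})
    (\prod_i (-1) ^+ (~~ f i)) * \prod_i Y i (f i) w).
  apply/funext => w; under eq_bigr => i _ do rewrite XY.
  rewrite bigA_distr_bigA; apply: eq_bigr => f _.
  by rewrite -big_split.
split; first by apply: intble_sum => f; apply: intbleZ; case: (key f).
rewrite Ex_sum; last by move=> f; apply: intbleZ; case: (key f).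
under [RHS]eq_bigr => i _.
  have -> : Ex (X i) = \sum_(b : bool) (-1) ^+ (~~ b) * Ex (Y i b).
    have -> : X i = fun w => \sum_(b : bool) (-1) ^+ (~~ b) * Y i b w.
      by apply/funext => w.
    rewrite Ex_sum => [|b]; last exact: intbleZ.
    by apply: eq_bigr => b _; rewrite ExZ.
  over.
rewrite bigA_distr_bigA; apply: eq_bigr => f _.
have [I1 E1] := key f.
by rewrite ExZ // E1 -big_split.
Qed.

End independence.
End expectation.

(** * Moments of quadratic forms in the noise *)

Definition evec (R : realType) (T : Type) (N : nat) (eps : 'I_N -> T -> R) w : 'cV[R]_N :=
  \col_s eps s w.

(* Noise coordinates eps s, grouped by subject g s; F i generates the sigma-algebra
   of subject i. The last field is Condition 1 freed from the standardization. *)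
Record grouped_noise (d : measure_display) (T : measurableType d) (R : realType)
    (P : probability T R) (n : nat) (F : 'I_n -> set (set T)) (N : nat)
    (g : 'I_N -> 'I_n) (eps : 'I_N -> T -> R) (Sg : 'M[R]_N) (K : R) : Prop :=
  GroupedNoise {
  gn_Fm : forall i, F i `<=` measurable;
  gn_Findep : forall (J : {set 'I_n}) (E : 'I_n -> set T),
    (forall i, i \in J -> <<s F i >> (E i)) ->
    P (\bigcap_(i in [set` J]) E i) = (\prod_(i in J) P (E i))%E;
  gn_meas : forall s, Fmeas F (g s) (eps s);
  gn_int : forall s, intble P (eps s);
  gn_int2 : forall s t, intble P (fun w => eps s w * eps t w);
  gn_mean : forall s, Ex P (eps s) = 0;
  gn_cov : forall s t, g s = g t -> Ex P (fun w => eps s w * eps t w) = Sg s t;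
  gn_Sgpd : posdefmx Sg;
  gn_Sgd : gdiag g Sg;
  gn_fourth : forall i v, gproj g i *m v = v ->
    intble P (fun w => dot v (evec eps w) ^+ 4) /\
    Ex P (fun w => dot v (evec eps w) ^+ 4) <= K * qform Sg v ^+ 2
}.

Section noise_forms.
Context {d : measure_display} {T : measurableType d} {R : realType}.
Variable P : probability T R.
Variables (n : nat) (F : 'I_n -> set (set T)).
Variables (N : nat) (g : 'I_N -> 'I_n) (eps : 'I_N -> T -> R) (Sg : 'M[R]_N) (K : R).
Local Notation intble := (intble P).
Local Notation Ex := (Ex P).
Local Notation evec := (evec eps).
Hypothesis HN : grouped_noise P F g eps Sg K.

Let Fm : forall i, F i `<=` measurable. Proof. by case: HN. Qed.
Let Findep : forall (J : {set 'I_n}) (E : 'I_n -> set T),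
  (forall i, i \in J -> <<s F i >> (E i)) ->
  P (\bigcap_(i in [set` J]) E i) = (\prod_(i in J) P (E i))%E.
Proof. by case: HN. Qed.
Let eps_meas : forall s, Fmeas F (g s) (eps s). Proof. by case: HN. Qed.
Let eps_int : forall s, intble (eps s). Proof. by case: HN. Qed.
Let eps_int2 : forall s t, intble (fun w => eps s w * eps t w). Proof. by case: HN. Qed.
Let eps_mean : forall s, Ex (eps s) = 0. Proof. by case: HN. Qed.
Let eps_cov : forall s t, g s = g t -> Ex (fun w => eps s w * eps t w) = Sg s t.
Proof. by case: HN. Qed.
Let Sgpd : posdefmx Sg. Proof. by case: HN. Qed.
Let Sgd : gdiag g Sg. Proof. by case: HN. Qed.
Let eps4 : forall i v, gproj g i *m v = v ->
  intble (fun w => dot v (evec w) ^+ 4) /\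
  Ex (fun w => dot v (evec w) ^+ 4) <= K * qform Sg v ^+ 2.
Proof. by case: HN. Qed.

Let SgT : Sg^T = Sg. Proof. by case: Sgpd. Qed.
Let Sgpsd : possemidefmx Sg. Proof. exact: pd_psd. Qed.
Let SgC s t : Sg s t = Sg t s. Proof. by rewrite -[in LHS]SgT mxE. Qed.

(** For coordinates of distinct subjects, this rewrites eps s * eps t as a product with one factor
    per subject, the form to which independence applies. *)
Let pairf s t (i : 'I_n) (w : T) : R :=
  if i == g s then eps s w else if i == g t then eps t w else 1.

Let prod_pairf s t w : g s != g t -> \prod_i pairf s t i w = eps s w * eps t w.
Proof.
move=> st; rewrite (bigD1 (g s)) //= /pairf eqxx; congr (_ * _).
have ts : g t != g s by rewrite eq_sym.
rewrite (bigD1 (g t)) //= (negPf ts) eqxx big1 ?mulr1 // => i.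
by case/andP => /negPf -> /negPf ->.
Qed.

Let Fmeas_pairf s t i : Fmeas F i (pairf s t i).
Proof.
rewrite /pairf; case: eqVneq => [->|_]; first exact: eps_meas.
case: eqVneq => [->|_]; [exact: eps_meas | exact: Fmeas_cst].
Qed.

(** A factor [pairf] holds at most one coordinate, so two of them at one subject involve second
    moments only. *)
Let intble_pairfM s t u v i : intble (fun w => pairf s t i w * pairf u v i w).
Proof.
have e1 r : intble (fun w => eps r w * 1) by under eq_fun do rewrite mulr1.
have e2 r : intble (fun w => 1 * eps r w) by under eq_fun do rewrite mul1r.
rewrite /pairf; do 4 (case: (i == _) => //).
exact: intble_cst.
Qed.

Let Ex_four s t u v : g s != g t -> g u != g v ->
  intble (fun w => eps s w * eps t w * (eps u w * eps v w)) /\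
  Ex (fun w => eps s w * eps t w * (eps u w * eps v w)) =
  \prod_i Ex (fun w => pairf s t i w * pairf u v i w).
Proof.
move=> st uv.
have -> : (fun w => eps s w * eps t w * (eps u w * eps v w)) =
    (fun w => \prod_i (pairf s t i w * pairf u v i w)).
  by apply/funext => w; rewrite big_split /= !prod_pairf.
apply: (prod_indep Fm Findep) => i; first exact: intble_pairfM.
by apply: FmeasM; exact: Fmeas_pairf.
Qed.

Let Ex_cov s t : Ex (fun w => eps s w * eps t w) = Sg s t.
Proof.
have [st|st] := eqVneq (g s) (g t); first exact: eps_cov.
rewrite Sgd //.
have -> : (fun w => eps s w * eps t w) = (fun w => \prod_i pairf s t i w).
  by apply/funext => w; rewrite prod_pairf.
have int1 i : intble (pairf s t i).
  by rewrite /pairf; do 2 (case: (i == _) => //); exact: intble_cst.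
have [_ ->] := prod_indep Fm Findep int1 (Fmeas_pairf s t).
by rewrite (bigD1 (g s)) //= {1}/pairf eqxx eps_mean mul0r.
Qed.

(** The Gaussian pairing formula, valid here without normality: a subject that occurs once
    contributes a mean 0, so the subjects of s and t must match those of u and v, in one of two
    orders. *)
Let Ex_four_cov s t u v : g s != g t -> g u != g v ->
  Ex (fun w => eps s w * eps t w * (eps u w * eps v w)) =
  Sg s u * Sg t v + Sg s v * Sg t u.
Proof.
have paired s' t' u' v' : g s' != g t' -> g u' != g v' -> g s' = g u' ->
    Ex (fun w => eps s' w * eps t' w * (eps u' w * eps v' w)) =
    Sg s' u' * Sg t' v' + Sg s' v' * Sg t' u'.
  move=> st uv su; have [_ ->] := Ex_four st uv.
  rewrite (Sgd (_ : g s' != g v')) ?su // mul0r addr0.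
  have gt : g t' != g u' by rewrite -su eq_sym.
  rewrite (bigD1 (g t')) //= {1 2}/pairf eq_sym (negPf st) eqxx (negPf gt).
  have [tv|tv] := eqVneq (g t') (g v'); last first.
    by under eq_fun do rewrite mulr1; rewrite eps_mean (Sgd tv) mul0r mulr0.
  rewrite Ex_cov mulrC; congr (_ * _).
  rewrite (bigD1 (g s')) //= big1 => [|i /andP[it is']].
    by rewrite /pairf eqxx su eqxx Ex_cov mulr1.
  have iu : i != g u' by rewrite -su.
  have iv : i != g v' by rewrite -tv.
  rewrite /pairf (negPf it) (negPf is') (negPf iu) (negPf iv).
  by under eq_fun do rewrite mulr1; exact: Ex_cst.
move=> st uv; have [su|su] := eqVneq (g s) (g u); first exact: paired.
have [sv|sv] := eqVneq (g s) (g v).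
  rewrite addrC -paired //; last by rewrite eq_sym.
  by congr Ex; apply/funext => w; rewrite (mulrC (eps u w)).
rewrite (Sgd su) (Sgd sv) !mul0r addr0; have [_ ->] := Ex_four st uv.
rewrite (bigD1 (g s)) //= {1 2}/pairf eqxx (negPf su) (negPf sv).
by under eq_fun do rewrite mulr1; rewrite eps_mean mul0r.
Qed.

Lemma dot_evec (M : 'M[R]_N) w : dot (evec w) (M *m evec w) =
  \sum_(p : 'I_N * 'I_N) M p.1 p.2 * (eps p.1 w * eps p.2 w).
Proof.
rewrite dotE -(pair_bigA _ (fun s t => M s t * (eps s w * eps t w))) /=.
apply: eq_bigr => s _; rewrite !mxE mulr_sumr; apply: eq_bigr => t _.
by rewrite !mxE mulrCA.
Qed.

Lemma intble_qform (M : 'M[R]_N) : intble (fun w => dot (evec w) (M *m evec w)).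
Proof.
under eq_fun do rewrite dot_evec.
by apply: intble_sum => p; exact: intbleZ.
Qed.

Lemma Ex_qform (M : 'M[R]_N) : Ex (fun w => dot (evec w) (M *m evec w)) = \tr (M *m Sg).
Proof.
under eq_fun do rewrite dot_evec.
rewrite Ex_sum => [|p]; last exact: intbleZ.
rewrite /mxtrace.
under [RHS]eq_bigr => s _ do rewrite mxE.
rewrite pair_bigA /=; apply: eq_bigr => p _.
by rewrite ExZ // Ex_cov SgC.
Qed.

Lemma Ex_linform (c : 'cV[R]_N) :
  intble (fun w => dot c (evec w)) /\ Ex (fun w => dot c (evec w)) = 0.
Proof.
have e : (fun w => dot c (evec w)) = (fun w => \sum_s c s 0 * eps s w).
  by apply/funext => w; rewrite dotE; apply: eq_bigr => s _; rewrite mxE.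
rewrite e; split; first by apply: intble_sum => s; exact: intbleZ.
rewrite Ex_sum => [|s]; last exact: intbleZ.
by rewrite big1 // => s _; rewrite ExZ // eps_mean mulr0.
Qed.

Lemma Ex_linform_sq (c : 'cV[R]_N) :
  intble (fun w => dot c (evec w) ^+ 2) /\
  Ex (fun w => dot c (evec w) ^+ 2) = qform Sg c.
Proof.
have -> : (fun w => dot c (evec w) ^+ 2) = (fun w => dot (evec w) ((c *m c^T) *m evec w)).
  by apply/funext => w; rewrite -qformE qform_rank1.
split; first exact: intble_qform.
by rewrite Ex_qform -mulmxA mxtrace_mulC trace_mx11.
Qed.

(** The second moment is exactly tr(M Sg M^T Sg) + tr(M Sg M Sg), one trace for each way of pairing
    the coordinates. *)
Lemma Ex_offdiag_sq (M : 'M[R]_N) : gpart g M = 0 ->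
  intble (fun w => dot (evec w) (M *m evec w) ^+ 2) /\
  Ex (fun w => dot (evec w) (M *m evec w) ^+ 2) <= 2 * \tr (M *m Sg *m M^T *m Sg).
Proof.
move=> M0; have Moff s t : g s = g t -> M s t = 0.
  by move=> st; have /matrixP/(_ s t) := M0; rewrite !mxE st eqxx.
pose h (q : ('I_N * 'I_N) * ('I_N * 'I_N)) (w : T) :=
  (M q.1.1 q.1.2 * M q.2.1 q.2.2) *
  (eps q.1.1 w * eps q.1.2 w * (eps q.2.1 w * eps q.2.2 w)).
have sqE : (fun w => dot (evec w) (M *m evec w) ^+ 2) = (fun w => \sum_q h q w).
  apply/funext => w; rewrite dot_evec expr2 mulr_suml.
  rewrite -(pair_bigA _ (fun p q => h (p, q) w)) /=; apply: eq_bigr => p _.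
  by rewrite mulr_sumr; apply: eq_bigr => q _; rewrite /h /= mulrACA.
have hq q : intble (h q) /\ Ex (h q) = M q.1.1 q.1.2 * M q.2.1 q.2.2 *
    (Sg q.1.1 q.2.1 * Sg q.1.2 q.2.2 + Sg q.1.1 q.2.2 * Sg q.1.2 q.2.1).
  have zero : M q.1.1 q.1.2 * M q.2.1 q.2.2 = 0 -> intble (h q) /\ Ex (h q) = 0.
    move=> z; have -> : h q = fun=> 0 by apply/funext => w; rewrite /h z mul0r.
    by split; [exact: intble_cst | exact: Ex_cst].
  have [e1|e1] := eqVneq (g q.1.1) (g q.1.2).
    by rewrite Moff ?mul0r //; apply: zero; rewrite Moff ?mul0r.
  have [e2|e2] := eqVneq (g q.2.1) (g q.2.2).
    by rewrite (Moff q.2.1) ?mulr0 ?mul0r //; apply: zero; rewrite (Moff q.2.1) ?mulr0.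
  have [I1 _] := Ex_four e1 e2.
  by split; [exact: intbleZ | rewrite ExZ // Ex_four_cov].
rewrite sqE; split; first by apply: intble_sum => q; case: (hq q).
rewrite Ex_sum; last by move=> q; case: (hq q).
have trT : \tr (M *m Sg *m M^T *m Sg) = \sum_(q : ('I_N * 'I_N) * ('I_N * 'I_N))
    M q.1.1 q.1.2 * M q.2.1 q.2.2 * (Sg q.1.1 q.2.1 * Sg q.1.2 q.2.2).
  rewrite -(pair_bigA _ (fun p q => M p.1 p.2 * M q.1 q.2 * (Sg p.1 q.1 * Sg p.2 q.2))) /=.
  rewrite -(pair_bigA _ (fun s t => \sum_(q : 'I_N * 'I_N) M s t * M q.1 q.2 * (Sg s q.1 * Sg t q.2))) /=.
  apply: eq_bigr => s _; rewrite mxE.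
  transitivity (\sum_j \sum_t \sum_v M s t * M j v * (Sg s j * Sg t v)).
    apply: eq_bigr => u _; rewrite mxE mulr_suml exchange_big; apply: eq_bigr => v _.
    rewrite mxE !mulr_suml; apply: eq_bigr => t _.
    by rewrite mxE (SgC u s); ring.
  by rewrite exchange_big; apply: eq_bigr => t _; rewrite pair_bigA.
have tr2 : \tr (M *m Sg *m M *m Sg) = \sum_(q : ('I_N * 'I_N) * ('I_N * 'I_N))
    M q.1.1 q.1.2 * M q.2.1 q.2.2 * (Sg q.1.1 q.2.2 * Sg q.1.2 q.2.1).
  rewrite -(pair_bigA _ (fun p q => M p.1 p.2 * M q.1 q.2 * (Sg p.1 q.2 * Sg p.2 q.1))) /=.
  rewrite -(pair_bigA _ (fun s t => \sum_(q : 'I_N * 'I_N) M s t * M q.1 q.2 * (Sg s q.2 * Sg t q.1))) /=.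
  apply: eq_bigr => s _; rewrite mxE.
  transitivity (\sum_v \sum_t \sum_u M s t * M u v * (Sg s v * Sg t u)).
    apply: eq_bigr => v _; rewrite mxE mulr_suml exchange_big; apply: eq_bigr => u _.
    rewrite mxE !mulr_suml; apply: eq_bigr => t _.
    by rewrite (SgC v s); ring.
  rewrite exchange_big; apply: eq_bigr => t _.
  by rewrite exchange_big pair_bigA.
have -> : \sum_q Ex (h q) = \tr (M *m Sg *m M^T *m Sg) + \tr (M *m Sg *m M *m Sg).
  rewrite trT tr2 -big_split; apply: eq_bigr => q _.
  by have [_ ->] := hq q; rewrite mulrDr.
rewrite mulr_natl mulr2n lerD2l.
(* For M - M^T this nonnegative trace is twice the difference of the two traces. *)
have := tr_psdM_ge0 (psd_congrT (M - M^T) Sgpsd) Sgpsd.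
rewrite [(M - M^T)^T]linearB /= trmxK !(mulmxBl, mulmxBr) !raddfB /=.
have -> : \tr (M^T *m Sg *m M *m Sg) = \tr (M *m Sg *m M^T *m Sg).
  by rewrite -mulmxA mxtrace_mulC mulmxA.
have -> : \tr (M^T *m Sg *m M^T *m Sg) = \tr (M *m Sg *m M *m Sg).
  by rewrite -mxtrace_tr !trmx_mul trmxK SgT mxtrace_mulC !mulmxA.
by lra.
Qed.

(** The fourth moment bound is available only for vectors supported on one subject. Being symmetric,
    B has the kernel of B B, so it kills the other subjects, and by symmetry its columns live on
    subject i. *)
Let block_col i (B : 'M[R]_N) k : B^T = B -> gblock g i (B *m B) = B *m B ->
  gproj g i *m col k B = col k B.
Proof.
move=> BT BB.
have BP : B *m (1%:M - gproj g i) = 0.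
  apply: mulmx_cV_eq0 => x; apply/eqP; rewrite -dot_eq0 -mulmxA; set y := _ *m x.
  rewrite dot_mulmxl BT mulmxA -BB /gblock /y -!mulmxA (mulmxA (gproj g i) (1%:M - _)).
  by rewrite mulmxBr mulmx1 gprojK subrr mul0mx !mulmx0 dot0r.
have {}BP : gproj g i *m B = B.
  move/eqP: BP; rewrite mulmxBr mulmx1 subr_eq0 => /eqP BP.
  by rewrite -[RHS]BT [in RHS]BP trmx_mul tr_gproj BT.
by rewrite !colE mulmxA BP.
Qed.

(** Through a square root of H the form is a sum of squares of linear forms in the noise of one
    subject. The mixed moments of these squares are bounded by K times the product of their
    variances. *)
Lemma Ex_psd_block_sq i (H : 'M[R]_N) : possemidefmx H -> gblock g i H = H ->
  intble (fun w => qform H (evec w) ^+ 2) /\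
  Ex (fun w => qform H (evec w) ^+ 2) <= K * \tr (H *m Sg) ^+ 2.
Proof.
move=> Hpsd HH; have [B [BT _] BB] := psd_sqrt Hpsd.
pose h k := col k B; pose p k := qform Sg (h k).
pose s k w := dot (h k) (evec w) ^+ 2.
have hP k : gproj g i *m h k = h k by apply: block_col => //; rewrite BB.
have p0 k : 0 <= p k by exact: psd_ge0.
have s0 k w : 0 <= s k w by exact: sqr_ge0.
have trE : \tr (H *m Sg) = \sum_k p k.
  by rewrite -BB -mulmxA mxtrace_mulC -[X in X *m _ *m _]BT trM_sum_qform.
have qE w : qform H (evec w) = \sum_k s k w.
  rewrite -BB qformE -mulmxA -[X in X *m _]BT -dot_mulmxl dotE; apply: eq_bigr => k _.
  rewrite /s expr2; have -> : (B *m evec w) k 0 = dot (h k) (evec w) => //.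
  by rewrite -[in LHS]BT mxE dotE; apply: eq_bigr => t _; rewrite !mxE.
have s2 k : intble (fun w => s k w ^+ 2) /\ Ex (fun w => s k w ^+ 2) <= K * p k ^+ 2.
  have -> : (fun w => s k w ^+ 2) = (fun w => dot (h k) (evec w) ^+ 4).
    by apply/funext => w; rewrite /s -exprM.
  exact: eps4 (hP k).
have ms k : measurable_fun setT (s k).
  by have [/intble_measurable] := Ex_linform_sq (h k).
have ss k l : intble (fun w => s k w * s l w) /\ Ex (fun w => s k w * s l w) <= K * (p k * p l).
  have [Ik Ek] := s2 k; have [Il El] := s2 l.
  have Ikl : intble (fun w => s k w * s l w).
    apply: intble_le (intbleD Ik Il) _; first exact: measurable_funM.
    move=> w; have h1 : 0 <= s k w * s l w by exact: mulr_ge0 (s0 k w) (s0 l w).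
    have h2 : 0 <= s k w ^+ 2 + s l w ^+ 2 by rewrite addr_ge0 ?sqr_ge0.
    rewrite (ger0_norm h1) (ger0_norm h2).
    by move: (sqr_ge0 (s k w - s l w)); rewrite sqrrB; lra.
  split=> //.
  (* A linear form of zero variance has zero coefficients, as Sg is positive definite; this allows
     dividing by p k and p l below. *)
  have zero m : p m = 0 -> forall w, s m w = 0.
    move=> pm w; have hm : h m = 0.
      apply/eqP; apply: contraT => hm0; case: Sgpd => _ /(_ _ hm0).
      by rewrite -/(p m) pm ltxx.
    by rewrite /s hm dot0l expr0n.
  have [pk|pk] := eqVneq (p k) 0.
    by under eq_fun do rewrite (zero k pk) mul0r; rewrite Ex_cst pk mul0r mulr0.
  have [pl|pl] := eqVneq (p l) 0.
    by under eq_fun do rewrite (zero l pl) mulr0; rewrite Ex_cst pl !mulr0.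
  have pk0 : 0 < p k by rewrite lt_def pk p0.
  have pl0 : 0 < p l by rewrite lt_def pl p0.
  have pp : 0 < 2 * (p k * p l) by rewrite !mulr_gt0.
  rewrite -(ler_pM2l pp) -ExZ //.
  apply: le_trans (_ : Ex (fun w => p l ^+ 2 * s k w ^+ 2 + p k ^+ 2 * s l w ^+ 2) <= _).
    apply: Ex_le; [exact: intbleZ | apply: intbleD; exact: intbleZ | move=> w].
    (* Weights p l and p k make both squares contribute K (p k)^2 (p l)^2, which replaces the
       Cauchy-Schwarz inequality for expectations. *)
    by have := sqr_ge0 (p l * s k w - p k * s l w); rewrite sqrrB !exprMn; lra.
  rewrite ExD ?ExZ //; try exact: intbleZ.
  have := ler_wpM2l (sqr_ge0 (p l)) Ek; have := ler_wpM2l (sqr_ge0 (p k)) El.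
  by lra.
have sqE : (fun w => qform H (evec w) ^+ 2) =
    (fun w => \sum_(q : 'I_N * 'I_N) s q.1 w * s q.2 w).
  apply/funext => w; rewrite qE expr2 mulr_suml.
  rewrite -(pair_bigA _ (fun k l => s k w * s l w)) /=.
  by apply: eq_bigr => k _; rewrite mulr_sumr.
rewrite sqE; split; first by apply: intble_sum => q; case: (ss q.1 q.2).
rewrite Ex_sum; last by move=> q; case: (ss q.1 q.2).
rewrite trE expr2 mulr_suml.
rewrite -[leRHS]/(K * _) mulr_sumr.
under [leRHS]eq_bigr => k _ do rewrite mulr_sumr mulr_sumr.
rewrite pair_bigA /=; apply: ler_sum => q _.
by case: (ss q.1 q.2).
Qed.

(** The centred form is a sum of independent centred terms, so the cross terms vanish. The blocks of
    M need not be symmetric, hence each variance is bounded through a dominating semi-definite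
    block. *)
Lemma Ex_diag_sq (M : 'M[R]_N) (H : 'I_n -> 'M[R]_N) :
  (forall i, possemidefmx (H i)) -> (forall i, gblock g i (H i) = H i) ->
  (forall i x, `|dot x (gblock g i M *m x)| <= qform (H i) x) ->
  intble (fun w => (dot (evec w) (gpart g M *m evec w) - \tr (M *m Sg)) ^+ 2) /\
  Ex (fun w => (dot (evec w) (gpart g M *m evec w) - \tr (M *m Sg)) ^+ 2)
    <= K * \sum_i \tr (H i *m Sg) ^+ 2.
Proof.
move=> Hpsd HH MH.
pose Z i w := dot (evec w) (gblock g i M *m evec w).
pose m i := \tr (gblock g i M *m Sg).
pose Y i w := Z i w - m i.
have mZ i : Fmeas F i (Z i).
  rewrite /Z; under eq_fun do rewrite dot_evec.
  apply: Fmeas_sum => p; rewrite gblockE; case: ifP => [/andP[/eqP p1 /eqP p2]|_].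
    apply: FmeasM; first exact: Fmeas_cst.
    by apply: FmeasM; [rewrite -p1 | rewrite -p2]; exact: eps_meas.
  by under eq_fun do rewrite mul0r; exact: Fmeas_cst.
have IZ i : intble (Z i) by exact: intble_qform.
have EZ i : Ex (Z i) = m i by exact: Ex_qform.
have mY i : Fmeas F i (Y i) by apply: FmeasD => //; exact: Fmeas_cst.
have IY i : intble (Y i) by apply: intbleD => //; exact: intble_cst.
have EY i : Ex (Y i) = 0.
  by rewrite /Y ExD //; [rewrite EZ Ex_cst subrr | exact: intble_cst].
have IZ2 i : intble (fun w => Z i w ^+ 2).
  have [IQ _] := Ex_psd_block_sq (Hpsd i) (HH i).
  apply: intble_le IQ _.
    by apply: measurable_funX; exact: intble_measurable.
  move=> w; rewrite !normrX ler_pXn2r ?nnegrE //.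
  by apply: le_trans (MH i _) _; exact: ler_norm.
have Y2E i : (fun w => Y i w * Y i w) = (fun w => Z i w ^+ 2 + ((- 2 * m i) * Z i w + m i ^+ 2)).
  by apply/funext => w; rewrite /Y; ring.
have IY2 i : intble (fun w => Y i w * Y i w).
  rewrite Y2E; apply: intbleD => //; apply: intbleD; [exact: intbleZ | exact: intble_cst].
have EY2 i : Ex (fun w => Y i w * Y i w) <= K * \tr (H i *m Sg) ^+ 2.
  rewrite Y2E ExD //; last by apply: intbleD; [exact: intbleZ | exact: intble_cst].
  rewrite ExD; [|exact: intbleZ|exact: intble_cst].
  rewrite ExZ // Ex_cst EZ; have [IQ EQ] := Ex_psd_block_sq (Hpsd i) (HH i).
  have : Ex (fun w => Z i w ^+ 2) <= Ex (fun w => qform (H i) (evec w) ^+ 2).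
    apply: Ex_le => // w; rewrite -[leLHS]ger0_norm ?sqr_ge0 // normrX.
    by rewrite ler_pXn2r ?nnegrE ?MH // psd_ge0.
  by move: (sqr_ge0 (m i)); lra.
have cross i j : i != j -> intble (fun w => Y i w * Y j w) /\ Ex (fun w => Y i w * Y j w) = 0.
  move=> ij; pose X k := if k == i then Y i else if k == j then Y j else fun=> 1.
  have XE : (fun w => Y i w * Y j w) = (fun w => \prod_k X k w).
    apply/funext => w; have ji : j != i by rewrite eq_sym.
    rewrite (bigD1 i) //= (bigD1 j) //= /X eqxx (negPf ji) eqxx big1 ?mulr1 // => k.
    by case/andP => /negPf -> /negPf ->.
  have IX k : intble (X k) by rewrite /X; do 2 case: ifP => // _; exact: intble_cst.
  have mX k : Fmeas F k (X k).
    rewrite /X; case: eqVneq => [->//|_]; case: eqVneq => [->//|_]; exact: Fmeas_cst.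
  have [I1 E1] := prod_indep Fm Findep IX mX; rewrite XE; split=> //.
  by rewrite E1 (bigD1 i) //= /X eqxx EY mul0r.
have sqE : (fun w => (dot (evec w) (gpart g M *m evec w) - \tr (M *m Sg)) ^+ 2) =
    (fun w => \sum_(q : 'I_n * 'I_n) Y q.1 w * Y q.2 w).
  apply/funext => w; rewrite (gpart_tr_mul M Sgd) -sum_gblock mulmx_suml dot_sumr.
  have -> : \tr ((\sum_i gblock g i M) *m Sg) = \sum_i m i.
    by rewrite mulmx_suml raddf_sum.
  rewrite -sumrB expr2 mulr_suml.
  rewrite -(pair_bigA _ (fun k l => Y k w * Y l w)) /=.
  by apply: eq_bigr => k _; rewrite mulr_sumr.
have II q : intble (fun w => Y q.1 w * Y q.2 w).
  by case: q => i j /=; have [->//|/cross[]] := eqVneq i j.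
rewrite sqE; split; first exact: intble_sum.
rewrite Ex_sum // -(pair_bigA _ (fun i j => Ex (fun w => Y i w * Y j w))) /= mulr_sumr.
apply: ler_sum => i _; rewrite (bigD1 i) //= big1 ?addr0 // => j ji.
by have [] := cross i j; rewrite 1?eq_sym.
Qed.

End noise_forms.

(** * Probability bounds for a fixed number of subjects *)

Section markov_inequality.
Context {d : measure_display} {T : measurableType d} {R : realType}.
Variable P : probability T R.

Lemma measurable_gt (h : T -> R) a : measurable_fun setT h ->
  measurable [set w | a < h w].
Proof.
move=> mh; have := mh measurableT _ (measurable_itv `]a, +oo[).
by rewrite setTI; congr measurable; apply/seteqP; split=> w /=; rewrite in_itv /= andbT.
Qed.

(** Stated relative to a level r that may be 0: then h has mean 0, vanishes almost everywhere, and
    the strict inequality has probability 0. *)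
Lemma markov_ge0 (h : T -> R) (c r delta : R) : intble P h -> (forall w, 0 <= h w) ->
  0 <= c -> 0 <= r -> 0 < delta -> Ex P h <= c * r ->
  (P [set w | (delta * r < h w)%R] <= (c / delta)%:E)%E.
Proof.
move=> Ih h0 c0 r0 d0 Eh; set A := [set _ | _].
have mh := intble_measurable Ih.
have mA : measurable A by exact: measurable_gt.
have [r_eq0|rn0] := eqVneq r 0.
  suff -> : P A = 0 by rewrite lee_fin divr_ge0 // ltW.
  have Eh0 : (\int[P]_(w in setT) `|(EFin \o h) w| = 0)%E.
    under eq_integral => w _ do rewrite /= ger0_norm //.
    by rewrite intbleE //; congr EFin; apply/eqP; rewrite eq_le Ex_ge0 // (le_trans Eh) // r_eq0 mulr0.
  have mh' : measurable_fun setT (EFin \o h) by exact/measurable_EFinP.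
  have := (ae_eq_integral_abs P measurableT mh').1 Eh0 => ae0.
  apply: measure_negligible => //; apply: negligibleS ae0 => w Aw /= /(_ I) [] hw.
  by move: Aw; rewrite /A /= hw r_eq0 mulr0 ltxx.
have r1 : 0 < r by rewrite lt_def rn0.
have dr : 0 < delta * r by rewrite mulr_gt0.
have IA := intble_indic P mA.
have -> : P A = (Ex P \1_A)%:E.
  by rewrite Ex_indic // fineK // fin_num_measure.
rewrite lee_fin; apply: le_trans (_ : Ex P (fun w => (delta * r)^-1 * h w) <= _).
  apply: Ex_le => //; first exact: intbleZ.
  move=> w; rewrite indicE; have [wA|wA] := boolP (w \in A); last first.
    by rewrite mulr_ge0 // invr_ge0 ltW.
  by rewrite mulrC ler_pdivlMr // mul1r ltW //; move: wA; rewrite inE.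
rewrite ExZ // ler_pdivrMl //; apply: le_trans Eh _.
by rewrite le_eqVlt; apply/orP; left; apply/eqP; field; rewrite gt_eqF.
Qed.

Lemma markov_sq (f : T -> R) (c r delta : R) : intble P (fun w => f w ^+ 2) ->
  0 <= c -> 0 <= r -> 0 < delta -> Ex P (fun w => f w ^+ 2) <= c * r ^+ 2 ->
  (P [set w | (delta * r < `|f w|)%R] <= (c / delta ^+ 2)%:E)%E.
Proof.
move=> If c0 r0 d0 Ef.
have := markov_ge0 If (fun w => sqr_ge0 _) c0 (sqr_ge0 r) (exprn_gt0 2 d0) Ef.
congr (P _ <= _)%E; apply/seteqP; split=> w /=.
  by rewrite -exprMn -[X in _ < X -> _]real_normK ?num_real // ltr_pXn2r // nnegrE mulr_ge0 // ltW.
by rewrite -exprMn -[X in _ -> _ < X]real_normK ?num_real // ltr_pXn2r // nnegrE mulr_ge0 // ltW.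
Qed.

Lemma measure_setU_le (A B : set T) (a b : R) : measurable A -> measurable B ->
  (P A <= a%:E)%E -> (P B <= b%:E)%E -> (P (A `|` B) <= (a + b)%:E)%E.
Proof.
move=> mA mB Aa Bb; apply: le_trans (measureU2 P mA mB) _.
by rewrite EFinD leeD.
Qed.

End markov_inequality.

(** * Error terms measured against the risk, for one n *)

Section core.
Context {d : measure_display} {T : measurableType d} {R : realType}.
Variable P : probability T R.
Variables (n N : nat) (F : 'I_n -> set (set T)) (g : 'I_N -> 'I_n).
Variables (eps : 'I_N -> T -> R) (S W A Sg : 'M[R]_N) (K s w v a c : R).
Hypothesis HN : grouped_noise P F g eps Sg K.
Hypothesis HS : smoother g S W A Sg s w v a c.
(** In the application b is the bias (1 - A) mu and r stacks the leave-subject-out residuals; k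
    below is 1/n and l is A Y - mu. *)
Variables (b : 'cV[R]_N) (r : T -> 'cV[R]_N).
Local Notation Ad := (gpart g A).
Local Notation xi0 := (s * w).
Local Notation theta := ((1 + w * v) * a ^+ 2).
Local Notation tau := (\tr (A^T *m A *m Sg)).
Local Notation ev := (evec eps).
Local Notation intble := (intble P).
Local Notation Ex := (Ex P).
Variables (k risk0 : R) (l : T -> 'cV[R]_N) (L CV U Noise : T -> R).
Hypothesis lE : forall o, l o = A *m ev o - b.
Hypothesis r_eq : forall o, (1%:M - Ad) *m r o = ev o - l o.
Hypothesis r_meas : measurable_fun setT (fun o => dot (r o) (r o)).

Hypothesis k_ge0 : 0 <= k.
Hypothesis risk0E : risk0 = k * dot b b + k * tau.
Hypothesis LE : forall o, L o = k * dot (l o) (l o).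
Hypothesis CVE : forall o, CV o = k * dot (r o) (r o).
Hypothesis UE : forall o,
  U o = k * dot (ev o - l o) (ev o - l o) + 2 * k * \tr (A *m Sg).
Hypothesis NoiseE : forall o, Noise o = k * dot (ev o) (ev o).

(** One parameter collects the rates that must tend to 0. *)
Variables (gam : R).
Hypothesis K_ge0 : 0 <= K.
Hypothesis a_half : a <= 2^-1.
Hypothesis gam_ge0 : 0 <= gam.
Hypothesis gam_le1 : gam <= 1.
Hypothesis c_le1 : c <= 1.
Hypothesis xi_small : k * xi0 <= gam * risk0.
Hypothesis xia_small : xi0 * a * (k * \tr A) <= gam * risk0.
Hypothesis theta_small : theta <= gam.

Let Q := A^T *m A.
(** The error terms: D1, D2, D3 separate the loss from the risk; D4, D5, D6 occur in U - L - Noise;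
    D6, D7, D8, D9 occur in CV - U. Only D9 is controlled by its mean, the others by their second
    moments. *)
Let D1 o := k * dot (ev o) ((Q - gpart g Q) *m ev o).
Let D2 o := k * (dot (ev o) (gpart g Q *m ev o) - \tr (Q *m Sg)).
Let D3 o := k * dot (A^T *m b) (ev o).
Let D4 o := k * dot b (ev o).
Let D5 o := k * dot (ev o) ((A - Ad) *m ev o).
Let D6 o := k * (dot (ev o) (Ad *m ev o) - \tr (A *m Sg)).
Let D7 o := k * dot (Ad *m b) (ev o).
Let D8 o := k * dot (ev o) ((Ad *m (A - Ad)) *m ev o).
Let D9 o := k * (a * qform (envelope W w (gpart g S)) (ev o)).

Let s_ge0 : 0 <= s. Proof. by case: HS. Qed.
Let w_gt0 : 0 < w. Proof. by case: HS. Qed.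
Let a_ge0 : 0 <= a. Proof. by case: HS. Qed.
Let v_ge0 : 0 <= v. Proof. by case: HS. Qed.
Let Sgpsd : possemidefmx Sg. Proof. by apply: pd_psd; case: HS. Qed.
Let Sgd : gdiag g Sg. Proof. by case: HS. Qed.
Let Spsd : possemidefmx S. Proof. by case: HS. Qed.
Let xi_ge0 : 0 <= xi0. Proof. by rewrite mulr_ge0 // ltW. Qed.
Let bb_ge0 : 0 <= k * dot b b. Proof. by rewrite mulr_ge0 // dot_ge0. Qed.
Let kt_ge0 : 0 <= k * tau. Proof. by rewrite mulr_ge0 // (tau_ge0 HS). Qed.
Let risk_ge0 : 0 <= risk0. Proof. by rewrite risk0E addr_ge0. Qed.
Let theta_ge0 : 0 <= theta.
Proof. by rewrite mulr_ge0 ?sqr_ge0 // addr_ge0 // mulr_ge0 // ltW. Qed.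

(** Common pattern of the variances: k^2 xi0 z = (k xi0)(k z), one factor being small against the
    risk and the other at most the risk. *)
Let kxi (z C : R) : 0 <= z -> k * z <= risk0 -> C <= xi0 * z ->
  k ^+ 2 * C <= gam * risk0 ^+ 2.
Proof.
move=> z0 zr Cz; apply: le_trans (ler_wpM2l (sqr_ge0 k) Cz) _.
have -> : k ^+ 2 * (xi0 * z) = (k * xi0) * (k * z) by ring.
rewrite [leRHS](_ : _ = (gam * risk0) * risk0); last by ring.
by apply: ler_pM => //; rewrite mulr_ge0.
Qed.

Let scaled (f : T -> R) C : intble (fun o => f o ^+ 2) /\ Ex (fun o => f o ^+ 2) <= C ->
  intble (fun o => (k * f o) ^+ 2) /\ Ex (fun o => (k * f o) ^+ 2) <= k ^+ 2 * C.
Proof.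
move=> [I1 E1]; have -> : (fun o => (k * f o) ^+ 2) = (fun o => k ^+ 2 * f o ^+ 2).
  by apply/funext => o; rewrite exprMn.
by split; [exact: intbleZ | rewrite ExZ // ler_wpM2l // sqr_ge0].
Qed.

(** Covers the constants 1 of linear forms, 2 of forms without diagonal blocks, and K of block
    diagonal forms. *)
Let m := 2 + K.
Let small f := intble (fun o => f o ^+ 2) /\ Ex (fun o => f o ^+ 2) <= (m * gam) * risk0 ^+ 2.

Let smallI f C (q : R) : 0 <= q -> q <= m -> intble (fun o => f o ^+ 2) ->
  Ex (fun o => f o ^+ 2) <= C -> C <= q * (gam * risk0 ^+ 2) -> small f.
Proof.
move=> q0 qm I1 E1 Cq; split=> //; apply: le_trans E1 _; apply: le_trans Cq _.
by rewrite -mulrA ler_wpM2r // mulr_ge0 // sqr_ge0.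
Qed.

Let m1 : 1 <= m. Proof. by rewrite /m; move: K_ge0; lra. Qed.
Let m2 : 2 <= m. Proof. by rewrite /m; move: K_ge0; lra. Qed.
Let mK : K <= m. Proof. by rewrite /m; lra. Qed.

Let off M C : gpart g M = 0 -> \tr (M *m Sg *m M^T *m Sg) <= C -> 
  forall z, 0 <= z -> k * z <= risk0 -> C <= xi0 * z ->
  small (fun o => k * dot (ev o) (M *m ev o)).
Proof.
move=> M0 MC z z0 zr Cz; have [I1 E1] := scaled (Ex_offdiag_sq HN M0).
apply: (@smallI _ _ 2 _ _ I1 E1) => //.
rewrite mulrCA ler_wpM2l // (kxi z0 zr) //; exact: le_trans MC Cz.
Qed.

Let kt_le : k * tau <= risk0. Proof. by rewrite risk0E lerDr. Qed.
Let kb_le : k * dot b b <= risk0. Proof. by rewrite risk0E lerDl. Qed.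

Let offpart0 (M : 'M[R]_N) : gpart g (M - gpart g M) = 0.
Proof. by apply/matrixP => i j; rewrite !mxE; case: (g i == g j); rewrite ?subrr. Qed.

Let D1s : small D1.
Proof.
apply: off (offpart0 Q) (tr_offpart_le Q Sgpsd Sgpsd Sgd Sgd) _ (tau_ge0 HS) kt_le _.
exact: tr_AtA_le HS.
Qed.

Let D5s : small D5.
Proof.
apply: off (offpart0 A) (tr_offpart_le A Sgpsd Sgpsd Sgd Sgd) _ (tau_ge0 HS) kt_le _.
exact: tr_A_le HS.
Qed.

Let D8s : small D8.
Proof.
apply: off (offpart_gpart_mul _ _) (lexx _) (theta * tau) _ _ _.
- by rewrite mulr_ge0 // (tau_ge0 HS).
- rewrite mulrCA; apply: le_trans kt_le; rewrite ler_piMl //.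
  exact: le_trans theta_small gam_le1.
- exact: gpart_A_off_le HS.
Qed.

Let lin c0 z : qform Sg c0 <= xi0 * z -> 0 <= z -> k * z <= risk0 ->
  small (fun o => k * dot c0 (ev o)).
Proof.
move=> qc z0 zr; have [I0 E0] := Ex_linform_sq HN c0.
rewrite -E0 in qc; have [I1 E1] := scaled (conj I0 qc).
by apply: (@smallI _ _ 1 _ _ I1 E1) => //; rewrite mul1r (kxi z0 zr).
Qed.

Let D3s : small D3.
Proof.
apply: lin (dot_ge0 b) kb_le; have := D_le_xi HS b.
by rewrite !qformE dot_mulmxl !mulmxA trmxK.
Qed.

Let D4s : small D4.
Proof. by apply: lin (dot_ge0 b) kb_le; exact: Sg_le_xi HS b. Qed.

Let D7s : small D7.
Proof.
apply: (@lin _ (theta * dot b b)).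
- apply: le_trans (Sg_le_xi HS _) _; rewrite ler_wpM2l //; exact: gpart_A_le HS _.
- by rewrite mulr_ge0 // dot_ge0.
- rewrite mulrCA; apply: le_trans kb_le; rewrite ler_piMl //.
  exact: le_trans theta_small gam_le1.
Qed.

Let D2s : small D2.
Proof.
have Qpsd i : possemidefmx (gblock g i Q) by exact: gblock_AtA_psd.
have QQ i : gblock g i (gblock g i Q) = gblock g i Q.
  by rewrite /gblock !mulmxA gprojK -!mulmxA gprojK.
(* The blocks of A^T A are semi-definite and dominate themselves. *)
have Qle i x : `|dot x (gblock g i Q *m x)| <= qform (gblock g i Q) x.
  by rewrite -qformE ger0_norm //; case: (Qpsd i).
have [I1 E1] := scaled (Ex_diag_sq HN Qpsd QQ Qle).
apply: (@smallI _ _ K _ _ I1 E1) => //.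
rewrite mulrCA ler_wpM2l // (kxi (tau_ge0 HS) kt_le) //.
rewrite -(sum_tr_gblock_AtA HS) mulr_sumr; apply: ler_sum => i _.
have t0 : 0 <= \tr (gblock g i Q *m Sg) by exact: tr_psdM_ge0.
rewrite expr2 ler_wpM2r //; apply: le_trans (tr_gblock_AtA_le HS i) _.
by rewrite ler_piMr.
Qed.

Let D6s : small D6.
Proof.
have Epsd i : possemidefmx (envelope W w (gblock g i S)).
  by apply: (envelope_psd HS); exact: psd_gblock.
have [I1 E1] := scaled (Ex_diag_sq HN Epsd (gblock_envelope HS) (gblock_A_le HS)).
apply: (@smallI _ _ K _ _ I1 E1) => //.
rewrite mulrCA ler_wpM2l //.
have h0 i : 0 <= \tr (envelope W w (gblock g i S) *m Sg) by exact: tr_psdM_ge0.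
have hle i := tr_envelope_le HS i.
have xiA : 0 <= xi0 * \tr A.
  rewrite -(sum_tr_gproj_A g A) mulr_sumr sumr_ge0 // => i _; exact: le_trans (hle i).
have sq_le : \sum_i \tr (envelope W w (gblock g i S) *m Sg) ^+ 2 <= xi0 * a * (xi0 * \tr A).
  rewrite -(sum_tr_gproj_A g A) !mulr_sumr; apply: ler_sum => i _; rewrite expr2.
  apply: ler_pM => //; apply: le_trans (hle i) _; rewrite ler_wpM2l //.
  by case: HS.
apply: le_trans (ler_wpM2l (sqr_ge0 k) sq_le) _.
(* Both factors are at most gam times the risk, by [xi_small] and [xia_small]; one gam is enough. *)
have -> : k ^+ 2 * (xi0 * a * (xi0 * \tr A)) = (k * xi0) * (xi0 * a * (k * \tr A)) by ring.
have gr : gam * risk0 <= risk0 by rewrite ler_piMl.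
have -> : gam * risk0 ^+ 2 = (gam * risk0) * risk0 by ring.
apply: ler_pM => //; first exact: mulr_ge0.
  have -> : xi0 * a * (k * \tr A) = a * k * (xi0 * \tr A) by ring.
  by rewrite mulr_ge0 // mulr_ge0.
exact: le_trans gr.
Qed.

Let H := envelope W w (gpart g S).

Let Hpsd : possemidefmx H.
Proof. by apply: (envelope_psd HS); exact: psd_gpart. Qed.

Let D9s : intble D9 /\ Ex D9 <= gam * risk0.
Proof.
have e : D9 = fun o => k * a * dot (ev o) (H *m ev o).
  by apply/funext => o; rewrite /D9 qformE mulrA.
rewrite e; have I1 := intble_qform HN H; split; first exact: intbleZ.
rewrite ExZ // (Ex_qform HN) /H -sum_envelope mulmx_suml raddf_sum /=.
apply: le_trans xia_small.
have -> : xi0 * a * (k * \tr A) = k * a * (xi0 * \tr A) by ring.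
rewrite ler_wpM2l ?mulr_ge0 // -(sum_tr_gproj_A g A) mulr_sumr.
by apply: ler_sum => i _; exact: tr_envelope_le HS i.
Qed.

Let D9_ge0 o : 0 <= D9 o.
Proof. by rewrite /D9 !mulr_ge0 //; case: Hpsd. Qed.

Let meas_qform M : measurable_fun setT (fun o => dot (ev o) (M *m ev o)).
Proof. exact: intble_measurable (intble_qform HN M). Qed.

Let meas_lin c0 : measurable_fun setT (fun o => dot c0 (ev o)).
Proof. by have [I1 _] := Ex_linform HN c0; exact: intble_measurable I1. Qed.

Let mD1 : measurable_fun setT D1. Proof. by apply: measurable_funM. Qed.
Let mD2 : measurable_fun setT D2.
Proof. by apply: measurable_funM => //; exact: measurable_funB. Qed.
Let mD3 : measurable_fun setT D3. Proof. by apply: measurable_funM. Qed.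
Let mD4 : measurable_fun setT D4. Proof. by apply: measurable_funM. Qed.
Let mD5 : measurable_fun setT D5. Proof. by apply: measurable_funM. Qed.
Let mD6 : measurable_fun setT D6.
Proof. by apply: measurable_funM => //; exact: measurable_funB. Qed.
Let mD7 : measurable_fun setT D7. Proof. by apply: measurable_funM. Qed.
Let mD8 : measurable_fun setT D8. Proof. by apply: measurable_funM. Qed.
Let mD9 : measurable_fun setT D9.
Proof. by case: D9s => I1 _; exact: intble_measurable I1. Qed.

Let L_eq o : L o = risk0 + D1 o + D2 o - 2 * D3 o.
Proof.
have h1 : dot (A *m ev o) (A *m ev o) = dot (ev o) (Q *m ev o).
  by rewrite dot_mulmxl mulmxA.
have h2 : dot (A *m ev o) b = dot (A^T *m b) (ev o) by rewrite dot_mulmxl dotC.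
rewrite LE lE !(dotBl, dotBr) (dotC b (A *m _)) h1 h2.
rewrite risk0E /D1 /D2 /D3 mulmxBl dotBr; ring.
Qed.

(** The trace term of U is exactly what centres the block diagonal form of A, leaving D6. *)
Let UL_eq o : U o - L o - Noise o = - 2 * (D5 o + D6 o - D4 o).
Proof.
rewrite UE LE NoiseE /D5 /D6 /D4 lE !(dotBl, dotBr) mulmxBl dotBr.
rewrite (dotC (A *m _) (ev o)) (dotC b (ev o)) ; ring.
Qed.

Let L_ge0 o : 0 <= L o. Proof. by rewrite LE mulr_ge0 // dot_ge0. Qed.

Let CVU_le eta o : 0 < eta ->
  `|CV o - U o| <= (34 + 2 / eta) * D9 o + (2 * eta + theta / eta + 32 * theta) * L o
     + 2 * `|D6 o| + 2 * `|D7 o| + 2 * `|D8 o|.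
Proof.
move=> eta0; have h1 := lso_residual_expansion HS a_half eta0 (r_eq o).
have h2 := gpart_A_sq_le HS (ev o).
have e : CV o - U o = k * (dot (r o) (r o) - dot (ev o - l o) (ev o - l o)
    - 2 * dot (ev o) (Ad *m ev o) + 2 * dot (ev o) (Ad *m l o))
  + 2 * D6 o - 2 * D8 o - 2 * (k * dot (ev o) (Ad *m (Ad *m ev o))) + 2 * D7 o.
  (* Since l = A eps - b and Ad A = Ad (A - Ad) + Ad Ad, the cross term splits into D8, a part
     dominated by the envelope, and D7. That part raises the coefficient 32 of the expansion to
     34. *)
  rewrite CVE UE /D6 /D7 /D8; have -> : dot (ev o) (Ad *m l o) =
      dot (ev o) (Ad *m (A - Ad) *m ev o) + dot (ev o) (Ad *m (Ad *m ev o))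
      - dot (Ad *m b) (ev o).
    rewrite lE mulmxBr dotBr -mulmxA mulmxBl mulmxBr dotBr (dotC (Ad *m b)); ring.
  by ring.
rewrite e; apply: le_trans (ler_normD _ _) _.
apply: le_trans (lerD (ler_normB _ _) (lexx _)) _.
apply: le_trans (lerD (lerD (ler_normB _ _) (lexx _)) (lexx _)) _.
apply: le_trans (lerD (lerD (lerD (ler_normD _ _) (lexx _)) (lexx _)) (lexx _)) _.
rewrite !normrM (ger0_norm k_ge0) (ger0_norm (_ : 0 <= 2 :> R)) //.
have := ler_wpM2l k_ge0 h1; have := ler_wpM2l k_ge0 h2; rewrite -/H => k2 k1.
have -> : (34 + 2 / eta) * D9 o + (2 * eta + theta / eta + 32 * theta) * L o =
  k * ((32 + 2 / eta) * (a * qform H (ev o)) + (2 * eta + theta / eta + 32 * theta) * dot (l o) (l o))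
  + 2 * (k * (a * qform H (ev o))).
  by rewrite /D9 LE -/H; ring.
by lra.
Qed.

Let mL : measurable_fun setT L.
Proof.
have -> : L = (fun o => risk0 + D1 o + D2 o - 2 * D3 o).
  by apply/funext => o; exact: L_eq.
apply: measurable_funB; last exact: measurable_funM.
by apply: measurable_funD => //; exact: measurable_funD.
Qed.

Let mNoise : measurable_fun setT Noise.
Proof.
have -> : Noise = (fun o => k * dot (ev o) (1%:M *m ev o)).
  by apply/funext => o; rewrite NoiseE mul1mx.
exact: measurable_funM.
Qed.

Let mU : measurable_fun setT U.
Proof.
have -> : U = (fun o => - 2 * (D5 o + D6 o - D4 o) + (L o + Noise o)).
  by apply/funext => o; rewrite -UL_eq; ring.
apply: measurable_funD; last exact: measurable_funD.
apply: measurable_funM => //; apply: measurable_funB => //; exact: measurable_funD.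
Qed.

Let mCV : measurable_fun setT CV.
Proof.
have -> : CV = (fun o => k * dot (r o) (r o)) by apply/funext.
exact: measurable_funM.
Qed.

Variables (e delta eta : R).
Hypothesis delta_gt0 : 0 < delta.
Hypothesis delta_le : delta <= 8^-1.
Hypothesis eta_gt0 : 0 < eta.
(** Off the bad event, D9 costs 34 + 2 / eta, the terms D6, D7, D8 of CV - U cost 6, and D4, D5, D6
    of U - L - Noise cost 6, all in units of delta times the risk. Replacing the risk by 2 L doubles
    46 + 2 / eta. *)
Hypothesis budget : (92 + 4 / eta) * delta + 2 * eta + gam / eta + 32 * gam <= e.

Let bad (f : T -> R) := [set o | delta * risk0 < `|f o|].
Let Bad := bad D1 `|` bad D2 `|` bad D3 `|` bad D4 `|` bad D5 `|` bad D6
  `|` bad D7 `|` bad D8 `|` bad D9.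

Let mbad f : measurable_fun setT f -> measurable (bad f).
Proof. by move=> mf; apply: measurable_gt; exact: measurableT_comp. Qed.

Let mBad : measurable Bad.
Proof. by do 8 (apply: measurableU; last exact: mbad); exact: mbad. Qed.

Let Pbad f : small f -> (P (bad f) <= (m * gam / delta ^+ 2)%:E)%E.
Proof.
move=> [I1 E1]; apply: markov_sq => //; rewrite mulr_ge0 //.
exact: le_trans m1.
Qed.

Let PBad : (P Bad <= (9 * (m * gam / delta ^+ 2))%:E)%E.
Proof.
have P9 : (P (bad D9) <= (m * gam / delta ^+ 2)%:E)%E.
  have [I1 E1] := D9s.
  have := markov_ge0 I1 D9_ge0 gam_ge0 risk_ge0 delta_gt0 E1.
  have -> : bad D9 = [set o | delta * risk0 < D9 o].
    by apply/seteqP; split=> o; rewrite /bad /= ger0_norm.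
  move=> h; apply: le_trans h _; rewrite lee_fin.
  have d1 : delta <= 1 by apply: le_trans delta_le _; rewrite invf_le1 ?ler1n.
  (* The first moment bound gam / delta is weakened to the bound shared by the other eight
     events. *)
  have -> : m * gam / delta ^+ 2 = (gam / delta) * (m / delta) by field; rewrite gt_eqF.
  rewrite ler_peMr ?divr_ge0 ?(ltW delta_gt0) // ler_pdivlMr // mul1r.
  exact: le_trans m1.
have -> : 9 * (m * gam / delta ^+ 2) = m * gam / delta ^+ 2 + m * gam / delta ^+ 2
  + m * gam / delta ^+ 2 + m * gam / delta ^+ 2 + m * gam / delta ^+ 2
  + m * gam / delta ^+ 2 + m * gam / delta ^+ 2 + m * gam / delta ^+ 2
  + m * gam / delta ^+ 2 by ring.
have mU2 := @measurableU _ T.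
do 8 (apply: measure_setU_le; [by repeat (apply: measurableU); exact: mbad | exact: mbad | | by [] || exact: Pbad]).
exact: Pbad.
Qed.

Let good o : ~ Bad o -> risk0 <= 2 * L o /\ `|CV o - U o| + 2 * `|D4 o| + 2 * `|D5 o| + 2 * `|D6 o| <= e * L o.
Proof.
move=> nB; have nb f : (bad f o -> Bad o) -> `|f o| <= delta * risk0.
  by move=> fB; rewrite leNgt; apply/negP => fo; exact/nB/fB.
have n1 : `|D1 o| <= delta * risk0 by apply: nb => h; rewrite /Bad; do 8 left.
have n2 : `|D2 o| <= delta * risk0 by apply: nb => h; rewrite /Bad; do 7 left; right.
have n3 : `|D3 o| <= delta * risk0 by apply: nb => h; rewrite /Bad; do 6 left; right.
have n4 : `|D4 o| <= delta * risk0 by apply: nb => h; rewrite /Bad; do 5 left; right.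
have n5 : `|D5 o| <= delta * risk0 by apply: nb => h; rewrite /Bad; do 4 left; right.
have n6 : `|D6 o| <= delta * risk0 by apply: nb => h; rewrite /Bad; do 3 left; right.
have n7 : `|D7 o| <= delta * risk0 by apply: nb => h; rewrite /Bad; do 2 left; right.
have n8 : `|D8 o| <= delta * risk0 by apply: nb => h; rewrite /Bad; left; right.
have n9 : D9 o <= delta * risk0.
  by apply: le_trans (ler_norm _) _; apply: nb => h; rewrite /Bad; right.
have dr : delta * risk0 <= 8^-1 * risk0 by rewrite ler_wpM2r.
(* D1, D2 and twice D3 take at most 4 delta <= 1/2 of the risk. *)
have rL : risk0 <= 2 * L o.
  move: n1 n2 n3; rewrite !ler_norml => /andP[a1 _] /andP[a2 _] /andP[_ a3].
  by rewrite L_eq; lra.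
split=> //; apply: le_trans (_ : ((92 + 4 / eta) * delta + 2 * eta + gam / eta + 32 * gam) * L o <= _);
  last by rewrite ler_wpM2r.
have h := CVU_le o eta_gt0.
have ei : 0 <= eta^-1 by rewrite invr_ge0 ltW.
have h9 : (34 + 2 / eta) * D9 o <= (34 + 2 / eta) * (delta * risk0).
  by rewrite ler_wpM2l // addr_ge0 // mulr_ge0.
have hr : (46 + 2 / eta) * delta * risk0 <= (46 + 2 / eta) * delta * (2 * L o).
  by rewrite ler_wpM2l // mulr_ge0 // ?(ltW delta_gt0) // addr_ge0 // mulr_ge0.
have ht : (theta / eta + 32 * theta) * L o <= (gam / eta + 32 * gam) * L o.
  by rewrite ler_wpM2r // lerD // ?ler_wpM2r // ler_wpM2l.
have -> : ((92 + 4 / eta) * delta + 2 * eta + gam / eta + 32 * gam) * L o =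
  (46 + 2 / eta) * delta * (2 * L o) + 2 * eta * L o + (gam / eta + 32 * gam) * L o by ring.
have e2 : (46 + 2 / eta) * delta * risk0 = (34 + 2 / eta) * (delta * risk0) + 12 * (delta * risk0) by ring.
by lra.
Qed.

Lemma core_bound :
  (P [set o | (e * `|L o| < `|CV o - U o|)%R] <= (9 * ((2 + K) * gam / delta ^+ 2))%:E)%E /\
  (P [set o | (e * `|L o| < `|CV o - L o - Noise o|)%R]
     <= (9 * ((2 + K) * gam / delta ^+ 2))%:E)%E.
Proof.
have gtB (f : T -> R) : measurable_fun setT f -> (forall o, ~ Bad o -> `|f o| <= e * `|L o|) ->
    (P [set o | (e * `|L o| < `|f o|)%R] <= (9 * ((2 + K) * gam / delta ^+ 2))%:E)%E.
  move=> mf fL; apply: le_trans PBad; apply: le_measure; rewrite ?inE //.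
    have -> : [set o | e * `|L o| < `|f o|] = [set o | 0 < `|f o| - e * `|L o|].
      by apply/seteqP; split=> o /=; rewrite subr_gt0.
    apply: measurable_gt; apply: measurable_funB; first exact: measurableT_comp.
    by apply: measurable_funM => //; exact: measurableT_comp.
  move=> o /= fo; apply: contrapT => /fL; by rewrite leNgt fo.
split; apply: gtB.
- exact: measurable_funB.
- move=> o /good[_]; rewrite (ger0_norm (L_ge0 o)); apply: le_trans.
  by rewrite -!addrA lerDl !addr_ge0 // mulr_ge0.
- by apply: measurable_funB => //; exact: measurable_funB.
- move=> o /good[_]; rewrite (ger0_norm (L_ge0 o)); apply: le_trans.
  have -> : CV o - L o - Noise o = (CV o - U o) + (U o - L o - Noise o) by ring.
  rewrite UL_eq; apply: le_trans (ler_normD _ _) _; rewrite -!addrA lerD2l normrM.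
  rewrite normrN (ger0_norm (_ : 0 <= 2 :> R)) // -!mulrDr ler_wpM2l //.
  apply: le_trans (ler_normD _ _) _; rewrite addrCA lerD2l [leRHS]addrC; exact: ler_normB.
Qed.

End core.

(** * The matrices of the model *)

Section blocks.
Context {R : realType} {n : nat} {p : 'I_n -> nat}.
Local Notation g := (@tagnat.sig1 n p).

Lemma dot_mxcol (u v : forall i, 'cV[R]_(p i)) :
  dot (\mxcol_i u i) (\mxcol_i v i) = \sum_i dot (u i) (v i).
Proof. by rewrite /dot tr_mxcol mul_mxrow_mxcol summxE. Qed.

Lemma qform_mxdiag (B : forall i, 'M[R]_(p i)) (u : forall i, 'cV[R]_(p i)) :
  qform (\mxdiag_i B i) (\mxcol_i u i) = \sum_i qform (B i) (u i).
Proof.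
rewrite qformE mul_mxdiag_mxcol dot_mxcol.
by apply: eq_bigr => i _; rewrite qformE.
Qed.

Lemma posdef_mxdiag (B : forall i, 'M[R]_(p i)) :
  (forall i, posdefmx (B i)) -> posdefmx (\mxdiag_i B i).
Proof.
move=> Bpd; split=> [|x x0].
  by rewrite tr_mxdiag; apply: eq_mxdiag => i; case: (Bpd i).
have [i xi] : exists i, submxcol x i != 0.
  apply/not_existsP => h; move: x0; rewrite -(submxcolK x) => /eqP; apply.
  rewrite -(mxcol0 (p_ := p)); apply: eq_mxcol => i.
  by have /negP/negPn/eqP := h i.
rewrite -(submxcolK x) qform_mxdiag (bigD1 i) //= ltr_wpDr //.
  by apply: sumr_ge0 => j _; exact: psd_ge0 (pd_psd (Bpd j)).
by case: (Bpd i) => _; apply.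
Qed.

Lemma mul_mxdiag (B C : forall i, 'M[R]_(p i)) :
  \mxdiag_i B i *m \mxdiag_i C i = \mxdiag_i (B i *m C i).
Proof.
rewrite {2}/mxdiag mul_mxdiag_mxblock; apply: eq_mxblock => i j.
by case: eqVneq => [->|_]; rewrite ?mulmx0 // !conform_mx_id.
Qed.

Lemma invmx_mxdiag (B : forall i, 'M[R]_(p i)) : (forall i, B i \in unitmx) ->
  invmx (\mxdiag_i B i) = \mxdiag_i invmx (B i).
Proof.
move=> uB; have e : \mxdiag_i invmx (B i) *m \mxdiag_i B i = 1%:M.
  by rewrite mul_mxdiag -mxdiagZ; apply: eq_mxdiag => i; rewrite mulVmx.
have [_ uD] := mulmx1_unit e.
by rewrite -[RHS]mulmx1 -(mulmxV uD) mulmxA e mul1mx.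
Qed.

Lemma gdiag_mxdiag (B : forall i, 'M[R]_(p i)) : gdiag g (\mxdiag_i B i).
Proof. by move=> s t st; rewrite !mxE (negPf st) mxE. Qed.

Lemma gproj_mxcol i (u : forall j, 'cV[R]_(p j)) :
  gproj g i *m \mxcol_j u j = \mxcol_j (if j == i then u j else 0).
Proof.
apply/matrixP => s t; rewrite mul_gprojE !mxE.
by case: (g s == i); rewrite ?mxE.
Qed.

Lemma mxtrace_submxblock (M : 'M[R]_(\sum_i p i)) i :
  \tr (submxblock M i i) = \tr (gproj g i *m M).
Proof.
have -> (C : 'M[R]_(\sum_i p i)) : \tr C = \sum_j \tr (submxblock C j j).
  by rewrite -[in LHS](submxblockK C) mxtrace_mxblock.
rewrite (bigD1 i) //= [X in _ = _ + X]big1 ?addr0.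
  by apply: eq_bigr => s _; rewrite [RHS]mxE mul_gprojE tagnat.Rank1K eqxx mxE.
move=> j ji; apply: big1 => s _.
by rewrite mxE mul_gprojE tagnat.Rank1K (negPf ji).
Qed.

Lemma mxdiag_Rank (B : forall i, 'M[R]_(p i)) i (s t : 'I_(p i)) :
  (\mxdiag_i B i) (tagnat.Rank i s) (tagnat.Rank i t) = B i s t.
Proof. by have /matrixP/(_ s t) := submxblock_diag B i; rewrite mxE => <-. Qed.

Lemma mxcol_Rank (u : forall i, 'cV[R]_(p i)) i (s : 'I_(p i)) :
  (\mxcol_i u i) (tagnat.Rank i s) 0 = u i s 0.
Proof. by have /matrixP/(_ s 0) := mxcolK u i; rewrite mxE. Qed.

Lemma Rank_ind (Q : 'I_(\sum_i p i) -> Prop) :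
  (forall i (s : 'I_(p i)), Q (tagnat.Rank i s)) -> forall s, Q s.
Proof. by move=> QR s; rewrite -(tagnat.sig2K s). Qed.

End blocks.

(** Existence of a root makes [xget] return a genuine one instead of its default. *)
Lemma sqrtmxP (R : realType) (k : nat) (M : 'M[R]_k) : posdefmx M ->
  [/\ posdefmx (sqrtmx M), sqrtmx M *m sqrtmx M = M & sqrtmx M \in unitmx].
Proof.
move=> Mpd; have [B Bpsd BB] := psd_sqrt (pd_psd Mpd).
have [Vpsd VV] := @xgetPex _ 0 [set B : 'M[R]_k | possemidefmx B /\ B *m B = M]
  (ex_intro _ B (conj Bpsd BB)).
have uV : sqrtmx M \in unitmx.
  by have := pd_unit Mpd; rewrite -{1}VV !unitmxE det_mulmx unitrM => /andP[].
by split=> //; exact: psd_unit_pd.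
Qed.

(* With P the projector on a group and Q = 1 - P, the block D = P V Q of V satisfies
   P V D + D V Q = P W Q = 0; multiplying by D^T, two nonnegative traces add up to 0. *)
Lemma psd_sqrt_gdiag (R : realType) (n N : nat) (g : 'I_N -> 'I_n) (V W : 'M[R]_N) :
  possemidefmx V -> V *m V = W -> posdefmx W -> gdiag g W -> gdiag g V.
Proof.
move=> Vpsd VV Wpd /gdiagP Wd; have [VT V0] := Vpsd.
have uV : V \in unitmx.
  have := pd_unit Wpd; rewrite -VV !unitmxE det_mulmx unitrM.
  by case/andP.
have Vpd := psd_unit_pd Vpsd uV.
have off i : gproj g i *m V *m (1%:M - gproj g i) = 0.
  set Pi := gproj g i; set Qi := 1%:M - Pi.
  have PT : Pi^T = Pi by exact: tr_gproj.
  have QT : Qi^T = Qi by rewrite linearB /= trmx1 PT.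
  have PP : Pi *m Pi = Pi by exact: gprojK.
  have PQ : Pi *m Qi = 0 by rewrite mulmxBr mulmx1 PP subrr.
  have QQ : Qi *m Qi = Qi by rewrite {1}/Qi mulmxBl mul1mx PQ subr0.
  have PQ1 : Pi + Qi = 1%:M by rewrite addrC subrK.
  set D := Pi *m V *m Qi.
  have DT : D^T = Qi *m V *m Pi by rewrite !trmx_mul VT PT QT mulmxA.
  have e : Pi *m V *m D + D *m V *m Qi = 0.
    have <- : Pi *m W *m Qi = 0 by rewrite Wd -mulmxA PQ mulmx0.
    have -> : W = V *m (Pi + Qi) *m V by rewrite PQ1 mulmx1.
    rewrite /D addrC; clearbody Qi.
    by rewrite (mulmxDr V) !mulmxA mulmxDr !mulmxDl !mulmxA addrC.
  have h1 : 0 <= \tr (D^T *m V *m D).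
    by apply: tr_psd_ge0; exact: psd_congr.
  have h2 : 0 <= \tr (D *m V *m D^T).
    by apply: tr_psd_ge0; exact: psd_congrT.
  have PD : Pi *m D = D by rewrite /D !mulmxA PP.
  have DQ : D *m Qi = D by rewrite /D -mulmxA QQ.
  have e2 : \tr (D^T *m V *m D) + \tr (D *m V *m D^T) = 0.
    have -> : \tr (D *m V *m D^T) = \tr (D^T *m (D *m V *m Qi)).
      have QD : Qi *m D^T = D^T by rewrite -{1}QT -trmx_mul DQ.
      by rewrite -[in LHS]QD mulmxA [LHS]mxtrace_mulC.
    have -> : \tr (D^T *m V *m D) = \tr (D^T *m (Pi *m V *m D)).
      have DP : D^T *m Pi = D^T by rewrite -{1}PT -trmx_mul PD.
      by rewrite !mulmxA DP.
    by rewrite -mxtraceD -mulmxDr e mulmx0 mxtrace0.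
  have h0 : \tr (D^T *m V *m D) = 0 by lra.
  apply: mulmx_cV_eq0 => x; apply/eqP; apply: contraT => Dx0.
  have q0 : 0 < qform (D^T *m V *m D) x.
    by have := Vpd.2 _ Dx0; rewrite !qformE dot_mulmxl !mulmxA.
  have := psd_le_tr x (psd_congr D Vpsd) (pd1 N).
  by rewrite invmx1 mulmx1 h0 mul0r leNgt q0.
apply/gdiagP => i.
have /eqP := off i; rewrite mulmxBr mulmx1 subr_eq0 => /eqP h.
have hT : V *m gproj g i = gproj g i *m V *m gproj g i.
  by have := congr1 trmx h; rewrite !trmx_mul tr_gproj VT mulmxA.
by rewrite hT.
Qed.

Section model_matrices.
Context {R : realType} {n : nat} (M : model R n).
Hypothesis ycov_pd : forall i, posdefmx (ycov M i).
Hypothesis wcorr_pd : forall i, posdefmx (wcorr M i).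
Hypothesis penalty_psd : forall k, possemidefmx (penalty M k).
Hypothesis lam_ge0 : forall k, 0 <= lam M k.
Hypothesis gram_unit : penalized_gram M \in unitmx.

Local Notation N := (ntot M).
Local Notation W := (Wmx M).
Local Notation J := (invmx (Wmx M)).
Local Notation Sg := (Sigmamx M).
Local Notation X := (Xmx M).
Local Notation A := (Amx M).
Local Notation G := (penalized_gram M).

Definition subject : 'I_(ntot M) -> 'I_n := @tagnat.sig1 n (nobs M).

Definition Smx : 'M[R]_(ntot M) := X *m invmx G *m X^T.

Let pen := \sum_(k < ncomp M) lam M k *: penalty M k.

Lemma Wmx_pd : posdefmx W. Proof. exact: posdef_mxdiag. Qed.
Lemma Sigmamx_pd : posdefmx Sg. Proof. exact: posdef_mxdiag. Qed.
Lemma Wmx_gdiag : gdiag subject W. Proof. exact: gdiag_mxdiag. Qed.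
Lemma Sigmamx_gdiag : gdiag subject Sg. Proof. exact: gdiag_mxdiag. Qed.

Lemma AmxE : A = Smx *m J. Proof. by []. Qed.

Let pen_psd : possemidefmx pen.
Proof. by apply: psd_sum => k; exact: psdZ. Qed.

Let GE : G = X^T *m J *m X + pen. Proof. by []. Qed.

Lemma gram_pd : posdefmx G.
Proof.
apply: psd_unit_pd => //; rewrite GE; apply: psdD => //.
exact: psd_congr (pd_psd (pd_inv Wmx_pd)).
Qed.

Lemma Smx_psd : possemidefmx Smx.
Proof. exact: psd_congrT (pd_psd (pd_inv gram_pd)). Qed.

(** Both sides are forms at z = G^-1 X^T x, of X^T W^-1 X and of G, and G exceeds the former by the
    semi-definite penalty. *)
Lemma Smx_smoother x : qform (Smx *m J *m Smx) x <= qform Smx x.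
Proof.
have GT : (invmx G)^T = invmx G by apply: sym_inv; case: gram_pd.
pose z := invmx G *m (X^T *m x).
have -> : qform Smx x = qform G z.
  by rewrite -(qform_inv z gram_pd) mulKVmx // [RHS]qformE dot_mulmxl trmxK qformE /Smx !mulmxA.
have -> : qform (Smx *m J *m Smx) x = qform (X^T *m J *m X) z.
  rewrite !qformE /z [RHS]dot_mulmxl GT dot_mulmxl trmxK /Smx !mulmxA.
  by [].
by rewrite GE qformD lerDl psd_ge0.
Qed.

Lemma mxtrace_Ablock i : \tr (Ablock M i) = \tr (gproj subject i *m A).
Proof. exact: mxtrace_submxblock. Qed.

(** The square root of W inherits its block structure, so conjugation by it commutes with the
    projectors and preserves the trace over each subject. *)
Lemma mxtrace_Cblock i : \tr (Cblock M i) = \tr (gproj subject i *m (A *m A)).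
Proof.
rewrite /Cblock mxtrace_submxblock -/subject /Atilde.
have [/pd_psd Vpsd VV uV] := sqrtmxP Wmx_pd; set V := sqrtmx W in Vpsd VV uV *.
have /gdiagP Vd := psd_sqrt_gdiag Vpsd VV Wmx_pd Wmx_gdiag.
have -> : invmx V *m A *m V *m (invmx V *m A *m V) = invmx V *m (A *m A *m V).
  by rewrite !mulmxA mulmxK.
have /gdiagP Vid := gdiag_inv uV ((gdiagP _ _).2 Vd).
have -> : gproj subject i *m (invmx V *m (A *m A *m V)) =
    invmx V *m (gproj subject i *m (A *m A) *m V) by rewrite !mulmxA Vid.
by rewrite mxtrace_mulC mulmxK.
Qed.

Lemma lso_objectiveE (y : responses M) i b :
  lso_objective y i b = qform J ((1%:M - gproj subject i) *m (\mxcol_j y j - X *m b))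
    + qform pen b.
Proof.
rewrite /lso_objective; congr (_ + _); last first.
  by rewrite qform_sum; apply: eq_bigr => k _; rewrite qformZ.
have -> : (1%:M - gproj subject i) *m (\mxcol_j y j - X *m b) =
    \mxcol_j (if j == i then 0 else y j - design M j *m b).
  rewrite mulmxBl mul1mx /Xmx mxcol_mul -mxcolB gproj_mxcol -mxcolB.
  by apply: eq_mxcol => j; case: eqP; rewrite ?subrr ?subr0.
rewrite /Wmx invmx_mxdiag; last by move=> j; exact: pd_unit.
rewrite qform_mxdiag big_mkcond /=; apply: eq_bigr => j _.
by case: eqP => //= _; rewrite qformE mulmx0 dot0r.
Qed.

(** First-order condition obtained without derivatives: along a direction h the objective changes by
    2 t c + t^2 q, which is nonnegative for all t only if c = 0. *)
Lemma lso_normal_equation (y : responses M) i b : lso_minimizer y i b ->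
  pen *m b = X^T *m J *m ((1%:M - gproj subject i) *m (\mxcol_j y j - X *m b)).
Proof.
move=> bmin; set P := gproj subject i; set Y := \mxcol_j y j.
set u := _ *m (Y - X *m b); set Z := (1%:M - P) *m X.
have JT : J^T = J by apply: sym_inv; case: Wmx_pd.
have [penT pen0] := pen_psd.
have PJ : P *m J = J *m P.
  by have /gdiagP -> := gdiag_inv (pd_unit Wmx_pd) Wmx_gdiag.
have QT : (1%:M - P)^T = 1%:M - P by rewrite linearB /= trmx1 tr_gproj.
have ZJu : Z^T *m (J *m u) = X^T *m J *m u.
  have -> : X^T *m J *m u = X^T *m J *m ((1%:M - P) *m u).
    congr (_ *m _); rewrite {2}/u mulmxA.
    by rewrite (mulmxBr (1%:M - P)) mulmx1 (mulmxBl _ _ P) mul1mx gprojK subrr subr0.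
  rewrite /Z trmx_mul QT !mulmxA; congr (_ *m _).
  have QJ : (1%:M - P) *m J = J *m (1%:M - P).
    by rewrite mulmxBl mulmxBr mul1mx mulmx1 PJ.
  by rewrite -(mulmxA X^T (1%:M - P)) QJ !mulmxA.
pose c h := dot h (pen *m b - Z^T *m (J *m u)).
suff c0 h : c h = 0.
  have := c0 (pen *m b - Z^T *m (J *m u)).
  by move/eqP; rewrite dot_eq0 subr_eq0 ZJu => /eqP.
pose q := qform J (Z *m h) + qform pen h.
have q_ge0 : 0 <= q by rewrite addr_ge0 // psd_ge0 //; exact: pd_psd (pd_inv Wmx_pd).
have step t : 0 <= 2 * t * c h + t ^+ 2 * q.
  have := bmin (b + t *: h); rewrite !lso_objectiveE -/P -/Y -/u.
  have -> : (1%:M - P) *m (Y - X *m (b + t *: h)) = u + (- t) *: (Z *m h).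
    rewrite /u /Z -(mulmxA (1%:M - P) X h) scalemxAr -mulmxDr; congr (_ *m _).
    by rewrite mulmxDr opprD addrA scaleNr -scalemxAr.
  rewrite (qform_add_sym _ _ JT) (qform_add_sym _ _ penT) !qformZv sqrrN.
  rewrite -!scalemxAr !dotZr (sym_dotC _ _ JT) dot_mulmxl (sym_dotC b _ penT) /c dotBr /q.
  by move=> h1; lra.
have q1 : 0 < q + 1 by rewrite ltr_wpDl.
(* The denominator q + 1 avoids the case q = 0; the value is then a negative multiple of c^2. *)
have := step (- c h / (q + 1)).
have -> : 2 * (- c h / (q + 1)) * c h + (- c h / (q + 1)) ^+ 2 * q =
    - (c h ^+ 2 * ((q + 2) / (q + 1) ^+ 2)) by field; rewrite gt_eqF.
rewrite oppr_ge0 pmulr_lle0; last by rewrite divr_gt0 ?exprn_gt0 //; lra.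
by move=> h1; apply/eqP; rewrite -sqrf_eq0 eq_le h1 sqr_ge0.
Qed.

(** The fit without subject i is also the full fit to data in which y_i is replaced by its own
    prediction. Hence only the full Gram matrix is inverted, and the leave-out one may be
    singular. *)
Lemma lso_residual_eq (y : responses M) (b : 'I_n -> 'cV[R]_(pdim M)) :
  (forall i, lso_minimizer y i (b i)) ->
  (1%:M - gpart subject A) *m \mxcol_i (y i - design M i *m b i) =
  \mxcol_i y i - A *m \mxcol_i y i.
Proof.
move=> bmin; set Y := \mxcol_i y i; set r := \mxcol_i (_ - _).
have rho i : gproj subject i *m r = gproj subject i *m (Y - X *m b i).
  rewrite /Xmx mxcol_mul -mxcolB !gproj_mxcol; apply: eq_mxcol => j.
  by case: eqP => [->|].
have key i : gproj subject i *m r =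
    gproj subject i *m (Y - A *m Y) + gproj subject i *m (A *m (gproj subject i *m r)).
  rewrite rho; set P := gproj subject i.
  (* Adding X^T W^-1 X b to the normal equation restores the full Gram matrix, with the response of
     subject i replaced by its prediction. *)
  have Gb : G *m b i = X^T *m J *m (Y - P *m (Y - X *m b i)).
    rewrite GE mulmxDl (lso_normal_equation (bmin i)) -/P -/Y.
    rewrite -(mulmxA _ X) -mulmxDr; congr (_ *m _).
    by rewrite mulmxBl mul1mx addrA (addrC (X *m b i)) subrK.
  have Xb : X *m b i = A *m (Y - P *m (Y - X *m b i)).
    by rewrite -{1}(mulKmx gram_unit (b i)) Gb /Amx !mulmxA.
  rewrite -mulmxDr; congr (_ *m _).
  by rewrite {1}Xb (mulmxBr A) opprB addrA addrAC.
rewrite mulmxBl mul1mx; apply/eqP; rewrite subr_eq addrC; apply/eqP.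
rewrite -{1}(mul1mx r) -[X in _ = _ + X]mul1mx -(sum_gproj subject) -sum_gblock.
rewrite !mulmx_suml -big_split /=; apply: eq_bigr => i _.
by rewrite {1}key addrC /gblock !mulmxA.
Qed.

End model_matrices.

Arguments subject {R n} M _.

(** A kernel vector of 1 - Ad is a residual for eps = l = 0, and the expansion then bounds its
    squared norm by 0. *)
Lemma unit_1_gpart (R : realType) (n N : nat) (g : 'I_N -> 'I_n)
    (S W A Sg : 'M[R]_N) (s w v a c : R) :
  smoother g S W A Sg s w v a c -> a <= 2^-1 -> 1%:M - gpart g A \in unitmx.
Proof.
move=> HS a2; rewrite unitmxE unitfE -det_tr; apply/negP => /det0P[u u0 uM].
have xM : (1%:M - gpart g A) *m u^T = 0.
  by apply: trmx_inj; rewrite trmx_mul trmxK uM trmx0.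
have := lso_residual_expansion (eta := 1) (eps := 0) (l := 0) HS a2 ltr01.
rewrite subr0 => /(_ _ xM); rewrite qformE !mulmx0 !dot0r !mulr0 !subr0 !addr0.
by rewrite normr_le0 dot_eq0 trmx_eq0 (negPf u0).
Qed.


(** * The noise of the model *)

Section random_vectors.
Context {d : measure_display} {T : measurableType d} {R : realType}.

Definition measurable_vec (N : nat) (X : T -> 'cV[R]_N) :=
  forall s, measurable_fun setT (fun w => X w s 0).

Lemma measurable_mulmx (N p : nat) (B : 'M[R]_(p, N)) (X : T -> 'cV[R]_N) :
  measurable_vec X -> measurable_vec (fun w => B *m X w).
Proof.
move=> mX s; under eq_fun do rewrite mxE.
by apply: measurable_sum => t; apply: measurable_funM.
Qed.

Lemma measurable_vecB (N : nat) (X Y : T -> 'cV[R]_N) :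
  measurable_vec X -> measurable_vec Y -> measurable_vec (fun w => X w - Y w).
Proof.
move=> mX mY s; under eq_fun do rewrite !mxE.
exact: measurable_funB.
Qed.

Lemma measurable_dot (N : nat) (X Y : T -> 'cV[R]_N) :
  measurable_vec X -> measurable_vec Y -> measurable_fun setT (fun w => dot (X w) (Y w)).
Proof.
move=> mX mY; under eq_fun do rewrite dotE.
by apply: measurable_sum => s; apply: measurable_funM.
Qed.

End random_vectors.

Section model_noise.
Context {d : measure_display} {T : measurableType d} {R : realType}.
Variables (P : probability T R) (n : nat) (M : model R n).
Variable y : forall i : 'I_n, 'I_(nobs M i) -> {RV P >-> R}.
Arguments y : clear implicits.
Hypothesis ycov_pd : forall i, posdefmx (ycov M i).
Hypothesis y_L2 : forall i j, (y i j : T -> R) \in Lfun P 2%:E.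
Hypothesis y_mean : forall i j, ('E_P[y i j] = (mean M i j 0)%:E)%E.
Hypothesis y_cov : forall i j k, covariance P (y i j) (y i k) = (ycov M i j k)%:E.
Arguments y_L2 : clear implicits.
Arguments y_mean : clear implicits.
Arguments y_cov : clear implicits.
Hypothesis y_indep : independent_vectors y.

Definition model_eps (s : 'I_(ntot M)) (w : T) : R :=
  (\mxcol_i residual (observed y w) i) s 0.

(** Written with the generators of [g_sigma_preimage], so that [independent_vectors] applies by
    conversion. *)
Definition response_events (i : 'I_n) : set (set T) :=
  \big[setU/set0]_(j < nobs M i) preimage_set_system setT (y i j : T -> R) measurable.

Lemma evec_model_eps w : evec model_eps w = \mxcol_i residual (observed y w) i.
Proof. by apply/matrixP => s t; rewrite mxE /model_eps (ord1 t). Qed.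

Lemma model_eps_Rank i j :
  model_eps (tagnat.Rank i j) = fun w => y i j w - mean M i j 0.
Proof.
by apply/funext => w; rewrite /model_eps mxcol_Rank /residual !mxE.
Qed.

Lemma subject_Rank i (j : 'I_(nobs M i)) : subject M (tagnat.Rank i j) = i.
Proof. exact: tagnat.Rank1K. Qed.

Lemma y_intble i j : intble P (y i j).
Proof. by apply/Lfun1_integrable; apply: Lfun_subset12 => //; exact: fin_num_measure. Qed.

Lemma y_intble2 i j i' j' : intble P (fun w => y i j w * y i' j' w).
Proof. by apply/Lfun1_integrable; exact: (Lfun2_mul_Lfun1 (y_L2 i j) (y_L2 i' j')). Qed.

Lemma model_eps_intble s : intble P (model_eps s).
Proof.
elim/(@Rank_ind n (nobs M)): s => i j; rewrite model_eps_Rank.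
by apply: intbleD; [exact: y_intble | exact: intble_cst].
Qed.

Lemma Ex_y i j : Ex P (y i j) = mean M i j 0.
Proof. by have := y_mean i j; rewrite unlock /Ex /Rintegral => ->. Qed.

Lemma model_eps_intble2 s t : intble P (fun w => model_eps s w * model_eps t w).
Proof.
elim/(@Rank_ind n (nobs M)): s => i j; elim/(@Rank_ind n (nobs M)): t => i' j'; rewrite !model_eps_Rank.
have -> : (fun w => (y i j w - mean M i j 0) * (y i' j' w - mean M i' j' 0)) =
    (fun w => (y i j w * y i' j' w + - mean M i' j' 0 * y i j w) +
      (- mean M i j 0 * y i' j' w + mean M i j 0 * mean M i' j' 0)).
  by apply/funext => w; ring.
apply: intbleD; first by apply: intbleD; [exact: y_intble2 | apply: intbleZ; exact: y_intble].
by apply: intbleD; [apply: intbleZ; exact: y_intble | exact: intble_cst].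
Qed.

Lemma model_eps_mean s : Ex P (model_eps s) = 0.
Proof.
elim/(@Rank_ind n (nobs M)): s => i j; rewrite model_eps_Rank ExD; last 2 first.
- exact: y_intble.
- exact: intble_cst.
by rewrite Ex_y Ex_cst subrr.
Qed.

Lemma model_eps_cov s t : subject M s = subject M t ->
  Ex P (fun w => model_eps s w * model_eps t w) = Sigmamx M s t.
Proof.
elim/(@Rank_ind n (nobs M)): s => i j; elim/(@Rank_ind n (nobs M)): t => i' j'; rewrite !subject_Rank => e.
case: _ / e j' => k; rewrite /Sigmamx mxdiag_Rank !model_eps_Rank.
have := y_cov i j k; rewrite unlock !y_mean /= => e.
by rewrite /Ex /Rintegral -[RHS]/(fine (ycov M i j k)%:E) -e unlock.
Qed.

Lemma model_eps_Fmeas s : Fmeas response_events (subject M s) (model_eps s).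
Proof.
elim/(@Rank_ind n (nobs M)): s => i j; rewrite subject_Rank model_eps_Rank.
apply: FmeasD; last exact: Fmeas_cst.
move=> _ B mB; apply: sub_sigma_algebra.
rewrite /response_events (bigD1 j) //=; left.
by exists B.
Qed.

Lemma response_events_measurable i : response_events i `<=` measurable.
Proof.
rewrite /response_events; elim/big_ind: _ => [|A B hA hB|j _].
- exact: sub0set.
- by move=> E [/hA|/hB].
- by move=> _ [B mB <-]; exact: measurable_funPT.
Qed.

Lemma measurable_model_eps : measurable_vec (evec model_eps).
Proof.
move=> s; under eq_fun do rewrite mxE.
exact: intble_measurable (model_eps_intble s).
Qed.

Lemma qform_Sigmamx (v : 'cV[R]_(ntot M)) i : gproj (subject M) i *m v = v ->
  qform (Sigmamx M) v = qform (ycov M i) (submxcol v i) /\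
  forall u : responses M, dot v (\mxcol_j u j) = dot (submxcol v i) (u i).
Proof.
move=> vi; have v0 j : j != i -> submxcol v j = 0.
  move=> ji; rewrite -vi -[v in gproj _ _ *m v]submxcolK gproj_mxcol mxcolK.
  by rewrite (negPf ji).
split=> [|u]; rewrite -[v in LHS]submxcolK.
  rewrite qform_mxdiag (bigD1 i) //= big1 ?addr0 // => j /v0 ->.
  by rewrite qformE mulmx0 dot0r.
by rewrite dot_mxcol (bigD1 i) //= big1 ?addr0 // => j /v0 ->; rewrite dot0l.
Qed.

(** For v supported on subject i, v.eps equals z.e_i with z = Sigma_i^(1/2) v_i, and |z|^2 is the
    form of Sigma at v. Condition 1 for z / |z| gives the bound by homogeneity. *)
Lemma model_eps_fourth (K : R) :
  (forall i (u : 'cV[R]_(nobs M i)), (u^T *m u) 0 0 = 1 ->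
     ('E_P[fun w => ((u^T *m standardized (observed y w) i) 0 0 ^+ 4)%R] <= K%:E)%E) ->
  forall i v, gproj (subject M) i *m v = v ->
    intble P (fun w => dot v (evec model_eps w) ^+ 4) /\
    Ex P (fun w => dot v (evec model_eps w) ^+ 4) <= K * qform (Sigmamx M) v ^+ 2.
Proof.
move=> E4 i v vi; have [-> dotv] := qform_Sigmamx vi.
have [Bpd BB uB] := sqrtmxP (ycov_pd i); set B := sqrtmx (ycov M i) in Bpd BB uB.
have [BT _] := Bpd; set z := B *m submxcol v i.
have -> : qform (ycov M i) (submxcol v i) = dot z z.
  by rewrite -BB qformE /z [RHS]dot_mulmxl BT mulmxA.
have hE w : dot v (evec model_eps w) = dot z (standardized (observed y w) i).
  by rewrite evec_model_eps dotv /z /standardized -/B dot_mulmxl BT mulKVmx.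
have mh : measurable_fun setT (fun w => dot v (evec model_eps w)).
  by apply: measurable_dot; [move=> s; exact: measurable_cst | exact: measurable_model_eps].
have [z0|z0] := eqVneq z 0.
  have -> : (fun w => dot v (evec model_eps w) ^+ 4) = fun=> 0.
    by apply/funext => w; rewrite hE z0 dot0l expr0n.
  by rewrite Ex_cst z0 dot0l expr0n mulr0; split=> //; exact: intble_cst.
have q0 : 0 < dot z z by rewrite lt_def dot_ge0 dot_eq0 z0.
pose c := (Num.sqrt (dot z z))^-1.
have c4 : c ^+ 4 = (dot z z ^+ 2)^-1.
  by rewrite exprVn (exprM _ 2 2) sqr_sqrtr // ltW.
have c2 : c ^+ 2 * dot z z = 1 by rewrite exprVn sqr_sqrtr ?ltW // mulVf ?gt_eqF.
have := E4 i (c *: z); rewrite -[(_ *m _) 0 0]/(dot _ _) dotZl dotZr mulrA -expr2.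
move=> /(_ c2); rewrite unlock.
have -> : (fun w => ((((c *: z)^T *m standardized (observed y w) i) 0 0) ^+ 4)%:E) =
    (fun w => (c ^+ 4 * dot v (evec model_eps w) ^+ 4)%:E).
  apply/funext => w; congr (_%:E).
  by rewrite -[(_ *m _) 0 0]/(dot _ _) dotZl -hE exprMn.
move=> h; have [|w|I1 E1] := intble_ge0 _ _ h.
- by apply: measurable_funM => //; exact: measurable_funX.
- by rewrite -exprMn -[4%N]/(2 * 2)%N exprM sqr_ge0.
have e : (fun w => dot v (evec model_eps w) ^+ 4) =
    (fun w => dot z z ^+ 2 * (c ^+ 4 * dot v (evec model_eps w) ^+ 4)).
  by apply/funext => w; rewrite c4 mulrA mulfV ?mul1r // expf_neq0 // gt_eqF.
rewrite e; split; first exact: intbleZ.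
by rewrite ExZ // mulrC ler_wpM2r // sqr_ge0.
Qed.

Lemma model_grouped_noise (K : R) :
  (forall i (u : 'cV[R]_(nobs M i)), (u^T *m u) 0 0 = 1 ->
     ('E_P[fun w => ((u^T *m standardized (observed y w) i) 0 0 ^+ 4)%R] <= K%:E)%E) ->
  grouped_noise P response_events (subject M) model_eps (Sigmamx M) K.
Proof.
move=> E4; split.
- exact: response_events_measurable.
- exact: y_indep.
- exact: model_eps_Fmeas.
- exact: model_eps_intble.
- exact: model_eps_intble2.
- exact: model_eps_mean.
- exact: model_eps_cov.
- exact: Sigmamx_pd.
- exact: Sigmamx_gdiag.
- exact: model_eps_fourth.
Qed.

End model_noise.

(** * The bound for the model at a fixed number of subjects *)

Section model_bound.
Context {R : realType} {n : nat} (M : model R n).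
Hypothesis ycov_pd : forall i, posdefmx (ycov M i).
Hypothesis wcorr_pd : forall i, posdefmx (wcorr M i).
Hypothesis penalty_psd : forall k, possemidefmx (penalty M k).
Hypothesis lam_ge0 : forall k, 0 <= lam M k.
Hypothesis gram_unit : penalized_gram M \in unitmx.

Local Notation W := (Wmx M).
Local Notation A := (Amx M).
Local Notation Sg := (Sigmamx M).
Local Notation condW := (lambda_max (Wmx M) * lambda_max (invmx (Wmx M))).

Lemma max_trA_ge0 : 0 <= max_trA M. Proof. exact: bigmax_ge_id. Qed.

Lemma mxtrace_Amx_ge0 : 0 <= \tr A.
Proof.
rewrite AmxE; apply: tr_psdM_ge0; first exact: Smx_psd.
exact: pd_psd (pd_inv (Wmx_pd wcorr_pd)).
Qed.

(* The absolute values and the existential quantifiers are for the case where there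
   is no observation at all, in which lambda_max returns the junk value sup set0. *)
Lemma model_smoother : exists s w v,
  [/\ smoother (subject M) (Smx M) W A Sg s w v (max_trA M) (max_trC M),
      s * w <= `|xi M| & w * v <= `|condW|].
Proof.
have Wpd := Wmx_pd wcorr_pd; have Jpd := pd_inv Wpd.
have Sgpd := Sigmamx_pd ycov_pd.
have a_max i : \tr (gproj (subject M) i *m A) <= max_trA M.
  by rewrite -mxtrace_Ablock; exact: le_bigmax.
have c_max i : \tr (gproj (subject M) i *m (A *m A)) <= max_trC M.
  by rewrite -mxtrace_Cblock //; exact: le_bigmax.
have [[x x0]|none] := pselect (exists x : 'cV[R]_(ntot M), x != 0); last first.
  have x0 (x : 'cV[R]_(ntot M)) : x = 0.
    by apply/eqP; apply: contraT => x0; case: none; exists x.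
  exists 0, 1, 0; rewrite mul0r mulr0 !normr_ge0; split=> //; split=> //.
  - exact: Wmx_gdiag.
  - exact: Sigmamx_gdiag.
  - exact: Smx_psd.
  - by move=> x; exact: Smx_smoother.
  - by move=> x; rewrite (x0 x) qformE mulmx0 dot0r mul0r.
  - by move=> x; rewrite (x0 x) qformE mulmx0 dot0r mulr0.
  - by move=> x; rewrite (x0 x) qformE mulmx0 dot0r mul0r.
  - exact: max_trA_ge0.
have Sg_le u : qform Sg u <= lambda_max (Sg *m invmx W) * qform W u.
  by apply: lambda_max_rayleigh => //; case: Sgpd.
have W_le u : qform W u <= lambda_max W * dot u u.
  by apply: lambda_maxP; case: Wpd.
have J_le u : qform (invmx W) u <= lambda_max (invmx W) * dot u u.
  by apply: lambda_maxP; case: Jpd.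
have xx : 0 < dot x x by rewrite lt_def dot_ge0 dot_eq0 x0.
have s0 : 0 <= lambda_max (Sg *m invmx W).
  rewrite -(pmulr_lge0 _ (Wpd.2 _ x0)); apply: le_trans (Sg_le x).
  exact: psd_ge0 (pd_psd Sgpd).
have w0 : 0 < lambda_max W.
  by rewrite -(pmulr_lgt0 _ xx); apply: lt_le_trans (W_le x); case: Wpd => _; apply.
have v0 : 0 < lambda_max (invmx W).
  by rewrite -(pmulr_lgt0 _ xx); apply: lt_le_trans (J_le x); case: Jpd => _; apply.
exists (lambda_max (Sg *m invmx W)), (lambda_max W), (lambda_max (invmx W)).
split; [|exact: ler_norm|exact: ler_norm].
have Spsd := Smx_psd wcorr_pd penalty_psd lam_ge0 gram_unit.
have SJS u := Smx_smoother wcorr_pd penalty_psd lam_ge0 gram_unit u.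
exact: (Smoother (AmxE M) Wpd Sgpd (@Wmx_gdiag _ _ M) (@Sigmamx_gdiag _ _ M) Spsd SJS s0 w0
  (ltW v0) Sg_le W_le J_le max_trA_ge0 a_max c_max).
Qed.

Context {d : measure_display} {T : measurableType d}.
Variables (P : probability T R) (y : forall i : 'I_n, 'I_(nobs M i) -> {RV P >-> R}).
Arguments y : clear implicits.
Variable betahat : 'I_n -> T -> 'cV[R]_(pdim M).
Hypothesis y_L2 : forall i j, (y i j : T -> R) \in Lfun P 2%:E.
Hypothesis y_mean : forall i j, ('E_P[y i j] = (mean M i j 0)%:E)%E.
Hypothesis y_cov : forall i j k, covariance P (y i j) (y i k) = (ycov M i j k)%:E.
Hypothesis y_indep : independent_vectors y.
Hypothesis betahat_min : forall i w, lso_minimizer (observed y w) i (betahat i w).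
Variable K : R.
Hypothesis K_ge0 : 0 <= K.
Hypothesis y_fourth : forall i (u : 'cV[R]_(nobs M i)), (u^T *m u) 0 0 = 1 ->
  ('E_P[fun w => ((u^T *m standardized (observed y w) i) 0 0 ^+ 4)%R] <= K%:E)%E.

Local Notation k := (n%:R^-1 : R).
Local Notation ev := (evec (model_eps y)).
Local Notation tau := (\tr (A^T *m A *m Sg)).

Let b := muv M - A *m muv M.
Let l w := A *m ev w - b.
Let Y w := \mxcol_i observed y w i.

Let evE w : ev w = Y w - muv M.
Proof. by rewrite evec_model_eps /Y /muv -mxcolB. Qed.

Let lE w : l w = A *m Y w - muv M.
Proof. by rewrite /l evE mulmxBr /b opprB addrA subrK. Qed.

Let evlE w : ev w - l w = Y w - A *m Y w.
Proof. by rewrite lE evE opprB addrA subrK. Qed.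

Let noise_y : grouped_noise P (response_events y) (subject M) (model_eps y) Sg K.
Proof. exact: model_grouped_noise. Qed.

Lemma model_risk : risk y = k * dot b b + k * tau.
Proof.
rewrite /risk unlock -[LHS]/(Ex P (fun w => loss (observed y w))).
have -> : (fun w => loss (observed y w)) =
    (fun w => k * dot (ev w) (A^T *m A *m ev w) + ((- 2 * k) * dot (A^T *m b) (ev w) + k * dot b b)).
  apply/funext => w; rewrite /loss sqnormE -/(Y w) -lE /l.
  have sq (p q : 'cV[R]_(ntot M)) : dot (p - q) (p - q) = dot p p - 2 * dot q p + dot q q.
    by rewrite dotBl !dotBr (dotC p q); ring.
  by rewrite sq (dot_mulmxl A^T) trmxK (dot_mulmxl A) mulmxA; ring.
have [I1 E1] := Ex_linform noise_y (A^T *m b).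
have I2 := intble_qform noise_y (A^T *m A).
rewrite ExD; [|exact: intbleZ|apply: intbleD; [exact: intbleZ | exact: intble_cst]].
rewrite ExD; [|exact: intbleZ|exact: intble_cst].
by rewrite (ExZ _ I1) (ExZ _ I2) E1 (Ex_qform noise_y) Ex_cst; ring.
Qed.

Lemma risk_ge_tau : k * tau <= risk y.
Proof. by rewrite model_risk lerDr mulr_ge0 ?dot_ge0 // invr_ge0. Qed.

Lemma model_core_bound (gam e delta eta : R) :
  max_trA M <= 2^-1 -> max_trC M <= 1 -> 0 <= gam <= 1 ->
  k * `|xi M| <= gam * risk y ->
  `|xi M| * max_trA M * (k * \tr A) <= gam * risk y ->
  (1 + `|condW|) * max_trA M ^+ 2 <= gam ->
  0 < delta <= 8^-1 -> 0 < eta ->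
  (92 + 4 / eta) * delta + 2 * eta + gam / eta + 32 * gam <= e ->
  let L w := loss (observed y w) in
  let U w := Ucrit (observed y w) in
  let CV w := lsocv (observed y w) (betahat ^~ w) in
  (P [set w | (e * `|L w| < `|CV w - U w|)%R] <= (9 * ((2 + K) * gam / delta ^+ 2))%:E)%E /\
  (P [set w | (e * `|L w| < `|CV w - L w - noise (observed y w)|)%R]
    <= (9 * ((2 + K) * gam / delta ^+ 2))%:E)%E.
Proof.
move=> a2 c1 /andP[g0 g1] xi_le xia_le th_le /andP[d0 d8] eta0 bud L U CV.
have [s [w [v [HS sw wv]]]] := model_smoother.
pose r o := \mxcol_i (observed y o i - design M i *m betahat i o).
have k0 : 0 <= k by rewrite invr_ge0.
have uA := unit_1_gpart HS a2.
have rE o : (1%:M - gpart (subject M) A) *m r o = ev o - l o.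
  by rewrite evlE; apply: lso_residual_eq => // i; exact: betahat_min.
have mev := measurable_model_eps y_L2.
(* The minimizers are arbitrary functions of the outcome; measurability of the residuals comes from
   solving the linear equation they satisfy. *)
have mr : measurable_vec r.
  have -> : r = fun o => invmx (1%:M - gpart (subject M) A) *m (ev o - l o).
    by apply/funext => o; rewrite -rE mulKmx.
  apply: measurable_mulmx; apply: measurable_vecB => //.
  apply: measurable_vecB; first exact: measurable_mulmx.
  by move=> i; exact: measurable_cst.
have a0 := max_trA_ge0; have t0 := mxtrace_Amx_ge0.
apply: (core_bound noise_y HS (b := b) (r := r) (k := k) (risk0 := risk y) (l := l)
  (L := L) (CV := CV) (U := U) (Noise := fun w => noise (observed y w))
  _ _ _ _ _ _ _ _ _ K_ge0 a2 g0 g1 c1 _ _ _ d0 d8 eta0 bud) => //.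
- exact: measurable_dot.
- exact: model_risk.
- by move=> o; rewrite /L /loss sqnormE lE.
- by move=> o; rewrite /CV /lsocv dot_mxcol.
- move=> o; rewrite /U /Ucrit evlE -/(Y o); congr (_ + _).
  have -> : Y o - A *m Y o = (1%:M - A) *m Y o by rewrite mulmxBl mul1mx.
  by rewrite /dot trmx_mul !mulmxA.
- by move=> o; rewrite /noise sqnormE evE.
- exact: le_trans (ler_wpM2l k0 sw) xi_le.
- exact: le_trans (ler_wpM2r (mulr_ge0 k0 t0) (ler_wpM2r a0 sw)) xia_le.
- by apply: le_trans th_le; rewrite ler_wpM2r ?sqr_ge0 // lerD2l.
Qed.

End model_bound.

(** * Asymptotics *)

(** Covers the degenerate case of Condition 4: with a zero denominator its quotient is 0 by
    convention and carries no information, but then A = 0 and tr A = 0. The trace is the sum of the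
    values of the form Sg at the rows of A. *)
Lemma mxtrace_AtASg_eq0 (R : realType) (N : nat) (A Sg : 'M[R]_N) :
  posdefmx Sg -> \tr (A^T *m A *m Sg) = 0 -> A = 0.
Proof.
move=> Sgpd; have q0 := psd_ge0 _ (pd_psd Sgpd).
rewrite -mulmxA mxtrace_mulC -{1}(trmxK A) trM_sum_qform => /eqP.
rewrite psumr_eq0 // => /allP cols; apply: trmx_inj; rewrite trmx0.
apply/matrixP => s t; have /eqP qt := cols t (mem_index_enum t).
have /eqP : col t A^T == 0.
  apply: contraT => c0; case: Sgpd => _ /(_ _ c0).
  by rewrite qt ltxx.
by move=> /matrixP/(_ s 0); rewrite !mxE.
Qed.

Lemma cvge0_le (R : realType) (u : nat -> \bar R) : (forall n, 0 <= u n)%E ->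
  (forall e : R, 0 < e -> \forall n \near \oo, (u n <= e%:E)%E) -> u n @[n --> \oo] --> 0%E.
Proof.
move=> u0 ule; have ufin e n : (u n <= e%:E)%E -> u n \is a fin_num.
  by move=> h; rewrite ge0_fin_numE //; exact: le_lt_trans h (ltry _).
apply/fine_cvgP; split.
  by apply: filterS (ule 1 ltr01) => n; exact: ufin.
apply/cvgr0Pnorm_le => e /ule; apply: filterS => n une /=.
have un := ufin _ _ une; rewrite ger0_norm ?fine_ge0 //.
by rewrite -lee_fin fineK.
Qed.

Lemma littleo1_le (R : realType) (u : nat -> R) : u =o_\oo (fun=> 1 : R) ->
  forall e, 0 < e -> \forall n \near \oo, `|u n| <= e.
Proof.
by move=> /eqoP uo e /uo; apply: filterS => n; rewrite normr1 mulr1.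
Qed.

(** The choice is successive: eta from e, then delta from e and eta, then gam from all of them and
    p. The four terms get e/4, e/4, e/8 and e/8. *)
Lemma budget_choice (R : realType) (e p K : R) : 0 < e -> 0 < p -> 0 <= K ->
  exists delta eta gam, [/\ 0 < delta <= 8^-1, 0 < eta, 0 < gam <= 1,
    (92 + 4 / eta) * delta + 2 * eta + gam / eta + 32 * gam <= e &
    9 * ((2 + K) * gam / delta ^+ 2) <= p].
Proof.
move=> e0 p0 K0; pose eta := e / 8; have eta0 : 0 < eta by rewrite divr_gt0.
have B0 : 0 < 92 + 4 / eta by rewrite addr_gt0 // divr_gt0.
pose delta := Num.min 8^-1 (e / 4 / (92 + 4 / eta)).
have delta0 : 0 < delta by rewrite lt_min invr_gt0 ltr0n /= !divr_gt0.
pose gam := Num.min (Num.min 1 (e / 8 * eta))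
  (Num.min (e / 8 / 32) (p * delta ^+ 2 / (9 * (2 + K)))).
have K2 : 0 < 2 + K by rewrite ltr_pwDl.
have gam0 : 0 < gam.
  have q1 : 0 < e / 8 * eta by rewrite mulr_gt0 // divr_gt0.
  have q2 : 0 < e / 8 / 32 by rewrite divr_gt0.
  have q3 : 0 < p * delta ^+ 2 / (9 * (2 + K)) by rewrite divr_gt0 ?mulr_gt0 ?exprn_gt0.
  by rewrite !lt_min ltr01 q1 q2 q3.
have [g1 g2 g3 g4] : [/\ gam <= 1, gam <= e / 8 * eta, gam <= e / 8 / 32 &
    gam <= p * delta ^+ 2 / (9 * (2 + K))] by split; rewrite !ge_min lexx ?orbT.
exists delta, eta, gam; split => //.
- by rewrite delta0 ge_min lexx.
- by rewrite gam0.
- have h1 : (92 + 4 / eta) * delta <= e / 4.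
    by rewrite mulrC -ler_pdivlMr // ge_min lexx orbT.
  have h2 : gam / eta <= e / 8 by rewrite ler_pdivrMr.
  have h3 : 2 * eta = e / 4 by rewrite /eta; field.
  lra.
- have -> : 9 * ((2 + K) * gam / delta ^+ 2) = gam * (9 * (2 + K)) / delta ^+ 2 by ring.
  by rewrite ler_pdivrMr ?exprn_gt0 // -ler_pdivlMr // mulr_gt0.
Qed.

(** Turns Conditions 2(i), 4 and 5 at one n into the smallness hypotheses of the fixed n bound. Here
    k is 1/n, t is tr A, x is xi, cw is the condition number of W, and C is the constant of the O in
    Condition 2. *)
Lemma rates_small (R : realType) (C gam a x k t tau risk0 cw : R) :
  0 < C -> 0 < gam <= 1 -> 0 <= a -> 0 <= t -> 0 <= k -> 0 <= tau ->
  (tau = 0 -> t = 0) -> k * tau <= risk0 ->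
  `|a| <= C * `|t * k| -> `|t * k| <= gam / 2 / C ->
  `|x * (k * t) ^+ 2 / (k * tau)| <= gam / C ->
  `|cw * (k ^+ 2 * t ^+ 2)| <= gam / 2 / C ^+ 2 ->
  [/\ a <= 2^-1, `|x| * a * (k * t) <= gam * risk0 & (1 + `|cw|) * a ^+ 2 <= gam].
Proof.
move=> C0 /andP[g0 g1] a0 t0 k0 tau0 t_eq0 tau_le.
rewrite -exprMn (mulrC k t); set u := t * k; have u0 : 0 <= u by rewrite mulr_ge0.
rewrite (ger0_norm a0) (ger0_norm u0) => aC uC; rewrite (normrM cw) => hx hcw.
have Cu : C * u <= gam / 2 by rewrite mulrC -ler_pdivlMr.
have ag : a <= gam / 2 := le_trans aC Cu.
have a2 : a <= 2^-1 by lra.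
have u2 : `|u ^+ 2| = u ^+ 2 by rewrite ger0_norm ?sqr_ge0.
split=> //.
(* If k tau = 0, the quotient of Condition 4 is a division by 0; then k t = 0 and the claim is
   trivial. *)
- have [ktau|ktau] := eqVneq (k * tau) 0.
    have -> : u = 0.
      move/eqP: ktau; rewrite mulf_eq0 /u => /orP[/eqP ->|/eqP/t_eq0 ->].
        by rewrite mulr0.
      by rewrite mul0r.
    by rewrite mulr0 mulr_ge0 ?(ltW g0) // -ktau.
  have ktau0 : 0 < k * tau by rewrite lt_def ktau mulr_ge0.
  move: hx; rewrite normf_div (normrM x) u2 (gtr0_norm ktau0) ler_pdivrMr // => hx.
  (* Since a <= C u, the product is at most C |x| u^2, which Condition 4 with threshold gam / C
     bounds by gam k tau. *)
  apply: le_trans (_ : C * (`|x| * u ^+ 2) <= _).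
    rewrite [leRHS](_ : _ = `|x| * (C * u) * u); last by ring.
    by rewrite ler_wpM2r // ler_wpM2l.
  apply: le_trans (_ : gam * (k * tau) <= _); last by rewrite ler_wpM2l ?(ltW g0).
  by rewrite mulrC -ler_pdivlMr // mulrAC.
- have h1 : a ^+ 2 <= gam / 2.
    rewrite expr2; apply: le_trans (_ : 1 * a <= _); last by rewrite mul1r.
    by rewrite ler_wpM2r //; lra.
  have h2 : `|cw| * a ^+ 2 <= gam / 2.
    apply: le_trans (_ : `|cw| * u ^+ 2 * C ^+ 2 <= _); last first.
      by rewrite -ler_pdivlMr ?exprn_gt0 // -u2.
    rewrite -mulrA ler_wpM2l // -exprMn mulrC ler_pXn2r ?nnegrE //.
    by rewrite mulr_ge0 ?(ltW C0).
  by rewrite mulrDl mul1r; lra.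
Qed.

Theorem theorem2p2 (R : realType) (d : nat -> measure_display)
  (T : forall n, measurableType (d n)) (P : forall n, probability (T n) R)
  (M : forall n, model R n)
  (y : forall n (i : 'I_n), 'I_(nobs (M n) i) -> {RV (P n) >-> R})
  (betahat : forall n, 'I_n -> T n -> 'cV[R]_(pdim (M n)))
  (* the model *)
  (ycov_pd : forall n i, posdefmx (ycov (M n) i))
  (y_L2 : forall n i j, (y n i j : T n -> R) \in Lfun (P n) 2%:E)
  (y_mean : forall n i j, ('E_(P n)[y n i j] = (mean (M n) i j 0)%:E)%E)
  (y_cov : forall n i j k,
     covariance (P n) (y n i j) (y n i k) = (ycov (M n) i j k)%:E)
  (y_indep : forall n, independent_vectors (y n))
  (* the estimators *)
  (wcorr_pd : forall n i, posdefmx (wcorr (M n) i))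
  (penalty_psd : forall n (k : 'I_(ncomp (M n))), possemidefmx (penalty (M n) k))
  (lam_ge0 : forall n (k : 'I_(ncomp (M n))), 0 <= lam (M n) k)
  (gram_unit : forall n, penalized_gram (M n) \in unitmx)
  (betahat_min : forall n i w,
     lso_minimizer (observed (y n) w) i (betahat n i w))
  (* Conditions 1 to 5 *)
  (cond1 : exists2 K : R, 0 < K & forall n i (u : 'cV[R]_(nobs (M n) i)),
     (u^T *m u) 0 0 = 1 ->
     ('E_(P n)[fun w =>
        ((u^T *m standardized (observed (y n) w) i) 0 0 ^+ 4)%R] <= K%:E)%E)
  (cond2i_O : (fun n => max_trA (M n))
     =O_\oo (fun n => \tr (Amx (M n)) / n%:R))
  (cond2i_o : (fun n => \tr (Amx (M n)) / n%:R) =o_\oo (fun=> 1 : R))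
  (cond2ii : (fun n => max_trC (M n)) =o_\oo (fun=> 1 : R))
  (cond3 : (fun n => xi (M n) / n%:R) =o_\oo (fun n => risk (y n)))
  (cond4 : (fun n => xi (M n) * (n%:R^-1 * \tr (Amx (M n))) ^+ 2
       / (n%:R^-1 * \tr ((Amx (M n))^T *m Amx (M n) *m Sigmamx (M n))))
     =o_\oo (fun=> 1 : R))
  (cond5 : (fun n => lambda_max (Wmx (M n)) * lambda_max (invmx (Wmx (M n)))
       * (n%:R ^- 2 * \tr (Amx (M n)) ^+ 2))
     =o_\oo (fun=> 1 : R)) :
  let L n w := loss (observed (y n) w) in
  let U n w := Ucrit (observed (y n) w) in
  let LsoCV n w := lsocv (observed (y n) w) (fun i => betahat n i w) in
  little_op P (fun n w => LsoCV n w - U n w) L /\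
  little_op P (fun n w => LsoCV n w - L n w - noise (observed (y n) w)) L.
Proof.
move=> L U LsoCV.
have [K K0 y_fourth] := cond1.
have /eqO_exP[C C0 hO] := cond2i_O.
have small (e p : R) : 0 < e -> 0 < p -> \forall n \near \oo,
    (P n [set w | (e * `|L n w| < `|LsoCV n w - U n w|)%R] <= p%:E)%E /\
    (P n [set w | (e * `|L n w| < `|LsoCV n w - L n w - noise (observed (y n) w)|)%R]
      <= p%:E)%E.
  (* All parameters are fixed before n grows; the conditions are then used at finitely many
     thresholds, which hold simultaneously for large n. *)
  move=> e0 p0; have [delta [eta [gam [hdelta eta0 hgam bud hp]]]] := budget_choice e0 p0 (ltW K0).
  have [g0 g1] := andP hgam.
  have h2i := littleo1_le cond2i_o; have h2ii := littleo1_le cond2ii.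
  have h4 := littleo1_le cond4; have h5 := littleo1_le cond5.
  have /eqoP h3 := cond3.
  have r1 : 0 < gam / 2 / C by rewrite !divr_gt0.
  have r2 : 0 < gam / C by rewrite divr_gt0.
  have r3 : 0 < gam / 2 / C ^+ 2 by rewrite !divr_gt0 ?exprn_gt0.
  near=> n.
  have k0 : 0 <= n%:R^-1 :> R by rewrite invr_ge0.
  have t0 := mxtrace_Amx_ge0 (@wcorr_pd n) (@penalty_psd n) (@lam_ge0 n) (@gram_unit n).
  have Sgpd := Sigmamx_pd (@ycov_pd n).
  have tau0 : 0 <= \tr ((Amx (M n))^T *m Amx (M n) *m Sigmamx (M n)).
    rewrite -mulmxA mxtrace_mulC tr_psd_ge0 //; exact: psd_congrT (pd_psd Sgpd).
  have tau_risk := risk_ge_tau (@ycov_pd n) (@y_L2 n) (@y_mean n) (@y_cov n) (@y_indep n)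
    (@y_fourth n).
  have risk0 : 0 <= risk (y n) by apply: le_trans tau_risk; exact: mulr_ge0.
  have [a2 xia th] : [/\ max_trA (M n) <= 2^-1,
      `|xi (M n)| * max_trA (M n) * (n%:R^-1 * \tr (Amx (M n))) <= gam * risk (y n) &
      (1 + `|lambda_max (Wmx (M n)) * lambda_max (invmx (Wmx (M n)))|)
        * max_trA (M n) ^+ 2 <= gam].
    apply: (rates_small C0 hgam (max_trA_ge0 (M n)) t0 k0 tau0 _ tau_risk).
    - by move/(mxtrace_AtASg_eq0 Sgpd) => ->; rewrite mxtrace0.
    - by near: n.
    - by near: n; exact: h2i.
    - by near: n; exact: h4.
    - by rewrite exprVn; near: n; exact: h5.
  have c1 : max_trC (M n) <= 1.
    apply: le_trans (ler_norm _) _.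
    by near: n; exact: h2ii.
  have xi_le : n%:R^-1 * `|xi (M n)| <= gam * risk (y n).
    have -> : n%:R^-1 * `|xi (M n)| = `|xi (M n) / n%:R|.
      by rewrite (normrM (xi (M n)) n%:R^-1) (ger0_norm k0) mulrC.
    by rewrite -(ger0_norm risk0); near: n; exact: h3.
  have [b1 b2] := model_core_bound (@ycov_pd n) (@wcorr_pd n) (@penalty_psd n) (@lam_ge0 n)
    (@gram_unit n) (@y_L2 n) (@y_mean n) (@y_cov n) (@y_indep n) (@betahat_min n) (ltW K0)
    (@y_fourth n) a2 c1 (introT andP (conj (ltW g0) g1)) xi_le xia th hdelta eta0 bud.
  by split; [apply: le_trans b1 _ | apply: le_trans b2 _]; rewrite lee_fin.
split=> e e0; apply: cvge0_le => // p p0.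
- by apply: filterS (small e p e0 p0) => n [].
- by apply: filterS (small e p e0 p0) => n [].
Unshelve. all: by end_near.
Qed.
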